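(* Let $U$ be an $N\times N$ Haar-distributed unitary matrix (a $\mathrm{CUE}(N)$ matrix) and let $v\in\mathbb{C}^N$ be a unit vector independent of $U$. Then the regularity assumption on $\mathscr{W}_2$ and the regularity assumption on $\omega_1^{(N)}$ (both stated in the context) hold. More precisely, $$\omega_1^{(N)}:=\sqrt N\,v^*U^*v\ \overset{d}{=}\ \sqrt N\,e^{\mathrm{i}\theta}\sqrt{\beta_{1,N}}\ \asymp\ 1,$$ where $\theta$ is uniform and $\beta_{1,N}$ is an independent Beta$(1,N)$ random variable, and for any $\delta>0$, the stochastic domination $$\mathscr{W}_2(z):=v^*\frac{(zU^* )^2}{I_N-zU^*}v\ \prec\ \frac{|z|^2}{\sqrt N(1-|z|)}$$ holds uniformly in $z$ with $1-|z|>N^{-\delta}$.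
   Context: $\mathbb{D}$ is the open unit disk and $D(z_0,r)$ the open disk of center $z_0$ and radius $r$. The expression $\frac{(zU^* )^2}{I_N-zU^*}$ denotes $(zU^* )^2(I_N-zU^* )^{-1}$; $\overset{d}{=}$ is equality in distribution; $\asymp 1$ means of order one. A sequence of events $\Omega^{(N)}$ holds with high probability if $\mathbb{P}(\Omega^{(N)})\to1$ as $N\to\infty$; it holds with overwhelming probability if for every $A>0$, $1-\mathbb{P}(\Omega^{(N)})<N^{-A}$ for all large enough $N$. Stochastic domination: for families $X^{(N)}(z),Y^{(N)}(z)$ of complex random variables indexed by $N$ and $z\in\mathbb{D}$, and sets $\mathscr{S}^{(N)}\subset\mathbb{D}$, ''$X\prec Y$ uniformly for $z\in\mathscr{S}^{(N)}$'' means that for every $\epsilon>0$, with overwhelming probability, $|X^{(N)}(z)|\le N^\epsilon|Y^{(N)}(z)|$ for all $z\in\mathscr{S}^{(N)}$. Regularity assumption on $\mathscr{W}_2$: for any $\delta>0$, $\mathscr{W}_2(z)\prec\frac{|z|^2}{\sqrt N(1-|z|)}$ uniformly for $z\in D(0,1-N^{-\delta})$. Regularity assumption on $\omega_1^{(N)}$: for any $\epsilon>0$, $N^{\epsilon}>|\omega_1^{(N)}|>N^{-\epsilon}$ holds with high probability.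
   Formalization: Beta(1,N) is replaced by Beta(1,N-1), and the equality in law is stated for N ≥ 2 only: |v*U*v|² has mean 1/N while Beta(1,N) has mean 1/(N+1), and for N = 1 it equals 1, so the law as printed is false. *)

(* Defs.v *)
From HB Require Import structures.
From mathcomp Require Import all_boot all_order all_algebra.
From mathcomp Require Import all_classical all_reals all_analysis.
From mathcomp Require Export complex.

Set Implicit Arguments.
Unset Strict Implicit.
Unset Printing Implicit Defensive.

Import Order.TTheory GRing.Theory Num.Theory.
Import numFieldNormedType.Exports.

Local Open Scope classical_set_scope.
Local Open Scope ring_scope.
Local Open Scope complex_scope.
Local Open Scope sesquilinear_scope.

(* The Borel sigma-algebra of the complex plane, identified with R * R. *)
Section complex_measurable.
Context {R : realType}.

Definition complex_pair (z : R[i]) : R * R := (complex.Re z, complex.Im z).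

Definition complex_sets : set (set R[i]) :=
  preimage_set_system setT complex_pair measurable.

Let complex_sets0 : complex_sets set0.
Proof. by exists set0 => //; rewrite preimage_set0 setI0. Qed.

Let complex_setsC A : complex_sets A -> complex_sets (~` A).
Proof.
by move=> [B mB <-]; exists (~` B); rewrite ?setTI//; exact: measurableC.
Qed.

Let complex_sets_bigcup (F : (set R[i])^nat) :
  (forall k, complex_sets (F k)) -> complex_sets (\bigcup_k F k).
Proof.
move=> /(_ _)/cid2-/all_sig2[B mB BF]; exists (\bigcup_k B k).
  exact: bigcupT_measurable.
rewrite setTI preimage_bigcup; apply: eq_bigcupr => k _.
by rewrite -BF setTI.
Qed.

HB.instance Definition _ := isPointed.Build R[i] 0.

HB.instance Definition _ := @isMeasurable.Build default_measure_display
  R[i] complex_sets complex_sets0 complex_setsC complex_sets_bigcup.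

End complex_measurable.

(* The sigma-algebra on complex matrices generated by the entries; it is the
   Borel sigma-algebra of the finite-dimensional space of matrices. *)
Section matrix_measurable.
Context {R : realType} {m n : nat}.

Definition mx_sets : set (set 'M[R[i]]_(m, n)) :=
  <<s \bigcup_(ij in [set: 'I_m * 'I_n])
        preimage_set_system setT (fun M : 'M[R[i]]_(m, n) => M ij.1 ij.2)
          measurable >>.

Let mx_sets0 : mx_sets set0.
Proof. exact: sigma_algebra0. Qed.

Let mx_setsC A : mx_sets A -> mx_sets (~` A).
Proof. exact: sigma_algebraC. Qed.

Let mx_sets_bigcup (F : (set 'M[R[i]]_(m, n))^nat) :
  (forall k, mx_sets (F k)) -> mx_sets (\bigcup_k F k).
Proof. exact: sigma_algebra_bigcup. Qed.

HB.instance Definition _ := @isMeasurable.Build default_measure_display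
  'M[R[i]]_(m, n) mx_sets mx_sets0 mx_setsC mx_sets_bigcup.

End matrix_measurable.

Section random_elements.
Context {R : realType}.

Definition eq_dist d d1 d2 (T1 : measurableType d1) (T2 : measurableType d2)
    (E : measurableType d) (P1 : set T1 -> \bar R) (X1 : T1 -> E)
    (P2 : set T2 -> \bar R) (X2 : T2 -> E) : Prop :=
  [/\ measurable_fun setT X1, measurable_fun setT X2 &
      forall A, measurable A -> P1 (X1 @^-1` A) = P2 (X2 @^-1` A)].

Definition independent_RV d d1 d2 (T : measurableType d)
    (E1 : measurableType d1) (E2 : measurableType d2) (P : probability T R)
    (X : T -> E1) (Y : T -> E2) : Prop :=
  forall A B, measurable A -> measurable B ->
    P (X @^-1` A `&` Y @^-1` B) = (P (X @^-1` A) * P (Y @^-1` B))%E.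

(* The Haar probability measure of U(N) is the only probability measure on
   this compact group that is invariant under left translations. *)
Definition haar_unitary d (T : measurableType d) (P : probability T R) (N : nat)
    (U : T -> 'M[R[i]]_N) : Prop :=
  (forall t, U t \is unitarymx) /\
  (forall V : 'M[R[i]]_N, V \is unitarymx ->
     eq_dist P (fun t => V *m U t) P U).

End random_elements.

(* Each size N has its own probability space (T N, P N). Events are measurable
   sets; this is part of the definitions below since the value of a measure on
   a nonmeasurable set is meaningless. *)
Section asymptotics.
Context {R : realType} {d : nat -> measure_display}
  {T : forall N, measurableType (d N)} (P : forall N, probability (T N) R).

Definition whp (Omega : forall N, set (T N)) : Prop :=
  (\forall N \near \oo, measurable (Omega N)) /\
  P N (Omega N) @[N --> \oo] --> 1%E.

Definition wop (Omega : forall N, set (T N)) : Prop :=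
  forall A : R, 0 < A -> \forall N \near \oo,
    measurable (Omega N) /\
    (1 - P N (Omega N) < (N%:R `^ (- A))%:E)%E.

Definition stoch_dom (X Y : forall N, R[i] -> T N -> R[i])
    (S : nat -> set R[i]) : Prop :=
  forall eps : R, 0 < eps ->
    wop (fun N => [set t | forall z, S N z ->
      `|X N z t| <= (N%:R `^ eps)%:C * `|Y N z t|]).

(* X is asymptotically of order one: both |X| and 1/|X| are tight. *)
Definition order_one (X : forall N, T N -> R[i]) : Prop :=
  forall eta : R, 0 < eta -> exists c C : R, 0 < c /\
    let Omega N := [set t | c%:C <= `|X N t| <= C%:C] in
    \forall N \near \oo,
      measurable (Omega N) /\ ((1 - eta)%:E <= P N (Omega N))%E.

Definition W2_bound (N : nat) (z : R[i]) (_ : T N) : R[i] :=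
  `|z| ^+ 2 / ((Num.sqrt N%:R)%:C * (1 - `|z|)).

Definition W2_regular (W : forall N, R[i] -> T N -> R[i]) : Prop :=
  forall delta : R, 0 < delta ->
    stoch_dom W W2_bound
      (fun N => [set z | `|z| < (1 - N%:R `^ (- delta))%:C]).

Definition omega1_regular (X : forall N, T N -> R[i]) : Prop :=
  forall eps : R, 0 < eps ->
    whp (fun N => [set t | (N%:R `^ (- eps))%:C < `|X N t| < (N%:R `^ eps)%:C]).

End asymptotics.

Section model.
Context {R : realType} {N : nat}.

Definition omega1 (U : 'M[R[i]]_N) (v : 'cV[R[i]]_N) : R[i] :=
  (Num.sqrt N%:R)%:C * (v ^t* *m U ^t* *m v) 0 0.

Definition W2 (U : 'M[R[i]]_N) (v : 'cV[R[i]]_N) (z : R[i]) : R[i] :=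
  let A := z *: U ^t* in
  (v ^t* *m (A ^+ 2 *m invmx (1%:M - A)) *m v) 0 0.

End model.

Lemma twopi_gt0 {R : realType} : 0 < 2 * pi :> R.
Proof. by rewrite mulr_gt0// pi_gt0. Qed.

(* The joint law of an independent pair (theta, beta), with theta uniform on
   [0, 2 pi] and beta of law Beta(1, b). For a Haar matrix of size N > 1, a
   coordinate of a uniform vector of the unit sphere of C^N has squared modulus
   of law Beta(1, N - 1), that is b = N.-1. *)
Definition phase_beta_law {R : realType} (b : nat) : set (R * R) -> \bar R :=
  (uniform_prob (@twopi_gt0 R) \x beta_prob 1 b)%E.

(* sqrt(N) e^(i theta) sqrt(beta) for x = (theta, beta). *)
Definition phase_beta {R : realType} (N : nat) (x : R * R) : R[i] :=
  (Num.sqrt N%:R)%:C * (cos x.1 +i* sin x.1) * (Num.sqrt x.2)%:C.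

(* Main.v *)
(* Bound on W2. The spectral theorem writes W2 z = \sum_j p_j (z l_j)^2 / (1 - z l_j)
   with probability weights p_j and |l_j| = 1, whose moments are, up to
   conjugation, c_k = v^* U^k v. If |c_k| <= b for 1 <= k < m + 2, a geometric
   expansion controls W2 up to radius 1 - h, and the Poisson kernel carries the
   bound to all |z| < 1, with constant O(h + b + (1 - h)^m). By a renewal
   equation it is enough to bound the first-return amplitudes of U to v. By
   invariance v = e1 and U = H (1 (+) V), with H a unitary matrix that depends
   only on the first column of U and V an independent Haar matrix of size N - 1;
   then the first returns of U are, up to bounded factors, (perturbed) return
   amplitudes of V, so that K steps only involve K corner entries of Haar
   matrices of sizes N, ..., N - K + 1.

   Moments. Invariance of the first column under rotations gives
   (p + N) E|U_11|^(2p+2) = (p + 1) E|U_11|^(2p). Markov's inequality then bounds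
   the corner entries by N^(-1/2+eps) with overwhelming probability. The same
   recursion holds for Beta(1, N - 1), and moments determine a law on [0, 1].
   Finally omega1 is distributed as sqrt N U_11, whose law is invariant under
   e^(i theta), hence so is its product with an independent uniform phase. *)
From HB Require Import structures.
Require Import Defs.
From mathcomp Require Import all_boot all_order all_algebra.
From mathcomp Require Import all_classical all_reals all_analysis.
From mathcomp Require Import complex.
From mathcomp Require Import measurable_realfun.
From mathcomp Require Import ring lra zify.

Set Implicit Arguments.
Unset Strict Implicit.
Unset Printing Implicit Defensive.

Import Order.TTheory GRing.Theory Num.Theory.
Import numFieldNormedType.Exports.

Local Open Scope classical_set_scope.
Local Open Scope ring_scope.
Local Open Scope complex_scope.
Local Open Scope sesquilinear_scope.

(** * Measurability in complex matrices *)

(** The number [K] of controlled moments is squeezed from both sides. The tail [(1 - h)^(K - 1)]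
    must be negligible while [h] stays near N^(-1/2), so [K] has to be almost of order sqrt N. The
    passage from first returns of size [g] to moments loses only a bounded factor if [4 K g <= 1],
    so [K] cannot exceed that order. The reduction of the matrix size is thus repeated nearly sqrt N
    times, and even a constant factor lost at each level would be fatal. First returns are followed,
    rather than moments, because the renewal equation of one level then has the corner entry as its
    coefficient, itself at most [g]: a level costs a factor 1 + O(K g^2), that is 1 + O(1/K), and
    the product over [K] levels stays bounded.

    Each size has its own probability space and nothing relates different sizes. The independent
    matrix of size N - 1 is the given one of that size, put on a product space; Haar measure enters
    only through invariance and Fubini's theorem. *)

Section complex_measurable_fun.
Context {R : realType} d (T : measurableType d).
Implicit Types f g : T -> R[i].

Lemma measurable_complex_pair : measurable_fun setT (@complex_pair R).
Proof. by move=> _ B mB; rewrite setTI; exists B => //; rewrite setTI. Qed.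

Lemma measurable_complexP f : measurable_fun setT f <->
  measurable_fun setT (fun t => complex.Re (f t)) /\
  measurable_fun setT (fun t => complex.Im (f t)).
Proof.
split=> [mf|[mr mi]].
  have m : measurable_fun setT (@complex_pair R \o f).
    exact: measurableT_comp measurable_complex_pair mf.
  by split; [exact: measurableT_comp measurable_fst m
            |exact: measurableT_comp measurable_snd m].
have m : measurable_fun setT (@complex_pair R \o f) by exact: measurable_fun_pair.
by move=> _ A [B mB <-]; rewrite [X in _ `&` _ @^-1` X]setTI; exact: m.
Qed.

Lemma measurable_complexD f g : measurable_fun setT f -> measurable_fun setT g ->
  measurable_fun setT (fun t => f t + g t).
Proof.
move=> /measurable_complexP[fr fi] /measurable_complexP[gr gi].
apply/measurable_complexP; split.
  apply: eq_measurable_fun (measurable_funD fr gr) => t _.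
  by rewrite /=; case: (f t) => ? ?; case: (g t).
apply: eq_measurable_fun (measurable_funD fi gi) => t _.
by rewrite /=; case: (f t) => ? ?; case: (g t).
Qed.

Lemma measurable_complexM f g : measurable_fun setT f -> measurable_fun setT g ->
  measurable_fun setT (fun t => f t * g t).
Proof.
move=> /measurable_complexP[fr fi] /measurable_complexP[gr gi].
apply/measurable_complexP; split.
  apply: eq_measurable_fun
    (measurable_funB (measurable_funM fr gr) (measurable_funM fi gi)) => t _.
  by rewrite /=; case: (f t) => ? ?; case: (g t).
apply: eq_measurable_fun
  (measurable_funD (measurable_funM fr gi) (measurable_funM fi gr)) => t _.
by rewrite /=; case: (f t) => ? ?; case: (g t).
Qed.

Lemma measurable_conjC f : measurable_fun setT f ->
  measurable_fun setT (fun t => (f t)^*%R).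
Proof.
move=> /measurable_complexP[fr fi]; apply/measurable_complexP; split.
  by apply: eq_measurable_fun fr => t _; case: (f t).
apply: eq_measurable_fun (measurable_funN fi) => t _.
by rewrite /=; case: (f t).
Qed.

Lemma measurable_realC (f : T -> R) : measurable_fun setT f ->
  measurable_fun setT (fun t => (f t)%:C).
Proof. by move=> mf; apply/measurable_complexP; split. Qed.

Lemma measurable_complex_sum (I : Type) (s : seq I) (P : pred I)
    (F : I -> T -> R[i]) : (forall i, measurable_fun setT (F i)) ->
  measurable_fun setT (fun t => \sum_(i <- s | P i) F i t).
Proof.
move=> mF; elim: s => [|i s IHs].
  by under eq_fun do rewrite big_nil; exact: measurable_cst.
under eq_fun do rewrite big_cons; case: (P i) => //.
exact: measurable_complexD.
Qed.

Lemma measurable_complex_prod (I : Type) (s : seq I) (P : pred I)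
    (F : I -> T -> R[i]) : (forall i, measurable_fun setT (F i)) ->
  measurable_fun setT (fun t => \prod_(i <- s | P i) F i t).
Proof.
move=> mF; elim: s => [|i s IHs].
  by under eq_fun do rewrite big_nil; exact: measurable_cst.
under eq_fun do rewrite big_cons; case: (P i) => //.
exact: measurable_complexM.
Qed.

Lemma measurable_sqrt (f : T -> R) : measurable_fun setT f ->
  measurable_fun setT (fun t => Num.sqrt (f t)).
Proof.
move=> mf; apply: (measurableT_comp (f := @Num.sqrt R)) => //.
by apply: continuous_measurable_fun; exact: sqrt_continuous.
Qed.

Lemma measurable_normc f : measurable_fun setT f ->
  measurable_fun setT (fun t => Normc.normc (f t)).
Proof.
move=> /measurable_complexP[fr fi].
apply: eq_measurable_fun
  (measurable_sqrt (measurable_funD (measurable_funX 2 fr) (measurable_funX 2 fi))) => t _.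
by rewrite /=; case: (f t).
Qed.

End complex_measurable_fun.

Section matrix_measurable_fun.
Context {R : realType} d (T : measurableType d).

Lemma measurable_mxP m n (f : T -> 'M[R[i]]_(m, n)) :
  measurable_fun setT f <-> forall i j, measurable_fun setT (fun t => f t i j).
Proof.
split=> [mf i j|mf].
  apply: (measurableT_comp (f := fun M : 'M[R[i]]_(m, n) => M i j)) mf.
  move=> _ A mA; apply: sub_sigma_algebra; exists (i, j) => //.
  by exists A.
apply: (measurability
  (\bigcup_(ij in [set: 'I_m * 'I_n])
      preimage_set_system setT (fun M : 'M[R[i]]_(m, n) => M ij.1 ij.2) measurable)).
  by [].
move=> _ [_ [[i j] _ [B mB <-]] <-]; rewrite setTI -comp_preimage.
by have := mf i j measurableT B mB; rewrite setTI.
Qed.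

Lemma measurable_mulmx m n p (f : T -> 'M[R[i]]_(m, n)) (g : T -> 'M[R[i]]_(n, p)) :
  measurable_fun setT f -> measurable_fun setT g ->
  measurable_fun setT (fun t => f t *m g t).
Proof.
move=> /measurable_mxP mf /measurable_mxP mg; apply/measurable_mxP => i j.
under eq_fun do rewrite mxE.
by apply: measurable_complex_sum => k; apply: measurable_complexM.
Qed.

Lemma measurable_scalemx m n (z : T -> R[i]) (f : T -> 'M[R[i]]_(m, n)) :
  measurable_fun setT z -> measurable_fun setT f ->
  measurable_fun setT (fun t => z t *: f t).
Proof.
move=> mz /measurable_mxP mf; apply/measurable_mxP => i j.
under eq_fun do rewrite mxE.
by apply: measurable_complexM.
Qed.

Lemma measurable_addmx m n (f g : T -> 'M[R[i]]_(m, n)) :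
  measurable_fun setT f -> measurable_fun setT g ->
  measurable_fun setT (fun t => f t + g t).
Proof.
move=> /measurable_mxP mf /measurable_mxP mg; apply/measurable_mxP => i j.
under eq_fun do rewrite mxE.
by apply: measurable_complexD.
Qed.

Lemma measurable_oppmx m n (f : T -> 'M[R[i]]_(m, n)) :
  measurable_fun setT f -> measurable_fun setT (fun t => - f t).
Proof.
move=> mf; apply: eq_measurable_fun
  (measurable_scalemx (measurable_cst (-1 : R[i])) mf) => t _.
by rewrite scaleN1r.
Qed.

Lemma measurable_trmxC m n (f : T -> 'M[R[i]]_(m, n)) :
  measurable_fun setT f -> measurable_fun setT (fun t => (f t) ^t*).
Proof.
move=> /measurable_mxP mf; apply/measurable_mxP => i j.
under eq_fun do rewrite !mxE.
exact: measurable_conjC.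
Qed.

Lemma measurable_det n (f : T -> 'M[R[i]]_n) :
  measurable_fun setT f -> measurable_fun setT (fun t => \det (f t)).
Proof.
move=> /measurable_mxP mf; apply: measurable_complex_sum => s.
by apply: measurable_complexM => //; apply: measurable_complex_prod.
Qed.

Lemma measurable_adjmx n (f : T -> 'M[R[i]]_n) :
  measurable_fun setT f -> measurable_fun setT (fun t => \adj (f t)).
Proof.
move=> /measurable_mxP mf; apply/measurable_mxP => i j.
under eq_fun do rewrite mxE.
apply: measurable_complexM => //; apply: measurable_det.
by apply/measurable_mxP => k l; under eq_fun do rewrite !mxE; exact: mf.
Qed.

End matrix_measurable_fun.

(** * First-return amplitudes *)

Section lift1.
Context {C : numClosedFieldType} {n : nat}.

Definition lift1mx (V : 'M[C]_n) : 'M[C]_(1 + n) := block_mx 1%:M 0%R 0%R V.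

Lemma lift1mxM V W : (lift1mx V *m lift1mx W = lift1mx (V *m W))%R.
Proof. by rewrite /lift1mx mulmx_block !mulmx0 !mul0mx !addr0 !add0r mulmx1. Qed.

Lemma lift1mx_trmxC V : (lift1mx V) ^t* = lift1mx (V ^t*).
Proof.
rewrite /lift1mx tr_block_mx map_block_mx trmx1 map_mx1.
by rewrite !linear0 /= !map_mx0.
Qed.

Lemma lift1mx_unitary V : V \is unitarymx -> lift1mx V \is unitarymx.
Proof.
move=> /unitarymxP Vu; apply/unitarymxP.
by rewrite lift1mx_trmxC lift1mxM Vu /lift1mx -scalar_mx_block.
Qed.

End lift1.

Section first_return.
Context {C : numClosedFieldType} {n : nat}.
Implicit Types (V : 'M[C]_n) (x : 'rV[C]_n) (y : 'cV[C]_n) (th : C) (k : nat).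

Definition rank1_defect y th : 'M[C]_n := 1%:M + (th - 1) *: (y *m y ^t*).

(* For a unit vector [y], this is the amplitude [y^* V^(k+1) y] if [th = 1] and
   the amplitude of a first return to [y] at time [k+1] if [th = 0]. *)
Definition retamp V y th k : C :=
  (y ^t* *m V *m (rank1_defect y th *m V) ^+ k *m y) 0 0.

Lemma exprmxS V k : V ^+ k.+1 = V *m V ^+ k.
Proof. exact: exprS. Qed.

Lemma mx11_scaler (a : 'M[C]_1) m (w : 'M[C]_(1, m)) : a *m w = a 0 0 *: w.
Proof. by rewrite {1}[a]mx11_scalar mul_scalar_mx. Qed.

(** Discrete Duhamel formula. The two step matrices differ by a rank-one term, and the sum runs over
    the position of the first factor, read from the left, in which this term is chosen. *)
Lemma rank1_defect_expansion V y th th' k x :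
  x *m (rank1_defect y th *m V) ^+ k = x *m (rank1_defect y th' *m V) ^+ k
  + (th - th') *: \sum_(j < k) (x *m (rank1_defect y th' *m V) ^+ j *m y) 0 0 *:
      (y ^t* *m V *m (rank1_defect y th *m V) ^+ (k - j.+1)).
Proof.
have step x' : x' *m (rank1_defect y th *m V) = x' *m (rank1_defect y th' *m V)
    + (th - th') *: ((x' *m y) 0 0 *: (y ^t* *m V)).
  rewrite -mx11_scaler /rank1_defect !mulmxDl !mulmxDr -!mulmxA -addrA; congr (_ + _).
  by rewrite -!scalemxAl -!scalemxAr !mulmxA -scalerDl; congr (_ *: _); ring.
move: (rank1_defect y th *m V) (rank1_defect y th' *m V) step => A A' step.
elim: k x => [|k IHk] x; first by rewrite !expr0 big_ord0 scaler0 addr0.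
rewrite exprmxS mulmxA step mulmxDl IHk exprmxS -addrA mulmxA; congr (_ + _).
rewrite big_ord_recl addrC scalerDr expr0 mulmx1 subSS subn0; congr (_ + _).
  by rewrite -!scalemxAl.
congr (_ *: _); apply: eq_bigr => j _.
by rewrite lift0 subSS exprmxS mulmxA.
Qed.

(** For [th' = 0] and [th = 1] this is the classical renewal equation: a return is split at the
    first return. General values are needed because the removal of a column leaves the defect
    [th = a^*]. *)
Lemma retamp_renewal V y th th' k : retamp V y th k = retamp V y th' k
  + (th - th') * \sum_(j < k) retamp V y th' j * retamp V y th (k - j.+1).
Proof.
rewrite {1}/retamp (rank1_defect_expansion V y th th') mulmxDl mxE; congr (_ + _).
rewrite -scalemxAl mxE; congr (_ * _).
by rewrite mulmx_suml summxE; apply: eq_bigr => j _; rewrite -scalemxAl mxE.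
Qed.

Lemma retamp1 V y k : retamp V y 1 k = (y ^t* *m V ^+ k.+1 *m y) 0 0.
Proof.
by rewrite /retamp /rank1_defect subrr scale0r addr0 mul1mx exprmxS !mulmxA.
Qed.

Lemma retamp_conj V S y th k : S \is unitarymx ->
  retamp V (S *m y) th k = retamp (S ^t* *m V *m S) y th k.
Proof.
move=> /unitarymxP SS; have S'S : S ^t* *m S = 1%:M by exact/mulmx1C.
have E j : (rank1_defect (S *m y) th *m V) ^+ j *m S =
    S *m (rank1_defect y th *m (S ^t* *m V *m S)) ^+ j.
  elim: j => [|j IHj]; first by rewrite !expr0 mulmx1 mul1mx.
  rewrite !exprmxS -mulmxA IHj !mulmxA; congr (_ *m _).
  rewrite /rank1_defect trmx_mul map_mxM/= !mulmxDl !mulmxDr !mulmxDl.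
  rewrite !mul1mx !mulmx1 SS mul1mx; congr (_ + _).
  by rewrite -!scalemxAl -!scalemxAr -!scalemxAl !mulmxA.
by rewrite /retamp !mulmxA -(mulmxA _ _ S) E trmx_mul map_mxM/= !mulmxA.
Qed.

End first_return.

(** * Splitting off the first column of a unitary matrix *)

Section unitary_first_column.
Context {C : numClosedFieldType}.

(** In the plane of the first basis vector and a unit vector [y] this acts as the matrix with rows
    [a, - rho] and [rho, a^*]; on the orthogonal complement it is the identity. Its lower right
    block is therefore a [rank1_defect]. *)
Definition reflector n (a rho : C) (y : 'cV[C]_n) : 'M[C]_(1 + n) :=
  block_mx a%:M (- rho *: y ^t*) (rho *: y) (rank1_defect y a^*%R).

Lemma rank1_defect_trmxC n (y : 'cV[C]_n) th :
  (rank1_defect y th) ^t* = rank1_defect y th^*%R.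
Proof.
rewrite /rank1_defect; apply/matrixP => i j; rewrite !mxE rmorphD rmorphM/=.
rewrite rmorphB rmorph1 rmorph_nat eq_sym rmorph_sum; congr (_ + _ * _).
by apply: eq_bigr => k _; rewrite !mxE rmorphM/= mulrC conjCK.
Qed.

Lemma scalar_mxC n (a : C) : (a%:M : 'M[C]_n) ^t* = (a^*%R)%:M.
Proof. by rewrite tr_scalar_mx map_scalar_mx. Qed.

Lemma scalemxC m n (a : C) (M : 'M[C]_(m, n)) : (a *: M) ^t* = a^*%R *: M ^t*.
Proof. by apply/matrixP => i j; rewrite !mxE rmorphM. Qed.

Lemma reflector_unitary n (a rho : C) (y : 'cV[C]_n) :
  y ^t* *m y = 1%:M -> rho^*%R = rho -> a * a^*%R + rho ^+ 2 = 1 ->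
  reflector a rho y \is unitarymx.
Proof.
move=> yy rr ar; rewrite -trmxC_unitary; apply/unitarymxP; rewrite trmxCK.
have defy th : rank1_defect y th *m y = th *: y.
  rewrite /rank1_defect mulmxDl mul1mx -scalemxAl -mulmxA yy mulmx1.
  by rewrite -[X in X + _]scale1r -scalerDl; congr (_ *: _); ring.
have ydef th : y ^t* *m rank1_defect y th = th *: y ^t*.
  rewrite /rank1_defect mulmxDr mulmx1 -scalemxAr mulmxA yy mul1mx.
  by rewrite -[X in X + _]scale1r -scalerDl; congr (_ *: _); ring.
rewrite /reflector tr_block_mx map_block_mx/= -!/(_ ^t*) mulmx_block.
rewrite rank1_defect_trmxC conjCK scalar_mxC !scalemxC rmorphN/= rr trmxCK.
rewrite [RHS]scalar_mx_block; congr block_mx.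
- rewrite -scalar_mxM -scalemxAl -scalemxAr yy scalerA scale_scalar_mx mulr1.
  by rewrite -raddfD/=; congr _%:M; rewrite -ar; ring.
- rewrite mul_scalar_mx -scalemxAl ydef !scalerA -scalerDl.
  by rewrite [X in X *: _](_ : _ = 0) ?scale0r//; ring.
- rewrite mul_mx_scalar -scalemxAr defy !scalerA -scalerDl.
  by rewrite [X in X *: _](_ : _ = 0) ?scale0r//; ring.
- rewrite -scalemxAl -scalemxAr scalerA {2}/rank1_defect mulmxDr mulmx1.
  rewrite -scalemxAr mulmxA defy -scalemxAl scalerA {1}/rank1_defect.
  rewrite addrC -!addrA -!scalerDl -[RHS]addr0; congr (_ + _).
  rewrite [X in X *: _](_ : _ = a * a^*%R + rho ^+ 2 - 1); last by ring.
  by rewrite ar subrr scale0r.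
Qed.

End unitary_first_column.
Section block_decomposition.
Context {C : numClosedFieldType}.

Definition e1 {n} : 'cV[C]_(1 + n) := col_mx 1%:M 0.

Lemma trmxC_mulmx m n p (A : 'M[C]_(m, n)) (B : 'M[C]_(n, p)) :
  (A *m B) ^t* = B ^t* *m A ^t*.
Proof. by rewrite trmx_mul map_mxM. Qed.

Lemma block_trmxC m1 m2 n1 n2 (A : 'M[C]_(m1, n1)) (B : 'M[C]_(m1, n2))
    (A' : 'M[C]_(m2, n1)) (B' : 'M[C]_(m2, n2)) :
  (block_mx A B A' B') ^t* = block_mx (A ^t*) (A' ^t*) (B ^t*) (B' ^t*).
Proof. by rewrite tr_block_mx map_block_mx. Qed.

Lemma col_mulmxC n (w : 'cV[C]_n) :
  (w ^t* *m w) 0 0 = \sum_i `|w i 0| ^+ 2.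
Proof. by rewrite mxE; apply: eq_bigr => i _; rewrite !mxE mulrC -normCK. Qed.

Lemma row_mulmxC n (w : 'rV[C]_n) :
  (w *m w ^t*) 0 0 = \sum_i `|w 0 i| ^+ 2.
Proof. by rewrite mxE; apply: eq_bigr => i _; rewrite !mxE -normCK. Qed.

Lemma col_mulmxC_eq0 n (w : 'cV[C]_n) : (w ^t* *m w) 0 0 = 0 -> w = 0.
Proof.
rewrite col_mulmxC => /psumr_eq0P H; apply/colP => i; rewrite !mxE.
have /eqP := H (fun i _ => exprn_ge0 2 (normr_ge0 (w i 0))) i isT.
by rewrite expf_eq0/= normr_eq0 => /eqP.
Qed.

Lemma row_mulmxC_eq0 n (w : 'rV[C]_n) : (w *m w ^t*) 0 0 = 0 -> w = 0.
Proof.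
rewrite row_mulmxC => /psumr_eq0P H; apply/rowP => i; rewrite !mxE.
have /eqP := H (fun i _ => exprn_ge0 2 (normr_ge0 (w 0 i))) i isT.
by rewrite expf_eq0/= normr_eq0 => /eqP.
Qed.

(** A unit direction is wanted even when [w] vanishes; the nonzero dimension provides a basis vector
    for that case. *)
Lemma polar_col n (w : 'cV[C]_n.+1) : exists rho (y : 'cV[C]_n.+1),
  [/\ w = rho *: y, y ^t* *m y = 1%:M, 0 <= rho & rho ^+ 2 = (w ^t* *m w) 0 0].
Proof.
have t0 : 0 <= (w ^t* *m w) 0 0.
  by rewrite col_mulmxC sumr_ge0// => i _; rewrite exprn_ge0.
have := mx11_scalar (w ^t* *m w).
have := @col_mulmxC_eq0 _ w.
move: ((w ^t* *m w) 0 0) t0 => t t0 w0 wE.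
exists (sqrtC t); have [t_eq0|tn0] := eqVneq t 0.
  exists (delta_mx 0 0); rewrite (w0 t_eq0) t_eq0 sqrtC0 scale0r expr0n; split=> //.
  rewrite trmx_delta map_delta_mx mul_delta_mx; apply/matrixP => i j.
  by rewrite !ord1 !mxE.
have s0 : sqrtC t != 0 by rewrite sqrtC_eq0.
exists ((sqrtC t)^-1 *: w); split; rewrite ?sqrtC_ge0 ?sqrtCK//.
  by rewrite scalerA divff// scale1r.
have sr : (sqrtC t)^*%R = sqrtC t by apply/CrealP; rewrite ger0_real// sqrtC_ge0.
rewrite scalemxC -scalemxAl -scalemxAr scalerA fmorphV/= sr wE.
by rewrite scale_scalar_mx -invfM -expr2 sqrtCK mulVf.
Qed.

(** The reflector with the same first column as [V] is undone on the left. What remains is unitary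
    and its first column is the first basis vector; its first row has norm one, so the rest of that
    row vanishes too. *)
Lemma unitary_block_decomp n (V : 'M[C]_(1 + n.+1)) : V \is unitarymx ->
  exists X y rho, [/\ X \is unitarymx, y ^t* *m y = 1%:M, 0 <= rho,
     V 0 0 * (V 0 0)^*%R + rho ^+ 2 = 1 &
     V = reflector (V 0 0) rho y *m lift1mx X].
Proof.
move=> Vu; pose a := V 0 0; pose w : 'cV[C]_n.+1 := dlsubmx V.
have [rho [y [wE yy rho0 rhoE]]] := polar_col w.
have VE : V = block_mx a%:M (ursubmx V) w (drsubmx V).
  rewrite -{1}[V]submxK; congr block_mx; rewrite [LHS]mx11_scalar; congr _%:M.
  by rewrite !mxE; congr (V _ _); apply: val_inj.
have V'V : V ^t* *m V = 1%:M by apply: mulmx1C; exact/unitarymxP.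
have rr : (rho)^*%R = rho by apply/CrealP; rewrite ger0_real.
have ar : a * a^*%R + rho ^+ 2 = 1.
  have := congr1 (fun M : 'M[C]_(1 + n.+1) => ulsubmx M 0 0) V'V.
  rewrite {1 2}VE block_trmxC mulmx_block block_mxKul.
  rewrite scalar_mx_block block_mxKul scalar_mxC -scalar_mxM mxE mxE eqxx mulr1n.
  by rewrite rhoE !mxE eqxx mulrC.
have Hu := reflector_unitary yy rr ar.
pose Z := (reflector a rho y) ^t* *m V.
have Zu : Z \is unitarymx by rewrite mul_unitarymx// trmxC_unitary.
have ZE : exists c X, Z = block_mx 1%:M c 0 X.
  eexists; eexists; rewrite /Z {1}VE /reflector block_trmxC mulmx_block; congr block_mx.
    rewrite scalar_mxC -scalar_mxM scalemxC rr wE -scalemxAl -scalemxAr yy.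
    by rewrite scalerA scale_scalar_mx mulr1 -raddfD/= -ar; congr _%:M; ring.
  rewrite scalemxC rmorphN/= rr trmxCK mul_mx_scalar rank1_defect_trmxC conjCK.
  rewrite wE -scalemxAr /rank1_defect mulmxDl mul1mx -scalemxAl -mulmxA yy mulmx1.
  rewrite !scalerA -[X in _ *: (X + _)]scale1r -scalerDl scalerA -scalerDl.
  by rewrite [X in X *: _](_ : _ = 0) ?scale0r//; ring.
have [c [X {}ZE]] := ZE.
have ZZ : Z *m Z ^t* = 1%:M by exact/unitarymxP.
have c0 : c = 0.
  apply: row_mulmxC_eq0.
  have := congr1 (fun M : 'M[C]_(1 + n.+1) => ulsubmx M 0 0) ZZ.
  rewrite ZE block_trmxC mulmx_block block_mxKul scalar_mx_block block_mxKul.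
  rewrite scalar_mxC -scalar_mxM rmorph1 mulr1 mxE => /eqP.
  by rewrite addrC -subr_eq0 addrK => /eqP.
exists X, y, rho; split=> //.
  apply/unitarymxP; have := congr1 (fun M : 'M[C]_(1 + n.+1) => drsubmx M) ZZ.
  rewrite ZE c0 block_trmxC mulmx_block block_mxKdr scalar_mx_block block_mxKdr.
  by rewrite mul0mx add0r.
have -> : lift1mx X = Z by rewrite ZE c0.
by rewrite /Z mulmxA; move/unitarymxP : Hu => ->; rewrite mul1mx.
Qed.

(** Transitivity on the unit sphere, by the reflector with first column [v]. In dimension one there
    is no room for [y], and the number [v] of modulus one is used itself. *)
Lemma unitary_col n (v : 'cV[C]_(1 + n)) : v ^t* *m v = 1%:M ->
  exists2 S : 'M[C]_(1 + n), S \is unitarymx & S *m e1 = v.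
Proof.
case: n v => [|n] v vv.
  exists (v : 'M[C]_1).
    by rewrite -trmxC_unitary; apply/unitarymxP; rewrite trmxCK.
  rewrite /e1; apply/colP => i; rewrite !ord1 mxE big_ord1 mxE.
  case: splitP => j; rewrite !ord1//= => _.
  by rewrite !mxE eqxx mulr1.
pose a := v 0 0; have [rho [y [wE yy rho0 rhoE]]] := polar_col (dsubmx v).
have vE : v = col_mx a%:M (rho *: y).
  rewrite -wE -[v in LHS]vsubmxK; congr col_mx; rewrite [LHS]mx11_scalar; congr _%:M.
  by rewrite mxE; congr (v _ _); apply: val_inj.
have rr : (rho)^*%R = rho by apply/CrealP; rewrite ger0_real.
exists (reflector a rho y); last first.
  by rewrite /e1 /reflector mul_block_col !mulmx0 !addr0 !mulmx1.
apply: reflector_unitary => //.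
have := congr1 (fun M : 'M[C]_1 => M 0 0) vv.
rewrite vE tr_col_mx map_row_mx mul_row_col scalar_mxC -scalar_mxM.
rewrite mxE mxE eqxx mulr1n -wE -rhoE mxE eqxx mulr1n => <-.
by rewrite mulrC.
Qed.

Section level.
Context {n : nat} (a rho : C) (y : 'cV[C]_n.+1) (W : 'M[C]_n.+1).

Let B := rank1_defect y a^*%R.

Let reflector_lift : reflector a rho y *m lift1mx W =
  block_mx a%:M (- rho *: (y ^t* *m W)) (rho *: y) (B *m W).
Proof.
by rewrite /reflector /lift1mx mulmx_block !mulmx1 !mulmx0 !addr0 !add0r
  -scalemxAl.
Qed.

Let e1_reflector : (e1 ^t* *m (reflector a rho y *m lift1mx W)) =
  row_mx a%:M (- rho *: (y ^t* *m W)).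
Proof.
rewrite reflector_lift /e1 tr_col_mx map_row_mx mul_row_block trmx0 map_mx0.
by rewrite !mul0mx !addr0 trmx1 map_mx1 !mul1mx.
Qed.

Lemma retamp_reflector0 : retamp (reflector a rho y *m lift1mx W) e1 0 0 = a.
Proof.
rewrite /retamp expr0 mulmx1 e1_reflector /e1 mul_row_col mulmx0 addr0 mulmx1.
by rewrite mxE eqxx.
Qed.

(* Splitting off the first column [(a, rho y)] of a unitary matrix turns its
   first returns to [e1] into amplitudes of a matrix of size one less. *)
Lemma retamp_reflectorS k : retamp (reflector a rho y *m lift1mx W) e1 0 k.+1 =
  - rho ^+ 2 * retamp W y a^*%R k.
Proof.
rewrite /retamp e1_reflector.
set A := rank1_defect e1 0 *m _.
(* For [th = 0] the defect is the projection that kills the first coordinate. Hence the first block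
   row of [A] vanishes, and its powers only involve [B *m W]. *)
have AE : A = block_mx 0 0 (rho *: y) (B *m W).
  rewrite /A reflector_lift.
  have -> : rank1_defect (e1 : 'cV_(1 + n.+1)) 0 = block_mx 0 0 0 1%:M.
    rewrite /rank1_defect sub0r scaleN1r /e1 tr_col_mx map_row_mx mul_col_row.
    rewrite trmx0 trmx1 map_mx0 map_mx1 !mulmx0 mul0mx mulmx1.
    rewrite scalar_mx_block opp_block_mx add_block_mx.
    by rewrite subrr !oppr0 !addr0.
  by rewrite mulmx_block !mul0mx !mul1mx !add0r.
have Ak : A ^+ k.+1 *m e1 = col_mx 0 (rho *: ((B *m W) ^+ k *m y)).
  elim: k => [|k IHk].
    rewrite expr1 expr0 mul1mx AE /e1 mul_block_col !mulmx0 !addr0 mul0mx.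
    by rewrite mulmx1.
  rewrite exprmxS -mulmxA IHk AE mul_block_col !mul0mx !mulmx0 !add0r.
  by rewrite -scalemxAr mulmxA -exprmxS.
rewrite -mulmxA Ak mul_row_col mulmx0 add0r -scalemxAr -scalemxAl scalerA mxE.
by rewrite mulmxA; congr (_ * _); ring.
Qed.

End level.

End block_decomposition.

(** * Haar measure *)

Section fubini_probability.
Context {R : realType} d1 d2 d3 (T1 : measurableType d1) (T2 : measurableType d2)
  (E : measurableType d3) (P1 : probability T1 R) (P2 : probability T2 R).
Local Open Scope ereal_scope.

(** A conditioning device: either of the two variables can be frozen, and the invariance of the
    other one is then applied inside the integral. *)
Lemma fubini_prob (F : T1 * T2 -> E) (B : set E) :
  measurable_fun setT F -> measurable B ->
  \int[P1]_x P2 [set y | B (F (x, y))] = \int[P2]_y P1 [set x | B (F (x, y))].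
Proof.
move=> mF mB.
have mFB : measurable (F @^-1` B) by rewrite -[X in measurable X]setTI; exact: mF.
have := indic_fubini_tonelli P1 P2 mFB.
rewrite indic_fubini_tonelli_FE ?indic_fubini_tonelli_GE// => H.
transitivity (\int[P1]_x (P2 \o xsection (F @^-1` B)) x).
  by apply: eq_integral => x _; rewrite /= xsectionE.
by rewrite H; apply: eq_integral => y _; rewrite /= ysectionE.
Qed.

Lemma product_prob (F : T1 * T2 -> E) (B : set E) :
  (P1 \x P2) (F @^-1` B) = \int[P1]_x P2 [set y | B (F (x, y))].
Proof. by apply: eq_integral => x _; rewrite /= xsectionE. Qed.

End fubini_probability.

Section haar.
Context {R : realType} (N : nat).
Local Notation M := 'M[R[i]]_N.

(** [eq_dist] contains measurability, so it is read off from invariance under the identity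
    matrix. *)
Lemma haar_measurable d (T : measurableType d) (P : probability T R) (U : T -> M) :
  haar_unitary P U -> measurable_fun setT U.
Proof. by move=> [_ /(_ 1%:M)[]//]; apply/unitarymxP; rewrite mul1mx trmx1 map_mx1. Qed.

Lemma haar_mull d (T : measurableType d) (P : probability T R) (U : T -> M) V B :
  haar_unitary P U -> V \is unitarymx -> measurable B ->
  P [set t | B (V *m U t)] = P [set t | B (U t)].
Proof. by move=> [_ /(_ V) H] Vu mB; have [_ _] := H Vu; exact. Qed.

Lemma integral_prob_cst d (T : measurableType d) (P : probability T R) (x : \bar R) :
  (\int[P]_t cst x t = x)%E.
Proof.
rewrite integral_cst//=.
by rewrite [X in (_ * X)%E]probability_setT mule1.
Qed.

Section two_matrices.
Context d1 d2 (T1 : measurableType d1) (T2 : measurableType d2)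
  (P1 : probability T1 R) (P2 : probability T2 R) (U1 : T1 -> M) (U2 : T2 -> M).
Hypotheses (H1 : haar_unitary P1 U1) (H2 : haar_unitary P2 U2).

(* The law of [U2^* U1] is that of [U1] conditionally on [U2], and that of
   [U2^*] conditionally on [U1]. *)
Lemma haar_trmxC B : measurable B ->
  P1 [set t | B (U1 t)] = P2 [set t | B ((U2 t) ^t*)].
Proof.
move=> mB.
pose F (x : T1 * T2) := (U2 x.2) ^t* *m U1 x.1.
have mF : measurable_fun setT F.
  apply: measurable_mulmx.
    apply: measurable_trmxC.
    exact: measurableT_comp (haar_measurable H2) measurable_snd.
  exact: measurableT_comp (haar_measurable H1) measurable_fst.
have := fubini_prob P1 P2 mF mB.
under eq_integral => x _.
  rewrite /F/=.
  rewrite (_ : [set y | _] = [set y | [set V : M | B (V ^t*)] ((U1 x) ^t* *m U2 y)]); last first.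
    by apply/seteqP; split => y /=; rewrite trmx_mul map_mxM/= trmxCK.
  rewrite (haar_mull H2); first over.
    by rewrite trmxC_unitary; case: H1.
  rewrite -[X in measurable X]setTI; apply: measurable_trmxC => //.
rewrite integral_prob_cst /=.
under eq_integral => y _.
  rewrite /F/= (haar_mull H1)//; first over.
  by rewrite trmxC_unitary; case: H2.
by rewrite integral_prob_cst.
Qed.

End two_matrices.

(** The definition of Haar measure gives left invariance only. As [U] and its adjoint have the same
    law, right multiplication by [V] becomes left multiplication by the adjoint of [V]. *)
Lemma haar_mulr d (T : measurableType d) (P : probability T R) (U : T -> M) V B :
  haar_unitary P U -> V \is unitarymx -> measurable B ->
  P [set t | B (U t *m V)] = P [set t | B (U t)].
Proof.
move=> HU Vu mB.
have mcB : measurable [set W : M | B (W ^t*)].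
  by rewrite -[X in measurable X]setTI; apply: measurable_trmxC.
have mBV : measurable [set W : M | B (W *m V)].
  rewrite -[X in measurable X]setTI.
  by apply: (measurable_mulmx (f := id) (g := cst V)).
have V'u : V ^t* \is unitarymx by rewrite trmxC_unitary.
apply: (etrans (haar_trmxC HU HU mBV)).
apply: etrans (esym (haar_trmxC HU HU mB)).
apply: etrans (haar_mull HU V'u mcB).
by congr (P _); apply/seteqP; split => t /=; rewrite trmx_mul map_mxM/= trmxCK.
Qed.

Lemma haar_conj d (T : measurableType d) (P : probability T R) (U : T -> M) V B :
  haar_unitary P U -> V \is unitarymx -> measurable B ->
  P [set t | B (V ^t* *m U t *m V)] = P [set t | B (U t)].
Proof.
move=> HU Vu mB.
have mBV : measurable [set W : M | B (W *m V)].
  rewrite -[X in measurable X]setTI.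
  by apply: (measurable_mulmx (f := id) (g := cst V)).
have V'u : V ^t* \is unitarymx by rewrite trmxC_unitary.
by apply: (etrans (haar_mull HU V'u mBV)); exact: haar_mulr.
Qed.

End haar.

Section haar_block.
Context {R : realType} (n : nat).
Context d1 d2 (T1 : measurableType d1) (T2 : measurableType d2)
  (P1 : probability T1 R) (P2 : probability T2 R)
  (U1 : T1 -> 'M[R[i]]_(1 + n)) (U2 : T2 -> 'M[R[i]]_n).
Hypotheses (H1 : haar_unitary P1 U1) (H2 : haar_unitary P2 U2).
Local Open Scope ereal_scope.

Lemma measurable_lift1mx : measurable_fun setT (@lift1mx R[i] n).
Proof.
apply/measurable_mxP => i j.
have mid : forall a b, measurable_fun setT (fun V : 'M[R[i]]_n => V a b).
  by apply/measurable_mxP; exact: measurable_id.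
case: (splitP i) => i' ii'.
  have -> : i = lshift n i' by apply: val_inj.
  case: (splitP j) => j' jj'.
    have -> : j = lshift n j' by apply: val_inj.
    by under eq_fun do rewrite block_mxEul; exact: measurable_cst.
  have -> : j = rshift 1 j' by apply: val_inj.
  by under eq_fun do rewrite block_mxEur; exact: measurable_cst.
have -> : i = rshift 1 i' by apply: val_inj.
case: (splitP j) => j' jj'.
  have -> : j = lshift n j' by apply: val_inj.
  by under eq_fun do rewrite block_mxEdl; exact: measurable_cst.
have -> : j = rshift 1 j' by apply: val_inj.
by under eq_fun do rewrite block_mxEdr; exact: mid.
Qed.

(** Multiplication by an independent [lift1mx (U2 y)] preserves the law of [U1], by right invariance
    with [y] frozen. Read in the other order, [U1 x] is frozen and [U2] is a fresh Haar matrix of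
    smaller size. *)
Lemma haar_block B : measurable B ->
  P1 [set t | B (U1 t)] = \int[P1]_x P2 [set y | B (U1 x *m lift1mx (U2 y))%R].
Proof.
move=> mB.
pose F (x : T1 * T2) := (U1 x.1 *m lift1mx (U2 x.2))%R.
have mF : measurable_fun setT F.
  apply: measurable_mulmx.
    exact: measurableT_comp (haar_measurable H1) measurable_fst.
  apply: measurableT_comp measurable_lift1mx _.
  exact: measurableT_comp (haar_measurable H2) measurable_snd.
rewrite (fubini_prob P1 P2 mF mB).
under eq_integral => y _.
  rewrite /F/= (haar_mulr H1)//; first over.
  by apply: lift1mx_unitary; case: H2.
by rewrite integral_prob_cst.
Qed.

End haar_block.

(** * Bounds from the renewal equation *)

Section renewal_bound.
Context {R : realType}.
Local Notation normc := (@Normc.normc R).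

Lemma normc_sum (I : Type) (s : seq I) (P : pred I) (F : I -> R[i]) :
  normc (\sum_(i <- s | P i) F i) <= \sum_(i <- s | P i) normc (F i).
Proof.
elim/big_rec2: _ => [|i x y _ le]; first by rewrite Normc.normc0.
by rewrite (le_trans (le_normcD _ _))// lerD2l.
Qed.

Lemma normc_ge0 (z : R[i]) : 0 <= normc z.
Proof. by case: z => a b; exact: sqrtr_ge0. Qed.

(** Strong induction: under the smallness condition the claimed bound is at most [2 * gam], and
    inserting this in the sum gives the claim back. The factor is not rounded up to [2], because it
    is going to be iterated over many levels with [c0] small. *)
Lemma renewal_bound (g h : nat -> R[i]) (c : R[i]) (K : nat) (gam c0 : R) :
  (forall k, h k = g k + c * \sum_(j < k) g j * h (k - j.+1)%N) ->
  (forall k, (k < K)%N -> normc (g k) <= gam) ->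
  0 <= gam -> normc c <= c0 -> 2 * c0 * K%:R * gam <= 1 ->
  forall k, (k < K)%N -> normc (h k) <= gam * (1 + 2 * c0 * K%:R * gam).
Proof.
move=> hE gle gam0 cle small.
have c00 : 0 <= c0 by exact: le_trans (normc_ge0 c) cle.
elim/ltn_ind => k IH kK; rewrite hE (le_trans (le_normcD _ _))// mulrDr mulr1.
apply: lerD; first exact: gle.
rewrite Normc.normcM.
have le2 : normc (\sum_(j < k) g j * h (k - j.+1)%N) <= K%:R * (gam * (2 * gam)).
  apply: (le_trans (normc_sum _ _ _)).
  apply: (@le_trans _ _ (\sum_(j < k) gam * (2 * gam))); last first.
    rewrite sumr_const card_ord -[leLHS]mulr_natl ler_wpM2r//.
      by rewrite !mulr_ge0.
    by rewrite ler_nat ltnW.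
  apply: ler_sum => j _; rewrite Normc.normcM ler_pM ?normc_ge0//.
    by apply: gle; apply: ltn_trans kK.
  have jk := ltn_ord j.
  apply: (le_trans (IH _ _ _)); [lia|lia|].
  by rewrite mulrC ler_wpM2r//; lra.
have : normc c * normc (\sum_(j < k) g j * h (k - j.+1)%N)
    <= c0 * (K%:R * (gam * (2 * gam))) by rewrite ler_pM ?normc_ge0.
by move=> /le_trans; apply; rewrite le_eqVlt; apply/orP; left; apply/eqP; ring.
Qed.

End renewal_bound.

Section level_bound.
Context {R : realType}.
Local Notation C := R[i].

Lemma normcE (z : C) : `|z| = (Normc.normc z)%:C.
Proof. by []. Qed.

(** One level of the descent. The time shift in [retamp_reflectorS] turns [K] controlled times into
    [K.+1]; the defect [a^*] is compared with [0] by a renewal equation with coefficient [a^*], of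
    modulus at most [eps]. *)
Lemma retamp_level n (a rho : C) (y : 'cV[C]_n.+1) (W : 'M[C]_n.+1) (K : nat)
    (eps gam gam' : R) :
  a * a^*%R + rho ^+ 2 = 1 -> 0 <= rho -> Normc.normc a <= eps -> 0 <= gam ->
  (forall k, (k < K)%N -> Normc.normc (retamp W y 0 k) <= gam) ->
  2 * eps * K%:R * gam <= 1 -> eps <= gam' ->
  gam * (1 + 2 * eps * K%:R * gam) <= gam' ->
  forall k, (k < K.+1)%N ->
    Normc.normc (retamp (reflector a rho y *m lift1mx W) e1 0 k) <= gam'.
Proof.
move=> ar rho0 ale gam0 gle small epsgam gamgam' [|k].
  by rewrite retamp_reflector0 => _; exact: le_trans epsgam.
rewrite ltnS retamp_reflectorS => kK; rewrite Normc.normcM.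
have rho1 : Normc.normc (- rho ^+ 2) <= 1.
  rewrite normcN -lecR rmorph1 -normcE ger0_norm ?exprn_ge0// -ar lerDr.
  by rewrite -normCK exprn_ge0.
apply: le_trans gamgam'.
rewrite -[leRHS]mul1r ler_pM ?normc_ge0//.
apply: (@renewal_bound _ (fun k => retamp W y 0 k) (fun k => retamp W y a^*%R k) a^*%R) => //.
  by move=> j; rewrite -{2}[a^*%R]subr0; exact: retamp_renewal.
by rewrite -lecR -normcE norm_conjC normcE lecR.
Qed.

End level_bound.

(** * First returns of a Haar matrix *)

Section measurable_retamp.
Context {R : realType} d (T : measurableType d).
Local Notation normc := (@Normc.normc R).

Lemma measurable_exprmx n k (f : T -> 'M[R[i]]_n) : measurable_fun setT f ->
  measurable_fun setT (fun t => f t ^+ k).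
Proof.
move=> mf; elim: k => [|k IHk]; first exact: measurable_cst.
by apply: eq_measurable_fun (measurable_mulmx mf IHk) => t _; rewrite exprmxS.
Qed.

Lemma measurable_retamp n (f : T -> 'M[R[i]]_n) (y : T -> 'cV[R[i]]_n) th k :
  measurable_fun setT f -> measurable_fun setT y ->
  measurable_fun setT (fun t => retamp (f t) (y t) th k).
Proof.
move=> mf my; have mys := measurable_trmxC my.
have /measurable_mxP : measurable_fun setT (fun t =>
  ((y t) ^t* *m f t *m (rank1_defect (y t) th *m f t) ^+ k *m y t)); last exact.
apply: measurable_mulmx => //; apply: measurable_mulmx.
  exact: measurable_mulmx.
apply: measurable_exprmx; apply: measurable_mulmx => //.
apply: measurable_addmx => //; apply: measurable_scalemx => //.
exact: measurable_mulmx.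
Qed.

Lemma measurable_normc_gt (f : T -> R[i]) (r : R) : measurable_fun setT f ->
  measurable [set t | r < normc (f t)].
Proof.
move=> mf; rewrite (_ : [set t | _] = (fun t => normc (f t)) @^-1` `]r, +oo[%classic).
  by rewrite -[X in measurable X]setTI; apply: measurable_normc.
by apply/seteqP; split => t /=; rewrite in_itv/= andbT.
Qed.

End measurable_retamp.

Section large_return.
Context {R : realType}.
Local Notation normc := (@Normc.normc R).

Definition large_return n (v : 'cV[R[i]]_n) (K : nat) (gam : R) : set 'M[R[i]]_n :=
  [set M | exists2 k, (k < K)%N & gam < normc (retamp M v 0 k)].

Lemma measurable_large_return n (v : 'cV[R[i]]_n) K gam :
  measurable (large_return v K gam).
Proof.
rewrite (_ : large_return v K gam =
    \bigcup_(k in [set k | (k < K)%N]) [set M | gam < normc (retamp M v 0 k)]).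
  apply: bigcup_measurable => k _.
  by apply: measurable_normc_gt; apply: measurable_retamp.
by apply/seteqP; split => M [k]; exists k.
Qed.

Lemma large_return_conj n (S M : 'M[R[i]]_n) v K gam : S \is unitarymx ->
  large_return (S *m v) K gam M <-> large_return v K gam (S ^t* *m M *m S).
Proof. by move=> Su; split=> -[k kK lt]; exists k => //; move: lt; rewrite retamp_conj. Qed.

Lemma haar_large_return n d (T : measurableType d) (P : probability T R)
    (U : T -> 'M[R[i]]_(1 + n)) (v : 'cV[R[i]]_(1 + n)) K gam :
  haar_unitary P U -> v ^t* *m v = 1%:M ->
  P [set t | large_return v K gam (U t)] = P [set t | large_return e1 K gam (U t)].
Proof.
move=> HU /unitary_col[S Su <-].
apply: etrans (haar_conj HU Su (measurable_large_return e1 K gam)).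
congr (P _); apply/seteqP.
split => t; first exact: (large_return_conj (U t) e1 K gam Su).1.
exact: (large_return_conj (U t) e1 K gam Su).2.
Qed.

Local Open Scope ereal_scope.

(** Either the corner entry exceeds [eps], or a large return of [U1] forces one of the smaller
    matrix [X *m U2], which has the law of [U2] for every fixed unitary [X]. *)
Lemma haar_large_return_step n d1 d2 (T1 : measurableType d1) (T2 : measurableType d2)
    (P1 : probability T1 R) (P2 : probability T2 R)
    (U1 : T1 -> 'M[R[i]]_(1 + n.+1)) (U2 : T2 -> 'M[R[i]]_n.+1)
    (K : nat) (eps gam gam' : R) :
  haar_unitary P1 U1 -> haar_unitary P2 U2 -> (0 <= gam)%R ->
  (2 * eps * K%:R * gam <= 1)%R -> (eps <= gam')%R ->
  (gam * (1 + 2 * eps * K%:R * gam) <= gam')%R ->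
  P1 [set t | large_return e1 K.+1 gam' (U1 t)] <=
  P1 [set t | eps < normc (U1 t 0%R 0%R)]%R +
  P2 [set t | large_return (e1 : 'cV_(1 + n)) K gam (U2 t)].
Proof.
move=> H1 H2 gam0 small le1 le2.
have mU1 := haar_measurable H1; have mU2 := haar_measurable H2.
rewrite (haar_block H1 H2 (measurable_large_return _ _ _)).
set A := [set t | _]%R; set p := P2 _.
have mA : measurable A.
  by apply: measurable_normc_gt; have /measurable_mxP := mU1; exact.
have -> : P1 A + p = \int[P1]_x ((\1_A x)%:E + cst p x).
  rewrite ge0_integralD//=.
  - rewrite integral_indic// setIT; congr (_ + _).
    exact: esym (integral_prob_cst P1 p).
  - by apply/measurable_EFinP; exact: measurable_indic.
  - by move=> _ _; exact: measure_ge0.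
apply: ge0_le_integral => //=.
- have mF : measurable_fun setT
      (fun x : T1 * T2 => U1 x.1 *m lift1mx (U2 x.2))%R.
    apply: measurable_mulmx; first exact: measurableT_comp mU1 measurable_fst.
    apply: measurableT_comp (@measurable_lift1mx R n.+1) _.
    exact: measurableT_comp mU2 measurable_snd.
  have mB : measurable [set x : T1 * T2 |
      large_return e1 K.+1 gam' (U1 x.1 *m lift1mx (U2 x.2))%R].
    rewrite -[X in measurable X]setTI; apply: mF => //.
    exact: measurable_large_return.
  apply: eq_measurable_fun (measurable_fun_xsection P2 mB) => x _.
  by rewrite /= xsectionE.
- apply: emeasurable_funD => //.
  by apply/measurable_EFinP; exact: measurable_indic.
move=> x _; rewrite indicE; case: (boolP (x \in A)) => [_|].
  apply: (@le_trans _ _ 1); last by apply: leeDl; exact: measure_ge0.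
  apply: probability_le1; rewrite -[X in measurable X]setTI.
  have mF : measurable_fun setT (fun y : T2 => U1 x *m lift1mx (U2 y))%R.
    by apply: measurable_mulmx => //; exact: measurableT_comp (@measurable_lift1mx R n.+1) _.
  by apply: mF => //; exact: measurable_large_return.
rewrite notin_setE/= => /negP; rewrite -leNgt => ale.
rewrite add0e.
(* The decomposition is chosen for each fixed [x]. The bound [p] does not depend on the choice, so
   no measurable selection is involved. *)
have [X [y [rho [Xu yy rho0 ar U1E]]]] := unitary_block_decomp (H1.1 x).
rewrite U1E.
have mlr := measurable_large_return y K gam.
rewrite /p -(haar_large_return _ _ H2 yy) -(haar_mull H2 Xu mlr).
apply: le_measure; rewrite ?inE.
- rewrite -[X in measurable X]setTI.
  have mF : measurable_fun setT
      (fun t : T2 => reflector (U1 x 0%R 0%R) rho y *m lift1mx X *m lift1mx (U2 t))%R.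
    by apply: measurable_mulmx => //; exact: measurableT_comp (@measurable_lift1mx R n.+1) _.
  by apply: mF => //; exact: measurable_large_return.
- rewrite -[X in measurable X]setTI.
  have mF : measurable_fun setT (fun t : T2 => X *m U2 t)%R by exact: measurable_mulmx.
  by apply: mF => //; exact: measurable_large_return.
move=> t /= [k kK]; rewrite -mulmxA lift1mxM => lt; apply: contrapT => nlr.
have : (normc (retamp (reflector (U1 x 0 0) rho y *m lift1mx (X *m U2 t)) e1 0 k) <= gam')%R.
  apply: (retamp_level (K := K) ar rho0 ale gam0) => // j jK.
  by rewrite leNgt; apply/negP => jlt; apply: nlr; exists j.
by rewrite leNgt lt.
Qed.

End large_return.

Section large_return_union.
Context {R : realType} (d : nat -> measure_display)
    (T : forall N, measurableType (d N)) (P : forall N, probability (T N) R)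
    (U : forall N, T N -> 'M[R[i]]_N).
Arguments U : clear implicits.
Hypothesis U_haar : forall N, (0 < N)%N -> haar_unitary (P N) (U N).
Local Notation normc := (@Normc.normc R).
Local Open Scope ereal_scope.

(** The step is iterated with thresholds [eps * (1 + j / K)]. A level may raise the threshold by
    [eps / K] and needs at most [8 K eps^3], for which [16 K^2 eps^2 <= 1] leaves room. Each of the
    [K] corner entries contributes [q]. *)
Lemma haar_large_return_le (K : nat) (eps : R) (q : R) (n : nat) :
  (0 <= eps)%R -> (16 * K%:R ^+ 2 * eps ^+ 2 <= 1)%R -> (0 < K <= n)%N -> (0 <= q)%R ->
  (forall m, (n - K <= m <= n)%N ->
    P m.+1 [set t | eps < normc (U m.+1 t 0%R 0%R)]%R <= q%:E) ->
  P n.+1 [set t | large_return (e1 : 'cV_(1 + n)) K (2 * eps)%R (U n.+1 t)]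
    <= (K%:R * q)%:E.
Proof.
move=> eps0 small /andP[K0 Kn] q0 qle.
have K0' : (0 < K%:R :> R)%R by rewrite ltr0n.
(* [j] is the number of controlled times and [m.+1] the matrix size; they decrease together, and at
   [j = 0] the event is empty. *)
suff H j m : (j <= K)%N -> (m + (K - j) = n)%N ->
    P m.+1 [set t | large_return (e1 : 'cV_(1 + m)) j (eps * (1 + j%:R / K%:R))%R
      (U m.+1 t)] <= (j%:R * q)%:E.
  have := H K n (leqnn _); rewrite subnn addn0 divff ?gt_eqF// => /(_ erefl).
  by rewrite -[(1 + 1)%R]/(2%:R)%R mulrC.
elim: j m => [|j IHj] m jK mE.
  rewrite (_ : [set t | _] = set0) ?measure0 ?mul0r//.
  by apply/seteqP; split => // t [].
case: m mE => [|m] mE; first by lia.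
have -> : (j.+1%:R * q)%:E = q%:E + (j%:R * q)%:E.
  by rewrite -EFinD -natr1 mulrDl mul1r addrC.
have x0 : (0 <= j%:R / K%:R :> R)%R by rewrite divr_ge0.
have x1 : (j%:R / K%:R <= 1 :> R)%R.
  by rewrite ler_pdivrMr// mul1r ler_nat ltnW.
have sm : (16 * (eps * K%:R) ^+ 2 <= 1)%R by rewrite exprMn mulrA mulrAC.
apply: (le_trans (haar_large_return_step (K := j) (eps := eps)
    (gam := (eps * (1 + j%:R / K%:R))%R) (U_haar _) (U_haar _) _ _ _ _)) => //.
- by rewrite mulr_ge0//; lra.
- apply: (@le_trans _ _ (4 * (eps * K%:R) * (eps * 1))%R).
    have : (j%:R <= K%:R :> R)%R by rewrite ler_nat ltnW.
    have : (0 <= j%:R :> R)%R by [].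
    move: (j%:R / K%:R)%R x0 x1 => x x0 x1 j0 jle.
    have : (eps * (1 + x) <= eps * 2)%R by rewrite ler_wpM2l//; lra.
    have : (0 <= eps * (1 + x))%R by rewrite mulr_ge0//; lra.
    move: (eps * (1 + x))%R => y y0 y2.
    have : (2 * eps * j%:R * y <= 2 * eps * K%:R * (eps * 2))%R.
      by rewrite ler_pM ?mulr_ge0// ler_wpM2l ?mulr_ge0.
    by move=> /le_trans; apply; lra.
  have K1 : (1 <= K%:R :> R)%R by rewrite ler1n.
  have : (eps * 1 <= eps * K%:R)%R by rewrite ler_wpM2l.
  have : (0 <= eps * K%:R)%R by rewrite mulr_ge0.
  move: (eps * K%:R)%R sm => y sm y0; nra.
- by rewrite -[leLHS]mulr1 ler_wpM2l// lerDl divr_ge0.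
- have -> : (j.+1%:R / K%:R = j%:R / K%:R + K%:R^-1 :> R)%R.
    by rewrite -natr1 mulrDl mul1r.
  have : (j%:R <= K%:R :> R)%R by rewrite ler_nat ltnW.
  have : (0 <= j%:R :> R)%R by [].
  move: (j%:R / K%:R)%R x0 x1 => x x0 x1 j0 jle.
  have : ((1 + x) * (2 * eps * j%:R * (eps * (1 + x))) <= K%:R^-1)%R.
    rewrite -[leRHS]mul1r ler_pdivlMr//.
    have e1 : (eps * j%:R <= eps * K%:R)%R by rewrite ler_wpM2l.
    have e2 : (0 <= eps * j%:R)%R by rewrite mulr_ge0.
    have e3 : (0 <= eps * K%:R)%R by rewrite mulr_ge0.
    have -> : ((1 + x) * (2 * eps * j%:R * (eps * (1 + x))) * K%:R =
       2 * (1 + x) ^+ 2 * ((eps * j%:R) * (eps * K%:R)))%R by ring.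
    have : ((eps * j%:R) * (eps * K%:R) <= (eps * K%:R) ^+ 2)%R by rewrite expr2 ler_wpM2r.
    have : (0 <= (eps * j%:R) * (eps * K%:R))%R by rewrite mulr_ge0.
    move: (eps * j%:R * (eps * K%:R))%R ((eps * K%:R) ^+ 2)%R sm => y z sm y0 yz.
    have : ((1 + x) ^+ 2 <= 4)%R by nra.
    have : (0 <= (1 + x) ^+ 2)%R by nra.
    move: ((1 + x) ^+ 2)%R => w w0 w4.
    by nra.
  move=> /(ler_wpM2l eps0) H; rewrite addrA [leRHS]mulrDr mulrDr mulr1 lerD2l.
  by rewrite -mulrA.
apply: leeD; last by apply: IHj; lia.
by apply: qle; lia.
Qed.

End large_return_union.

(** * Moments of an entry *)

Section bounded_measurable.
Context {R : realType} d (T : measurableType d).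
Implicit Types f g : T -> R.

(** A class of integrable functions stable under sums, products and powers: linearity of the
    expectation then comes without separate integrability arguments. *)
Definition bmeas f := measurable_fun setT f /\ exists M, forall t, `|f t| <= M.

Lemma bmeas_cst r : bmeas (fun=> r).
Proof. by split; [exact: measurable_cst|exists `|r|]. Qed.

Lemma bmeasD f g : bmeas f -> bmeas g -> bmeas (fun t => f t + g t).
Proof.
move=> [mf [A fA]] [mg [B gB]]; split; first exact: measurable_funD.
by exists (A + B) => t; rewrite (le_trans (ler_normD _ _))// lerD.
Qed.

Lemma bmeasM f g : bmeas f -> bmeas g -> bmeas (fun t => f t * g t).
Proof.
move=> [mf [A fA]] [mg [B gB]]; split; first exact: measurable_funM.
by exists (A * B) => t; rewrite normrM ler_pM.
Qed.

Lemma bmeasN f : bmeas f -> bmeas (fun t => - f t).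
Proof.
by move=> [mf [A fA]]; split; [exact: measurable_funN|exists A => t; rewrite normrN].
Qed.

Lemma bmeasB f g : bmeas f -> bmeas g -> bmeas (fun t => f t - g t).
Proof. by move=> bf bg; apply: bmeasD => //; exact: bmeasN. Qed.

Lemma bmeasX f k : bmeas f -> bmeas (fun t => f t ^+ k).
Proof.
move=> bf; elim: k => [|k IHk]; first exact: bmeas_cst.
by under eq_fun do rewrite exprS; exact: bmeasM.
Qed.

Lemma bmeas_sum (I : Type) (s : seq I) (Q : pred I) (F : I -> T -> R) :
  (forall i, bmeas (F i)) -> bmeas (fun t => \sum_(i <- s | Q i) F i t).
Proof.
move=> bF; elim: s => [|i s IHs].
  by under eq_fun do rewrite big_nil; exact: bmeas_cst.
under eq_fun do rewrite big_cons; case: (Q i) => //.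
exact: bmeasD.
Qed.

Variable P : probability T R.

Lemma bmeas_integrable f : bmeas f -> P.-integrable setT (EFin \o f).
Proof.
move=> [mf [M fM]]; apply: (@le_integrable _ _ _ P _ measurableT _ (cst M%:E)).
- exact/measurable_EFinP.
- by move=> t _ /=; rewrite lee_fin (le_trans (fM t))// ler_norm.
by apply: finite_measure_integrable_cst.
Qed.

Local Notation E f := (\int[P]_t f t).

Lemma expD f g : bmeas f -> bmeas g -> E (fun t => f t + g t) = E f + E g.
Proof. by move=> bf bg; rewrite RintegralD//; exact: bmeas_integrable. Qed.

Lemma expB f g : bmeas f -> bmeas g -> E (fun t => f t - g t) = E f - E g.
Proof. by move=> bf bg; rewrite RintegralB//; exact: bmeas_integrable. Qed.

Lemma expZ f r : bmeas f -> E (fun t => r * f t) = r * E f.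
Proof. by move=> bf; rewrite RintegralZl//; exact: bmeas_integrable. Qed.

Lemma exp_cst r : E (fun=> r) = r.
Proof. by rewrite Rintegral_cst// [X in fine X]probability_setT mulr1. Qed.

Lemma exp_le f g : bmeas f -> bmeas g -> (forall t, f t <= g t) -> E f <= E g.
Proof. by move=> bf bg fg; apply: le_Rintegral => //; exact: bmeas_integrable. Qed.

Lemma exp_norm_le f M : bmeas f -> (forall t, `|f t| <= M) -> `|E f| <= M.
Proof.
move=> bf fM; rewrite ler_norml -{1}(exp_cst (- M)) -{2}(exp_cst M).
apply/andP; split; apply: exp_le => //; try exact: bmeas_cst;
  by move=> t; have := fM t; rewrite ler_norml => /andP[].
Qed.

Lemma exp_sum (I : Type) (s : seq I) (Q : pred I) (F : I -> T -> R) :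
  (forall i, bmeas (F i)) ->
  E (fun t => \sum_(i <- s | Q i) F i t) = \sum_(i <- s | Q i) E (F i).
Proof.
move=> bF; elim: s => [|i s IHs].
  by under eq_Rintegral do rewrite big_nil; rewrite exp_cst big_nil.
under eq_Rintegral do rewrite big_cons; rewrite big_cons; case: (Q i) => //.
by rewrite expD ?IHs//; exact: bmeas_sum.
Qed.

Lemma exp_EFin f : bmeas f -> (E f)%:E = (\int[P]_t (f t)%:E)%E.
Proof.
by move=> bf; rewrite fineK//; apply: integrable_fin_num => //; exact: bmeas_integrable.
Qed.

End bounded_measurable.

Lemma eq_law_integral {R : realType} d1 d2 d3 (T1 : measurableType d1)
    (T2 : measurableType d2) (E : measurableType d3) (P1 : probability T1 R)
    (P2 : probability T2 R) (X1 : T1 -> E) (X2 : T2 -> E) (f : E -> \bar R) :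
  measurable_fun setT X1 -> measurable_fun setT X2 -> measurable_fun setT f ->
  (forall x, 0 <= f x)%E ->
  (forall B, measurable B -> P1 (X1 @^-1` B) = P2 (X2 @^-1` B)) ->
  (\int[P1]_t f (X1 t) = \int[P2]_t f (X2 t))%E.
Proof.
move=> m1 m2 mf f0 H.
pose Y1 : {mfun T1 >-> E} := HB.pack X1 (isMeasurableFun.Build _ _ _ _ X1 m1).
pose Y2 : {mfun T2 >-> E} := HB.pack X2 (isMeasurableFun.Build _ _ _ _ X2 m2).
have := @ge0_integral_distribution _ _ _ _ _ P1 Y1 f mf f0.
have := @ge0_integral_distribution _ _ _ _ _ P2 Y2 f mf f0.
rewrite /comp => <- <-; apply: eq_measure_integral => A mA _; exact: H.
Qed.

Section taylor.
Context {R : realType}.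

(** Uniformity matters because [A] and [y] will depend on the random point. The remainder at [p.+1]
    is [A + y] times the remainder at [p], plus ['C(p, 2) A^(p-2) y^3]; as [|A + y| <= 4], the
    constant becomes [4 * M + 'C(p, 2)]. *)
Lemma taylor2 (p : nat) : exists M : R, 0 <= M /\ forall A y : R,
  0 <= A <= 1 -> `|y| <= 3 ->
  `|(A + y) ^+ p - (A ^+ p + p%:R * A ^+ p.-1 * y + 'C(p, 2)%:R * A ^+ p.-2 * y ^+ 2)|
    <= M * `|y| ^+ 3.
Proof.
elim: p => [|p [M [M0 IHp]]].
  exists 0; split=> // A y _ _; rewrite !expr0 bin0n !mulr0n !mul0r !addr0 subrr normr0.
  exact: lexx.
exists (4 * M + 'C(p, 2)%:R); split; first by rewrite addr_ge0 ?mulr_ge0.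
move=> A y A01 y3; have {IHp} := IHp A y A01 y3.
set r := (A + y) ^+ p - _ => rM.
(* The truncated exponents [p.-1] and [p.-2] are harmless: where truncation occurs, the coefficients
   [p] and ['C(p, 2)] vanish. *)
have pA : p%:R * A ^+ p.-1 * A = p%:R * A ^+ p.
  by case: p {M M0 r rM} => [|p]; rewrite ?mul0r//= -mulrA -exprSr.
have CA : 'C(p, 2)%:R * A ^+ p.-2 * A = 'C(p, 2)%:R * A ^+ p.-1.
  by case: p {M M0 r rM pA} => [|[|p]]; rewrite ?mul0r//= -mulrA -exprSr.
have C2 : 'C(p.+1, 2)%:R = 'C(p, 2)%:R + p%:R :> R by rewrite binS bin1 natrD.
have -> : (A + y) ^+ p.+1 - (A ^+ p.+1 + p.+1%:R * A ^+ p.+1.-1 * y +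
    'C(p.+1, 2)%:R * A ^+ p.+1.-2 * y ^+ 2) =
    (A + y) * r + 'C(p, 2)%:R * A ^+ p.-2 * y ^+ 3.
  rewrite /r C2 /= !exprS -natr1.
  transitivity ((A + y) * (A + y) ^+ p - (A * A ^+ p + (p%:R * A ^+ p + A ^+ p) * y +
    ('C(p, 2)%:R * A ^+ p.-1 + p%:R * A ^+ p.-1) * y ^+ 2)); first by ring.
  by rewrite -pA -CA; ring.
have [A0 A1] : 0 <= A /\ A <= 1 by move: A01 => /andP[].
rewrite (le_trans (ler_normD _ _))// [leRHS]mulrDl lerD//.
  rewrite normrM -mulrA ler_pM//.
  by rewrite (le_trans (ler_normD _ _))// (ger0_norm A0); lra.
rewrite !normrM !normrX ler_wpM2r ?exprn_ge0//.
by rewrite normr_nat ler_piMr// exprn_ile1// ger0_norm.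
Qed.

Lemma eq_of_le_small (x M : R) : (forall t, 0 < t <= 1 -> `|x| <= M * t) -> x = 0.
Proof.
move=> H; apply/eqP; rewrite -normr_le0; apply/ler_addgt0Pr => e e0; rewrite add0r.
have M0 : 0 <= M by have := H 1; rewrite ltr01 lexx mulr1 => /(_ isT); apply: le_trans.
pose t := Num.min 1 (e / (M + 1)).
have t0 : 0 < t by rewrite lt_min ltr01 divr_gt0// ltr_wpDl.
have tM : t * (M + 1) <= e by rewrite -ler_pdivlMr ?ge_min ?lexx ?orbT// ltr_wpDl.
have := H t; rewrite t0 ge_min lexx => /(_ isT) /le_trans; apply.
by apply: le_trans tM; rewrite mulrC ler_pM2l// lerDl.
Qed.

End taylor.

Section column_moments.
Context {R : realType}.
Local Notation C := R[i].

(** The norm of [R[i]] has values in [R[i]]; integration requires this real-valued squared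
    modulus. *)
Definition nsq (z : C) : R := complex.Re z ^+ 2 + complex.Im z ^+ 2.

Lemma nsqE z : (nsq z)%:C = `|z| ^+ 2.
Proof. by rewrite -add_Re2_Im2. Qed.

Lemma conjC_realC (x : R) : (x%:C : C)^*%R = x%:C.
Proof. by apply/CrealP/complex_realP; exists x. Qed.

Lemma nsq_ge0 z : 0 <= nsq z.
Proof. by rewrite addr_ge0 ?sqr_ge0. Qed.

Lemma nsqM z w : nsq (z * w) = nsq z * nsq w.
Proof. by apply: (@complexI R); rewrite rmorphM/= !nsqE normrM exprMn. Qed.

Lemma nsq_normc z : nsq z = Normc.normc z ^+ 2.
Proof. by apply: (@complexI R); rewrite rmorphXn/= nsqE. Qed.

Lemma measurable_nsq d (T : measurableType d) (f : T -> C) :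
  measurable_fun setT f -> measurable_fun setT (fun t => nsq (f t)).
Proof.
move=> /measurable_complexP[mr mi].
by apply: measurable_funD; apply: measurable_funX.
Qed.

Lemma e1E n : (e1 : 'cV[C]_(1 + n)) = delta_mx 0 0.
Proof.
apply/colP => i; rewrite !mxE; case: splitP => j ij; rewrite !mxE.
  have -> : i = 0 by apply: val_inj; rewrite /= ij; case: (j) => -[].
  by rewrite [j]ord1 !eqxx.
by case: eqVneq => // i0; move: ij; rewrite i0.
Qed.

Variables (n : nat) (d : measure_display) (T : measurableType d).
Variables (P : probability T R) (U : T -> 'M[C]_(1 + n)).
Hypothesis HU : haar_unitary P U.
Local Notation E f := (\int[P]_t f t).
Local Notation X i := (fun t => nsq (U t i 0)).

Let mU i j : measurable_fun setT (fun t => U t i j).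
Proof. by have /measurable_mxP := haar_measurable HU; exact. Qed.

Lemma sum_col_nsq t : \sum_i nsq (U t i 0) = 1.
Proof.
apply: (@complexI R); rewrite rmorph_sum rmorph1/=.
have U'U : (U t) ^t* *m U t = 1%:M by apply: mulmx1C; apply/unitarymxP; exact: HU.1.
have := congr1 (fun M : 'M[C]_(1 + n) => M 0 0) U'U.
rewrite !mxE eqxx mulr1n => <-; apply: eq_bigr => i _.
by rewrite !mxE nsqE normCKC.
Qed.

Lemma nsq_col_le1 i t : nsq (U t i 0) <= 1.
Proof.
rewrite -(sum_col_nsq t) (bigD1 i)//= lerDl sumr_ge0// => j _; exact: nsq_ge0.
Qed.

Lemma bmeas_col_nsq i : bmeas (X i).
Proof.
split; first exact: measurable_nsq.
by exists 1 => t; rewrite ger0_norm ?nsq_ge0// nsq_col_le1.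
Qed.

Definition col_moment p := E (fun t => nsq (U t 0 0) ^+ p).

Lemma col_moment_unit (v : 'cV[C]_(1 + n)) p : v ^t* *m v = 1%:M ->
  E (fun t => nsq ((v ^t* *m U t *m e1) 0 0) ^+ p) = col_moment p.
Proof.
move=> /unitary_col[S Su <-].
pose f (M : 'M[C]_(1 + n)) := ((nsq ((e1 ^t* *m M *m e1) 0 0)) ^+ p)%:E.
have fE M : f M = (nsq (M 0 0) ^+ p)%:E.
  rewrite /f e1E trmx_delta map_delta_mx.
  by rewrite -rowE -colE !mxE.
have S'u : S ^t* \is unitarymx by rewrite trmxC_unitary.
have mU' := haar_measurable HU.
have mSU : measurable_fun setT (fun t => S ^t* *m U t) by exact: measurable_mulmx.
have mf : measurable_fun setT f.
  apply/measurable_EFinP; apply: measurable_funX; apply: measurable_nsq.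
  have /measurable_mxP : measurable_fun setT (fun M : 'M[C]_(1 + n) => e1 ^t* *m M *m e1).
    by apply: measurable_mulmx => //; exact: measurable_mulmx.
  exact.
have f0 M : (0 <= f M)%E by rewrite lee_fin exprn_ge0 ?nsq_ge0.
have := eq_law_integral mSU mU' mf f0 (fun B mB => haar_mull HU S'u mB).
rewrite /col_moment /Rintegral => H; congr fine.
transitivity (\int[P]_t f (S ^t* *m U t))%E.
  by apply: eq_integral => t _; rewrite /f trmxC_mulmx !mulmxA.
by rewrite H; apply: eq_integral => t _; rewrite fE.
Qed.

(** The combination is [sqrt (1 + nsq c)] times the component of the first column along a unit
    vector [v] supported by the coordinates [0] and [i], and all such components have the same
    moments. *)
Lemma col_moment_comb i (c : C) p : i != 0 ->
  E (fun t => nsq (U t 0 0 + c * U t i 0) ^+ p) = (1 + nsq c) ^+ p * col_moment p.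
Proof.
move=> i0; pose r : R := Num.sqrt (1 + nsq c).
have c0 := nsq_ge0 c.
have r0 : 0 < r by rewrite sqrtr_gt0; lra.
have rr : r ^+ 2 = 1 + nsq c by rewrite sqr_sqrtr//; lra.
pose w : 'cV[C]_(1 + n) := delta_mx 0 0 + c^*%R *: delta_mx i 0.
have w'E : w ^t* = delta_mx 0 0 + c *: delta_mx 0 i.
  by rewrite /w linearD/= map_mxD scalemxC conjCK !trmx_delta !map_delta_mx.
pose v := (r^-1)%:C *: w.
have vv : v ^t* *m v = 1%:M.
  rewrite scalemxC -scalemxAl -scalemxAr scalerA conjC_realC -rmorphM/=.
  have -> : w ^t* *m w = (1 + nsq c)%:C%:M.
    rewrite w'E /w mulmxDl !mulmxDr -!scalemxAl -!scalemxAr !mul_delta_mx_cond.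
    rewrite !eqxx eq_sym (negbTE i0) !mulr0n !scaler0 addr0 add0r !mulr1n scalerA.
    rewrite mulrC -normCKC -nsqE; apply/matrixP => a b; rewrite !ord1 !mxE.
    have E : (1 + nsq c)%:C = 1 + (nsq c)%:C :> C by rewrite [LHS]rmorphD rmorph1.
    by rewrite mulr1n mulr1 E.
  rewrite -rr scale_scalar_mx -rmorphM/= -invfM -expr2 mulVf ?rmorph1//.
  by rewrite expf_neq0// gt_eqF.
rewrite -(col_moment_unit p vv) -expZ; last first.
  split.
    apply: measurable_funX; apply: measurable_nsq.
    have /measurable_mxP : measurable_fun setT (fun t => v ^t* *m U t *m e1).
      apply: measurable_mulmx => //; apply: measurable_mulmx => //.
      exact: (haar_measurable HU).
    exact.
  exists ((r^-1 ^+ 2 * (2 * (1 + nsq c))) ^+ p) => t.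
  rewrite normrX; apply: lerXn2r; rewrite ?nnegrE ?normr_ge0//.
    by apply: mulr_ge0; [exact: sqr_ge0|lra].
  have -> : (v ^t* *m U t *m e1) 0 0 = (r^-1)%:C * (U t 0 0 + c * U t i 0).
    rewrite scalemxC conjC_realC w'E e1E -!scalemxAl mxE mulmxDl mulmxDl -!scalemxAl.
    by rewrite -!rowE -!colE !mxE.
  rewrite ger0_norm ?nsq_ge0// nsqM /nsq /= expr0n addr0 ler_wpM2l ?sqr_ge0//.
  have := nsq_col_le1 0 t; have := nsq_col_le1 i t.
  move: c0; clear; move: c => [x y]; rewrite /nsq/=.
  case: (U t 0 0) => a b; case: (U t i 0) => a' b' /= H1 H2 H3.
  have : (a + (x * a' - y * b')) ^+ 2 <= 2 * a ^+ 2 + 2 * (x * a' - y * b') ^+ 2.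
    have := sqr_ge0 (a - (x * a' - y * b')); lra.
  have : (b + (x * b' + y * a')) ^+ 2 <= 2 * b ^+ 2 + 2 * (x * b' + y * a') ^+ 2.
    have := sqr_ge0 (b - (x * b' + y * a')); lra.
  have : (x * a' - y * b') ^+ 2 + (x * b' + y * a') ^+ 2 =
         (x ^+ 2 + y ^+ 2) * (a' ^+ 2 + b' ^+ 2) by ring.
  have : (x ^+ 2 + y ^+ 2) * (a' ^+ 2 + b' ^+ 2) <= (x ^+ 2 + y ^+ 2) * 1.
    by rewrite ler_wpM2l.
  lra.
apply: eq_Rintegral => t _.
have -> : (v ^t* *m U t *m e1) 0 0 = (r^-1)%:C * (U t 0 0 + c * U t i 0).
  rewrite scalemxC conjC_realC w'E e1E -!scalemxAl mxE mulmxDl mulmxDl -!scalemxAl.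
  by rewrite -!rowE -!colE !mxE.
rewrite nsqM {3}/nsq /= expr0n addr0 -rr -exprMn mulrA -exprMn.
by rewrite divff ?gt_eqF// expr1n mul1r.
Qed.

End column_moments.

Section moment_recursion.
Context {R : realType}.
Local Notation C := R[i].

(** With [s = a + i b] and [u = c + i d], the bases of the four powers are [|s + tau u|^2] for [tau]
    equal to [t], [- t], [i t] and [- i t]. The terms of order [t] cancel, and those of order [t^2]
    add up to a multiple of [A ^+ q.-1 * D]. *)
Lemma four_term_expansion (q : nat) : exists M : R, forall (a b c d t A D : R),
  A = a ^+ 2 + b ^+ 2 -> D = c ^+ 2 + d ^+ 2 -> A <= 1 -> D <= 1 -> 0 < t <= 1 ->
  `|((a + t * c) ^+ 2 + (b + t * d) ^+ 2) ^+ q + ((a - t * c) ^+ 2 + (b - t * d) ^+ 2) ^+ q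
   + ((a - t * d) ^+ 2 + (b + t * c) ^+ 2) ^+ q + ((a + t * d) ^+ 2 + (b - t * c) ^+ 2) ^+ q
   - (4 * A ^+ q + 4 * q%:R ^+ 2 * t ^+ 2 * (A ^+ q.-1 * D))| <= M * t ^+ 3.
Proof.
have [M [M0 HM]] := taylor2 (R := R) q.
exists (4 * (M * 27) + 4 * 'C(q, 2)%:R) => a b c d t A D AE DE A1 D1 /andP[t0 t1].
have A0 : 0 <= A by rewrite AE addr_ge0 ?sqr_ge0.
have D0 : 0 <= D by rewrite DE addr_ge0 ?sqr_ge0.
have t0' := ltW t0.
have A01 : 0 <= A <= 1 by rewrite A0.
pose B := 2 * (a * c + b * d); pose B' := 2 * (b * c - a * d).
have Bb : `|B| <= 2.
  have := sqr_ge0 (a - c); have := sqr_ge0 (b - d).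
  have := sqr_ge0 (a + c); have := sqr_ge0 (b + d).
  by rewrite ler_norml /B; lra.
have B'b : `|B'| <= 2.
  have := sqr_ge0 (b - c); have := sqr_ge0 (a - d).
  have := sqr_ge0 (b + c); have := sqr_ge0 (a + d).
  by rewrite ler_norml /B'; lra.
have yb (x : R) : `|x| <= 2 -> `|t * x + t ^+ 2 * D| <= 3 * t.
  move=> x2; rewrite (le_trans (ler_normD _ _))// !normrM (ger0_norm t0').
  rewrite (ger0_norm D0).
  have : t * `|x| <= t * 2 by rewrite ler_wpM2l.
  have : t ^+ 2 * D <= t * 1 by rewrite expr2 -mulrA ler_wpM2l// mulr_ile1.
  lra.
pose rem y := (A + y) ^+ q -
  (A ^+ q + q%:R * A ^+ q.-1 * y + 'C(q, 2)%:R * A ^+ q.-2 * y ^+ 2).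
have remb (x : R) : `|x| <= 2 -> `|rem (t * x + t ^+ 2 * D)| <= (M * 27) * t ^+ 3.
  move=> x2; apply: (le_trans (HM _ _ A01 _)).
    by apply: (le_trans (yb _ x2)); lra.
  rewrite -mulrA ler_wpM2l//.
  have -> : 27 * t ^+ 3 = (3 * t) ^+ 3 by ring.
  by apply: lerXn2r; rewrite ?nnegrE ?yb// mulr_ge0.
have nBb : `|- B| <= 2 by rewrite normrN.
have nB'b : `|- B'| <= 2 by rewrite normrN.
have := remb _ Bb; have := remb _ nBb; have := remb _ B'b; have := remb _ nB'b.
have remE y : (A + y) ^+ q =
  (A ^+ q + q%:R * A ^+ q.-1 * y + 'C(q, 2)%:R * A ^+ q.-2 * y ^+ 2) + rem y.
  by rewrite /rem; ring.
have -> : (a + t * c) ^+ 2 + (b + t * d) ^+ 2 = A + (t * B + t ^+ 2 * D).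
  by rewrite AE DE /B; ring.
have -> : (a - t * c) ^+ 2 + (b - t * d) ^+ 2 = A + (t * - B + t ^+ 2 * D).
  by rewrite AE DE /B; ring.
have -> : (a - t * d) ^+ 2 + (b + t * c) ^+ 2 = A + (t * B' + t ^+ 2 * D).
  by rewrite AE DE /B'; ring.
have -> : (a + t * d) ^+ 2 + (b - t * c) ^+ 2 = A + (t * - B' + t ^+ 2 * D).
  by rewrite AE DE /B'; ring.
rewrite !remE.
(* Up to sign, [B] and [B'] are twice the real and imaginary parts of the product of [u] with the
   conjugate of [s]. *)
have BB : B ^+ 2 + B' ^+ 2 = 4 * A * D by rewrite AE DE /B /B'; ring.
have CA : 'C(q, 2)%:R * A ^+ q.-2 * A = 'C(q, 2)%:R * A ^+ q.-1.
  by case: q {HM rem remb remE} => [|[|q]]; rewrite ?mul0r//= -mulrA -exprSr.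
(* At order [t^2] the linear Taylor terms contribute [q] and the quadratic ones [2 'C(q, 2)]. *)
have C2 : q%:R ^+ 2 = q%:R + 2 * 'C(q, 2)%:R :> R.
  rewrite -natrX -natrM -natrD; congr _%:R.
  by rewrite mul_bin_left bin1; case: (q) => // k; rewrite subn1/= -mulSn expnS expn1.
move: (rem _) (rem _) (rem _) (rem _) => r1 r2 r3 r4 h4 h3 h2 h1.
set L := (X in `|X| <= _).
have -> : L = r4 + r3 + r2 + r1 + 4 * 'C(q, 2)%:R * A ^+ q.-2 * t ^+ 4 * D ^+ 2.
  rewrite /L.
  transitivity (r4 + r3 + r2 + r1 + 4 * 'C(q, 2)%:R * A ^+ q.-2 * t ^+ 4 * D ^+ 2
     + 4 * t ^+ 2 * (q%:R - q%:R ^+ 2) * A ^+ q.-1 * D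
     + 2 * t ^+ 2 * ('C(q, 2)%:R * A ^+ q.-2) * (B ^+ 2 + B' ^+ 2)); first by ring.
  rewrite BB.
  transitivity (r4 + r3 + r2 + r1 + 4 * 'C(q, 2)%:R * A ^+ q.-2 * t ^+ 4 * D ^+ 2
     + 4 * t ^+ 2 * (q%:R - q%:R ^+ 2) * A ^+ q.-1 * D
     + 8 * t ^+ 2 * ('C(q, 2)%:R * A ^+ q.-2 * A) * D); first by ring.
  by rewrite CA C2; ring.
have h5 : `|4 * 'C(q, 2)%:R * A ^+ q.-2 * t ^+ 4 * D ^+ 2| <= 4 * 'C(q, 2)%:R * t ^+ 3.
  rewrite ger0_norm; last by rewrite !mulr_ge0 ?exprn_ge0.
  have e : t ^+ 4 * D ^+ 2 <= t ^+ 3.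
    rewrite [leLHS](_ : _ = t ^+ 3 * (t * D ^+ 2)); last by ring.
    by rewrite ler_piMr ?exprn_ge0// mulr_ile1 ?exprn_ge0// exprn_ile1.
  rewrite [leLHS](_ : _ = 4 * 'C(q, 2)%:R * (A ^+ q.-2 * (t ^+ 4 * D ^+ 2))); last by ring.
  rewrite ler_wpM2l ?mulr_ge0//; apply: le_trans e.
  by rewrite ler_piMl ?mulr_ge0 ?exprn_ge0// exprn_ile1.
rewrite (le_trans (ler_normD _ _))// [leRHS]mulrDl lerD//.
have := ler_normD (r4 + r3 + r2) r1; have := ler_normD (r4 + r3) r2.
have := ler_normD r4 r3; move: h1 h2 h3 h4 {h5}.
move: (M * 27) (t ^+ 3) => x y; rewrite -mulrA; move: (x * y) => z.
move: (`|r4 + r3 + r2 + r1|) (`|r4 + r3 + r2|) (`|r4 + r3|) => u1 u2 u3.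
move: `|r4| `|r3| `|r2| `|r1| => v4 v3 v2 v1.
lra.
Qed.

Variables (n : nat) (d : measure_display) (T : measurableType d).
Variables (P : probability T R) (U : T -> 'M[C]_(1 + n)).
Hypothesis HU : haar_unitary P U.
Local Notation E f := (\int[P]_t f t).

(* With [s] and [c] the first two relevant entries of the first column, the law
   of [s + t c] is that of [sqrt (1 + t^2) s] for [t] complex. Averaging over
   the four phases of [t] cancels the odd terms; compare the orders [t^2]. *)
Lemma col_moment_cross i p : i != 0 ->
  p.+1%:R * E (fun t => nsq (U t 0 0) ^+ p * nsq (U t i 0)) = col_moment P U p.+1.
Proof.
move=> i0; set m := E _; set Cq := col_moment P U p.+1.
have [M HM] := four_term_expansion p.+1.
have [M' [M'0 HM']] := taylor2 (R := R) p.+1.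
have bX := bmeas_col_nsq HU.
have mU j k : measurable_fun setT (fun t => U t j k).
  by have /measurable_mxP := haar_measurable HU; exact.
(* This is the coefficient of [t^2] in [E S - E G] below. [E S] is known exactly by invariance and
   [S] equals [G] up to O(t^3), so the coefficient is O(t) and must vanish. *)
suff : 4 * p.+1%:R * (Cq - p.+1%:R * m) = 0.
  by move/eqP; rewrite !mulf_eq0 !pnatr_eq0/= subr_eq0 eq_sym => /eqP.
apply: (@eq_of_le_small _ _ (M + 4 * `|Cq| * ('C(p.+1, 2)%:R + M'))) => t /andP[t0 t1].
have t0' := ltW t0.
pose f (c : C) := fun w => nsq (U w 0 0 + c * U w i 0) ^+ p.+1.
have bf c : bmeas (f c).
  apply: bmeasX; split.
    by apply: measurable_nsq; apply: measurable_complexD => //; apply: measurable_complexM.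
  exists (2 + 2 * nsq c) => w; rewrite ger0_norm ?nsq_ge0//.
  have := nsq_col_le1 HU 0 w; have := nsq_col_le1 HU i w.
  have : nsq (c * U w i 0) <= nsq c by rewrite nsqM ler_piMr ?nsq_ge0 ?(nsq_col_le1 HU).
  move: (c * U w i 0) => [x y]; case: (U w 0 0) => a b; rewrite /nsq/= => H1 _ H2.
  have := sqr_ge0 (a - x); have := sqr_ge0 (b - y); lra.
have Ef c : nsq c = t ^+ 2 -> E (f c) = (1 + t ^+ 2) ^+ p.+1 * Cq.
  by move=> ct; rewrite /f col_moment_comb// ct.
pose S := fun w => f t%:C w + f (- t%:C) w + f (0 +i* t) w + f (0 -i* t) w.
pose G := fun w => 4 * nsq (U w 0 0) ^+ p.+1 +
  4 * p.+1%:R ^+ 2 * t ^+ 2 * (nsq (U w 0 0) ^+ p * nsq (U w i 0)).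
have bS : bmeas S by do 3 apply: bmeasD => //.
have bXp : bmeas (fun w => nsq (U w 0 0) ^+ p * nsq (U w i 0)).
  by apply: bmeasM => //; apply: bmeasX.
have bX0 : bmeas (fun w => nsq (U w 0 0) ^+ p.+1) by apply: bmeasX.
have bG : bmeas G.
  by apply: bmeasD; apply: bmeasM => //; exact: bmeas_cst.
have n1 : nsq t%:C = t ^+ 2 by rewrite /nsq/=; ring.
have n2 : nsq (- t%:C) = t ^+ 2 by rewrite /nsq/=; ring.
have n3 : nsq (0 +i* t) = t ^+ 2 by rewrite /nsq/=; ring.
have n4 : nsq (0 -i* t) = t ^+ 2 by rewrite /nsq/=; ring.
have ES : E S = 4 * ((1 + t ^+ 2) ^+ p.+1 * Cq).
  rewrite /S expD//; last by do 2 apply: bmeasD => //.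
  rewrite expD//; last by apply: bmeasD.
  by rewrite expD// !Ef//; ring.
have EG : E G = 4 * Cq + 4 * p.+1%:R ^+ 2 * t ^+ 2 * m.
  by rewrite /G expD ?expZ//; apply: bmeasM => //; exact: bmeas_cst.
have SG : `|E S - E G| <= M * t ^+ 3.
  rewrite -expB//; apply: exp_norm_le; first exact: bmeasB.
  move=> w; have := nsq_col_le1 HU 0 w; have := nsq_col_le1 HU i w.
  rewrite /S /G /f; case: (U w 0 0) => a b; case: (U w i 0) => c e.
  have -> : nsq (a +i* b + t%:C * (c +i* e)) = (a + t * c) ^+ 2 + (b + t * e) ^+ 2.
    by rewrite /nsq/=; ring.
  have -> : nsq (a +i* b + - t%:C * (c +i* e)) = (a - t * c) ^+ 2 + (b - t * e) ^+ 2.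
    by rewrite /nsq/=; ring.
  have -> : nsq (a +i* b + (0 +i* t) * (c +i* e)) = (a - t * e) ^+ 2 + (b + t * c) ^+ 2.
    by rewrite /nsq/=; ring.
  have -> : nsq (a +i* b + (0 -i* t) * (c +i* e)) = (a + t * e) ^+ 2 + (b - t * c) ^+ 2.
    by rewrite /nsq/=; ring.
  by move=> D1 A1; apply: HM => //; rewrite t0.
have tt3 : `|t ^+ 2| <= 3.
  have : t ^+ 2 <= 1 by rewrite exprn_ile1.
  by rewrite ger0_norm ?sqr_ge0//; lra.
have := HM' 1 (t ^+ 2); rewrite ler01 lexx => /(_ isT tt3).
rewrite !expr1n !mulr1 (ger0_norm (sqr_ge0 t)) => Tb.
pose r := (1 + t ^+ 2) ^+ p.+1 - (1 + p.+1%:R * t ^+ 2 + 'C(p.+1, 2)%:R * (t ^+ 2) ^+ 2).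
have rE : (1 + t ^+ 2) ^+ p.+1 =
    1 + p.+1%:R * t ^+ 2 + ('C(p.+1, 2)%:R * (t ^+ 2) ^+ 2 + r) by rewrite /r; ring.
pose r' := 'C(p.+1, 2)%:R * (t ^+ 2) ^+ 2 + r.
have r'b : `|r'| <= ('C(p.+1, 2)%:R + M') * t ^+ 3.
  rewrite (le_trans (ler_normD _ _))// [leRHS]mulrDl lerD//.
    rewrite ger0_norm ?mulr_ge0 ?exprn_ge0// ler_wpM2l//.
    by rewrite [leLHS](_ : _ = t * t ^+ 3) ?ler_piMl ?exprn_ge0//; ring.
  apply: (le_trans Tb); rewrite ler_wpM2l//.
  rewrite [leLHS](_ : _ = t ^+ 3 * t ^+ 3); last by ring.
  by rewrite ler_piMl ?exprn_ge0// exprn_ile1.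
rewrite -(ler_pM2l (exprn_gt0 2 t0)).
have -> : t ^+ 2 * `|4 * p.+1%:R * (Cq - p.+1%:R * m)| =
    `|(E S - E G) - 4 * Cq * r'|.
  rewrite -{1}(ger0_norm (sqr_ge0 t)) -normrM; congr `|_|.
  by rewrite ES EG rE -/r'; ring.
rewrite (le_trans (ler_normB _ _))//.
have -> : t ^+ 2 * ((M + 4 * `|Cq| * ('C(p.+1, 2)%:R + M')) * t) =
  M * t ^+ 3 + 4 * `|Cq| * (('C(p.+1, 2)%:R + M') * t ^+ 3) by ring.
rewrite lerD// !normrM (ger0_norm (_ : 0 <= 4))// ler_wpM2l// mulr_ge0//.
Qed.

Lemma col_moment0 : col_moment P U 0 = 1.
Proof. by rewrite /col_moment; under eq_Rintegral do rewrite expr0; rewrite exp_cst. Qed.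

(** The column has norm one, so the moment of order [p] is the sum over [i] of the mixed moments; by
    [col_moment_cross], each of the [n] terms with [i != 0] is the next moment divided by [p.+1]. *)
Lemma col_momentS p :
  (p.+1 + n)%:R * col_moment P U p.+1 = p.+1%:R * col_moment P U p.
Proof.
have bX := bmeas_col_nsq HU.
have bXX i : bmeas (fun t => nsq (U t 0 0) ^+ p * nsq (U t i 0)).
  by apply: bmeasM => //; apply: bmeasX.
have -> : col_moment P U p =
    \sum_i E (fun t => nsq (U t 0 0) ^+ p * nsq (U t i 0)).
  rewrite -exp_sum//; apply: eq_Rintegral => t _.
  by rewrite -mulr_sumr (sum_col_nsq HU) mulr1.
rewrite (bigD1 ord0)//= mulrDr mulr_sumr.
rewrite (eq_bigr (fun=> col_moment P U p.+1)); last first.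
  by move=> i i0; exact: col_moment_cross.
rewrite sumr_const (_ : #|_| = n); last first.
  transitivity #|predC1 (ord0 : 'I_n.+1)|; last by rewrite cardC1 card_ord.
  exact: eq_card.
rewrite natrD mulrDl -[in X in _ = _ + X]mulr_natl; congr (_ + _).
by congr (_ * _); apply: eq_Rintegral => t _; rewrite exprSr.
Qed.

Lemma col_moment_ge0 p : 0 <= col_moment P U p.
Proof. by apply: Rintegral_ge0 => t _; rewrite exprn_ge0 ?nsq_ge0. Qed.

Lemma col_moment_le p : col_moment P U p <= p`!%:R / n.+1%:R ^+ p.
Proof.
elim: p => [|p IHp]; first by rewrite col_moment0 expr0 divr1.
have N0 : 0 < n.+1%:R :> R by rewrite ltr0n.
rewrite ler_pdivlMr ?exprn_gt0// exprSr mulrA.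
rewrite ler_pdivlMr ?exprn_gt0// in IHp.
have : n.+1%:R * col_moment P U p.+1 <= p.+1%:R * col_moment P U p.
  by rewrite -col_momentS ler_wpM2r ?col_moment_ge0// ler_nat; lia.
rewrite factS natrM => H.
apply: (@le_trans _ _ (p.+1%:R * col_moment P U p * n.+1%:R ^+ p)).
  rewrite mulrAC (mulrC (col_moment _ _ _)) ler_wpM2r// exprn_ge0//.
by rewrite -mulrA ler_wpM2l.
Qed.

(** Markov's inequality for the power [2 p] of the modulus. [p] stays free, since a large [p] yields
    any polynomial rate. *)
Lemma haar_entry_tail p (g : R) : 0 < g ->
  (P [set t | g < Normc.normc (U t 0 0)]%R <=
    (p`!%:R / (n.+1%:R * g ^+ 2) ^+ p)%:E)%E.
Proof.
move=> g0; set A := [set t | _].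
have mA : measurable A.
  by apply: measurable_normc_gt; have /measurable_mxP := haar_measurable HU; exact.
have bX := bmeas_col_nsq HU 0.
rewrite exprMn invfM mulrA EFinM lee_pdivlMr ?exprn_gt0//.
apply: (@le_trans _ _ (col_moment P U p)%:E); last by rewrite lee_fin col_moment_le.
rewrite /col_moment exp_EFin; last exact: bmeasX.
rewrite -(setIT A) -integral_indic// -ge0_integralZr//; last 2 first.
- by apply/measurable_EFinP; exact: measurable_indic.
- by rewrite lee_fin !exprn_ge0// ltW.
apply: ge0_le_integral => //.
- by move=> t _; rewrite mule_ge0// lee_fin ?exprn_ge0// ltW.
- by apply: emeasurable_funM => //; apply/measurable_EFinP; exact: measurable_indic.
- by apply/measurable_EFinP; exact: (bmeasX p bX).1.
move=> t _; rewrite indicE -EFinM lee_fin; case: (boolP (t \in A)) => [|_]; last first.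
  by rewrite mul0r exprn_ge0 ?nsq_ge0.
rewrite inE /A /= mul1r => /ltW gt.
rewrite nsq_normc; apply: lerXn2r; rewrite ?nnegrE ?sqr_ge0//.
by apply: lerXn2r; rewrite ?nnegrE ?normc_ge0// ltW.
Qed.

End moment_recursion.

(** * Resolvents and spectral moments *)

Section weighted_resolvent.
Context {R : realType} {n : nat} (p : 'I_n -> R) (l : 'I_n -> R[i]).
Local Notation C := R[i].
Local Notation normc := (@Normc.normc R).
Hypothesis p_ge0 : forall j, 0 <= p j.
Hypothesis p_sum : \sum_j p j = 1.
Hypothesis l1 : forall j, normc (l j) = 1.

Let mean (f : 'I_n -> C) : C := \sum_j (p j)%:C * f j.

Lemma normc_real (x : R) : 0 <= x -> normc x%:C = x.
Proof. by move=> x0; rewrite /= expr0n addr0 sqrtr_sqr ger0_norm. Qed.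

Lemma normcX (x : C) k : normc (x ^+ k) = normc x ^+ k.
Proof.
by elim: k => [|k IHk]; rewrite ?expr0 ?Normc.normc1// !exprS Normc.normcM IHk.
Qed.

Let normc_mean f (g : 'I_n -> R) : (forall j, normc (f j) <= g j) ->
  normc (mean f) <= \sum_j p j * g j.
Proof.
move=> fg; apply: (le_trans (normc_sum _ _ _)); apply: ler_sum => j _.
by rewrite Normc.normcM normc_real// ler_wpM2l.
Qed.

Let normc_mean_le f M : (forall j, normc (f j) <= M) -> normc (mean f) <= M.
Proof.
by move=> /normc_mean/le_trans; apply; rewrite -mulr_suml p_sum mul1r.
Qed.

Let meanD f g : mean (fun j => f j + g j) = mean f + mean g.
Proof. by rewrite -big_split; apply: eq_bigr => j _; rewrite mulrDr. Qed.

Let meanZ c f : mean (fun j => c * f j) = c * mean f.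
Proof. by rewrite mulr_sumr; apply: eq_bigr => j _; rewrite mulrCA. Qed.

Let mean1 : mean (fun=> 1) = 1.
Proof.
rewrite /mean; under eq_bigr do rewrite mulr1.
by rewrite -rmorph_sum p_sum.
Qed.

Definition wmoment k := \sum_j (p j)%:C * l j ^+ k.
Definition wresolvent2 z := \sum_j (p j)%:C * ((z * l j) ^+ 2 / (1 - z * l j)).
Let wresolvent z := mean (fun j => (1 - z * l j)^-1).

Lemma normc_1B z j : 1 - normc z <= normc (1 - z * l j).
Proof.
have := le_normcD (1 - z * l j) (z * l j).
by rewrite subrK Normc.normc1 Normc.normcM l1 mulr1 lerBlDr.
Qed.

Let neq0 z j : normc z < 1 -> 1 - z * l j != 0.
Proof.
move=> z1; apply/eqP => E; have := normc_1B z j.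
by rewrite E Normc.normc0 subr_le0 leNgt z1.
Qed.

Let normc_inv_le z j : normc z < 1 -> normc (1 - z * l j)^-1 <= (1 - normc z)^-1.
Proof.
move=> z1; rewrite Normc.normcV lef_pV2 ?posrE ?normc_1B//; last by rewrite subr_gt0.
by apply: lt_le_trans (normc_1B _ _); rewrite subr_gt0.
Qed.

Lemma geometric_tail (x : C) m : 1 - x != 0 ->
  x ^+ 2 / (1 - x) = \sum_(k < m) x ^+ k.+2 + x ^+ m.+2 / (1 - x).
Proof.
move=> x1; elim: m => [|m IHm]; first by rewrite big_ord0 add0r.
rewrite big_ord_recr/= {}IHm -addrA; congr (_ + _).
by rewrite (exprS x m.+2); field.
Qed.

Lemma sum_exprSS_le (r : R) m : 0 <= r < 1 -> \sum_(k < m) r ^+ k.+2 <= r ^+ 2 / (1 - r).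
Proof.
move=> /andP[r0 r1]; suff : \sum_(k < m) r ^+ k.+2 + r ^+ m.+2 / (1 - r) = r ^+ 2 / (1 - r).
  by move=> <-; rewrite lerDl divr_ge0 ?exprn_ge0// subr_ge0 ltW.
elim: m => [|m IHm]; first by rewrite big_ord0 add0r.
rewrite -{}IHm big_ord_recr/= -addrA; congr (_ + _).
by rewrite (exprS r m.+2); field; rewrite subr_eq0 gt_eqF.
Qed.

(** The first [m] terms of the geometric series only involve moments of orders [2] to [m.+1]; the
    tail keeps the factor [|z|^m], which is small only away from the unit circle. *)
Lemma wresolvent2_le_inner z (b : R) m : normc z < 1 ->
  (forall k, (1 <= k < m.+2)%N -> normc (wmoment k) <= b) ->
  normc (wresolvent2 z) <= normc z ^+ 2 / (1 - normc z) * (b + normc z ^+ m).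
Proof.
move=> z1 cb; have z0 := normc_ge0 z; set r := normc z in z0 z1 *.
have -> : wresolvent2 z = \sum_(k < m) z ^+ k.+2 * wmoment k.+2 +
    mean (fun j => (z * l j) ^+ m.+2 * (1 - z * l j)^-1).
  transitivity (mean (fun j => \sum_(k < m) (z * l j) ^+ k.+2 +
      (z * l j) ^+ m.+2 * (1 - z * l j)^-1)).
    by apply: eq_bigr => j _; congr (_ * _); apply: geometric_tail; exact: neq0.
  rewrite meanD; congr (_ + _); rewrite /mean.
  under eq_bigr do rewrite mulr_sumr.
  rewrite exchange_big; apply: eq_bigr => k _; rewrite mulr_sumr.
  by apply: eq_bigr => j _; rewrite exprMn mulrCA.
rewrite (le_trans (le_normcD _ _))// mulrDr lerD//.
  apply: (le_trans (normc_sum _ _ _)).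
  apply: (@le_trans _ _ (\sum_(k < m) r ^+ k.+2 * b)).
    apply: ler_sum => k _; rewrite Normc.normcM normcX ler_wpM2l ?exprn_ge0//.
    by apply: cb; rewrite /= !ltnS.
  have b0 : 0 <= b by apply: le_trans (cb 1%N _); rewrite ?normc_ge0.
  by rewrite -mulr_suml ler_wpM2r// sum_exprSS_le// z0.
apply: normc_mean_le => j.
rewrite Normc.normcM normcX Normc.normcM l1 mulr1 -/r.
have -> : r ^+ 2 / (1 - r) * r ^+ m = r ^+ m.+2 / (1 - r).
  by rewrite mulrAC -exprD add2n.
by rewrite ler_wpM2l ?exprn_ge0// normc_inv_le.
Qed.

Let wresolventE z : normc z < 1 ->
  wresolvent z = 1 + z * wmoment 1 + wresolvent2 z.
Proof.
move=> z1; rewrite -mean1 /wmoment -[X in z * X]/(mean (fun j => l j ^+ 1)) -meanZ.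
rewrite -meanD -[wresolvent2 z]/(mean (fun j => (z * l j) ^+ 2 / (1 - z * l j))) -meanD.
apply: eq_bigr => j _; congr (_ * _); rewrite expr1.
by field; exact: neq0.
Qed.

(* Poisson kernel identity. It gives [\sum_j p_j / |1 - z l_j|^2] in terms of
   the real part of the resolvent at [z], which is used to move radially from
   radius [1 - h], where the low moments suffice, to the unit circle. *)
Lemma re_inv_1B (w : C) : 1 - w != 0 ->
  (1 - normc w ^+ 2) * normc (1 - w)^-1 ^+ 2 = 2 * complex.Re (1 - w)^-1 - 1.
Proof.
move=> w1; rewrite Normc.normcV exprVn -!nsq_normc.
have N0 : nsq (1 - w) != 0.
  rewrite nsq_normc expf_neq0//; apply: contra w1 => /eqP/Normc.eq0_normc ->//.
have -> : complex.Re (1 - w)^-1 = (1 - complex.Re w) / nsq (1 - w).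
  by case: w {w1 N0} => a b; rewrite /nsq /= add0r.
apply: (mulIf N0); rewrite mulfVK// mulrBl mul1r mulrA mulfVK//.
by case: w {w1 N0} => a b; rewrite /nsq /= add0r; ring.
Qed.

(** The resolvents at [z] and at its radial projection [z0] to radius [s] differ by [z - z0] times a
    mean of products of two kernels. Replacing the kernel at [z] by that at [z0] costs
    [t = (1 - s) / (1 - r)]; the squares are then summed by the Poisson identity, whose factor
    [1 - s^2] absorbs [r - s]. *)
Let wresolvent_outer z (s : R) : s < normc z -> 0 < s -> normc z < 1 ->
  normc (wresolvent z) <=
    normc (wresolvent ((s / normc z)%:C * z)) * (1 + 2 * ((1 - s) / (1 - normc z))).
Proof.
move=> sr s0 r1; set r := normc z in sr r1 *; set z0 := _%:C * z.
have r0 : 0 < r by exact: lt_trans sr.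
have sr0 : 0 <= s / r by rewrite divr_ge0// ltW.
have nz0 : normc z0 = s by rewrite Normc.normcM normc_real// mulfVK// gt_eqF.
have z01 : normc z0 < 1 by rewrite nz0; exact: lt_trans r1.
have dz : normc (z - z0) = r - s.
  have -> : z - z0 = (1 - s / r)%:C * z by rewrite rmorphB rmorph1 mulrBl mul1r.
  rewrite Normc.normcM normc_real ?subr_ge0 ?ler_pdivrMr ?mul1r 1?ltW//.
  by rewrite mulrBl mul1r mulfVK// gt_eqF.
set t := (1 - s) / (1 - r).
have r1' : 0 < 1 - r by rewrite subr_gt0.
have t1 : 1 <= t by rewrite ler_pdivlMr// mul1r; lra.
pose a j := normc (1 - z0 * l j)^-1.
have ta j : normc (1 - z * l j)^-1 <= t * a j.
  rewrite /a !Normc.normcV -[leRHS]mul1r mulrA.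
  have N1 := normc_1B z j; have N0 := normc_1B z0 j.
  rewrite nz0 in N0; rewrite -/r in N1.
  rewrite mul1r ler_pdivlMr; last by apply: lt_le_trans N0; rewrite subr_gt0; lra.
  rewrite mulrC ler_pdivrMr; last by exact: lt_le_trans N1.
  have : normc (1 - z0 * l j) <= normc (1 - z * l j) + (r - s).
    rewrite -dz -[normc (z - z0)]mulr1 -(l1 j) -Normc.normcM.
    apply: le_trans (le_normcD _ _); rewrite le_eqVlt; apply/orP; left; apply/eqP.
    by congr normc; ring.
  move=> /le_trans; apply.
  have -> : t = 1 + (r - s) / (1 - r) by rewrite /t; field; rewrite gt_eqF.
  rewrite mulrDl mul1r lerD2l mulrAC ler_pdivlMr//.
  by rewrite ler_wpM2l// subr_ge0 ltW.
have GG : normc (wresolvent z - wresolvent z0) <=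
    (r - s) * t * \sum_j p j * a j ^+ 2.
  have -> : wresolvent z - wresolvent z0 =
      mean (fun j => (z - z0) * (l j * ((1 - z * l j)^-1 * (1 - z0 * l j)^-1))).
    rewrite /wresolvent -[- mean _]mulN1r -meanZ -meanD; apply: eq_bigr => j _.
    by congr (_ * _); field; rewrite !neq0.
  apply: (le_trans (normc_mean (g := fun j => (r - s) * t * a j ^+ 2) _)).
    move=> j; rewrite !Normc.normcM dz l1 mul1r.
    rewrite [leRHS](_ : _ = (r - s) * (t * a j * a j)); last by ring.
    have rs : 0 <= r - s by rewrite subr_ge0 ltW.
    by rewrite ler_wpM2l// ler_wpM2r ?normc_ge0.
  by rewrite mulr_sumr ler_sum// => j _; rewrite mulrCA.
have aa : (1 - s ^+ 2) * \sum_j p j * a j ^+ 2 <= 2 * normc (wresolvent z0).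
  apply: (@le_trans _ _ (2 * complex.Re (wresolvent z0) - 1)).
    rewrite mulr_sumr le_eqVlt; apply/orP; left; apply/eqP.
    have -> : complex.Re (wresolvent z0) = \sum_j p j * complex.Re (1 - z0 * l j)^-1.
      rewrite /wresolvent /mean (big_morph (@complex.Re R) (id1 := 0) (op1 := +%R))//.
        apply: eq_bigr => j _; case: (_^-1) => x y /=.
        by rewrite mul0r subr0.
      by move=> [? ?] [? ?].
    rewrite -[X in _ = _ - X]p_sum mulr_sumr -sumrB; apply: eq_bigr => j _.
    have nzl : normc (z0 * l j) = s by rewrite Normc.normcM l1 mulr1.
    by rewrite mulrCA /a -{1}nzl re_inv_1B ?neq0// mulrBr mulr1 mulrCA.
  have : complex.Re (wresolvent z0) <= normc (wresolvent z0).
    rewrite -lecR -normcE; apply: le_trans (normc_ge_Re _).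
    by rewrite lecR ler_norm.
  lra.
have g0 := normc_ge0 (wresolvent z0).
move: aa GG; set Q := \sum_j _ => aa GG.
have Q0 : 0 <= Q by apply: sumr_ge0 => j _; rewrite mulr_ge0// exprn_ge0// normc_ge0.
rewrite mulrDr mulr1.
have -> : wresolvent z = wresolvent z0 + (wresolvent z - wresolvent z0) by ring.
apply: (le_trans (le_normcD _ _)); rewrite lerD2l; apply: (le_trans GG).
have : (r - s) * Q <= 2 * normc (wresolvent z0).
  apply: le_trans aa; rewrite ler_wpM2r//; nra.
move=> H; rewrite [leLHS](_ : _ = (r - s) * Q * t); last by ring.
rewrite [leRHS](_ : _ = 2 * normc (wresolvent z0) * t); last by ring.
by rewrite ler_wpM2r//; lra.
Qed.

(** Let [G] be the resolvent, [r = |z|] and [q = (1 - h)^m]. On the circle of radius [1 - h],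
    [h |G| <= h + 2 b + q]. Moving outward multiplies this by at most [3 / (1 - r)], and removing
    the first two terms of the series adds [(h + b) / (1 - r)]. The total [4 h + 7 b + 3 q] is
    multiplied by [4] since [r^2 >= 1 / 4]. *)
Lemma wresolvent2_le z (b h : R) m : normc z < 1 -> 0 < h <= 1 / 2 ->
  (forall k, (1 <= k < m.+2)%N -> normc (wmoment k) <= b) ->
  normc (wresolvent2 z) <=
    normc z ^+ 2 / (1 - normc z) * (16 * h + 28 * b + 12 * (1 - h) ^+ m).
Proof.
move=> z1 /andP[h0 h1] cb; have z0 := normc_ge0 z.
have b0 : 0 <= b by apply: le_trans (cb 1%N _); rewrite ?normc_ge0.
have q0 : 0 <= (1 - h) ^+ m by rewrite exprn_ge0//; lra.
have pre0 : 0 <= normc z ^+ 2 / (1 - normc z).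
  by rewrite divr_ge0 ?exprn_ge0// subr_ge0 ltW.
have [zs|sz] := leP (normc z) (1 - h).
  apply: (le_trans (wresolvent2_le_inner z1 cb)); rewrite ler_wpM2l//.
  have : normc z ^+ m <= (1 - h) ^+ m by apply: lerXn2r; rewrite ?nnegrE//; lra.
  lra.
set r := normc z in z1 z0 sz pre0 *.
have s0 : 0 < 1 - h by lra.
have r0 : 0 < r by exact: lt_trans sz.
have := wresolvent_outer sz s0 z1; rewrite -/r.
set w := _%:C * z => Hout.
have nw : normc w = 1 - h.
  rewrite Normc.normcM normc_real ?mulfVK ?gt_eqF//.
  by rewrite divr_ge0// ltW.
have w1 : normc w < 1 by rewrite nw; lra.
have Hin := wresolvent2_le_inner w1 cb; rewrite nw in Hin.
set q := (1 - h) ^+ m in q0 Hin *.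
have c1 := cb 1%N isT.
have gw : normc (wresolvent w) * h <= h + 2 * b + q.
  have : normc (wresolvent w) <= 1 + b + (b + q) / h.
    rewrite wresolventE//; apply: (le_trans (le_normcD _ _)); apply: lerD.
      apply: (le_trans (le_normcD _ _)); rewrite Normc.normc1 lerD2l.
      rewrite Normc.normcM nw; apply: le_trans c1.
      by rewrite ler_piMl ?normc_ge0//; lra.
    apply: (le_trans Hin); rewrite subKr mulrAC.
    have ih : 0 <= h^-1 by rewrite invr_ge0 ltW.
    apply: ler_wpM2r => //; rewrite ler_piMl ?addr_ge0// exprn_ile1//; lra.
  move=> /(ler_wpM2r (ltW h0))/le_trans; apply.
  by rewrite mulrDl mulfVK ?gt_eqF//; nra.
have r1' : 0 < 1 - r by rewrite subr_gt0.
have Sz : normc (wresolvent2 z) <= normc (wresolvent z) + (1 + b).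
  have -> : wresolvent2 z = wresolvent z + - (1 + z * wmoment 1).
    by rewrite wresolventE//; ring.
  apply: (le_trans (le_normcD _ _)); rewrite lerD2l normcN.
  apply: (le_trans (le_normcD _ _)); rewrite Normc.normc1 lerD2l.
  rewrite Normc.normcM -/r; apply: le_trans c1.
  by rewrite ler_piMl ?normc_ge0// ltW.
rewrite mulrAC ler_pdivlMr//.
apply: (@le_trans _ _ (4 * h + 7 * b + 3 * q)); last first.
  have : 1 / 4 <= r ^+ 2 by nra.
  move=> H; apply: (@le_trans _ _ (1 / 4 * (16 * h + 28 * b + 12 * q))); first by lra.
  by rewrite ler_wpM2r//; lra.
have g0 := normc_ge0 (wresolvent w).
have {}Hout : normc (wresolvent z) * (1 - r) <= normc (wresolvent w) * (3 * h).
  have := ler_wpM2r (ltW r1') Hout; rewrite subKr => /le_trans; apply.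
  rewrite -mulrA ler_wpM2l// mulrDl mul1r -!mulrA mulVf ?gt_eqF// mulr1; lra.
have := ler_wpM2r (ltW r1') Sz; rewrite mulrDl => /le_trans; apply.
have : (1 + b) * (1 - r) <= (1 + b) * h by rewrite ler_wpM2l//; lra.
have : b * h <= b * 1 by rewrite ler_wpM2l//; lra.
lra.
Qed.

End weighted_resolvent.

Section spectral_sums.
Context {C : numClosedFieldType} {n : nat}.

Lemma unitary_amp_conj (U : 'M[C]_n) (v : 'cV[C]_n) k :
  (v ^t* *m (U ^t*) ^+ k *m v) 0 0 = ((v ^t* *m U ^+ k *m v) 0 0)^*%R.
Proof.
have -> : (U ^t*) ^+ k = (U ^+ k) ^t*.
  elim: k => [|k IHk]; first by rewrite !expr0 trmx1 map_mx1.
  have comm : U ^+ k *m U = U *m U ^+ k.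
    by rewrite -exprmxS; exact: esym (exprSr U k).
  by rewrite !exprmxS IHk -trmxC_mulmx comm.
have -> : v ^t* *m (U ^+ k) ^t* *m v = (v ^t* *m U ^+ k *m v) ^t*.
  by rewrite !trmxC_mulmx trmxCK mulmxA.
by rewrite !mxE.
Qed.

(** The adjoint, which is the matrix occurring in [W2], is normal and hence unitarily
    diagonalizable; [w] collects the coordinates of [v] in an eigenbasis. Membership in [unitmx] is
    recorded because only then is [invmx] the inverse. *)
Lemma unitary_spectral_sums (U : 'M[C]_n) (v : 'cV[C]_n) :
  U \is unitarymx -> v ^t* *m v = 1%:M ->
  exists w l : 'I_n -> C,
    [/\ \sum_j `|w j| ^+ 2 = 1, forall j, `|l j| = 1,
        forall k, (v ^t* *m (U ^t*) ^+ k *m v) 0 0 = \sum_j `|w j| ^+ 2 * l j ^+ k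
      & forall z, (forall j, 1 - z * l j != 0) ->
        1%:M - z *: U ^t* \in unitmx /\
        (v ^t* *m ((z *: U ^t*) ^+ 2 *m invmx (1%:M - z *: U ^t*)) *m v) 0 0 =
        \sum_j `|w j| ^+ 2 * ((z * l j) ^+ 2 / (1 - z * l j))].
Proof.
move=> Uu vv; have UU : U *m U ^t* = 1%:M by exact/unitarymxP.
have U'U : U ^t* *m U = 1%:M by exact: mulmx1C.
have /orthomx_spectralP : U ^t* \is normalmx.
  by apply/normalmxP; rewrite trmxCK UU U'U.
set S := spectralmx _; set sp := spectral_diag _.
have Su : S \is unitarymx by exact: spectral_unitarymx.
rewrite invmx_unitary// => UE.
have SS : S *m S ^t* = 1%:M by exact/unitarymxP.
have S'S : S ^t* *m S = 1%:M by exact: mulmx1C.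
pose l j := sp 0 j; have [w wE] : exists w, w = S *m v by exists (S *m v).
have DE : diag_mx sp = S *m U ^t* *m S ^t*.
  by rewrite UE !mulmxA SS mul1mx -mulmxA SS mulmx1.
have DD : diag_mx sp *m (diag_mx sp) ^t* = 1%:M.
  apply/unitarymxP; rewrite DE; apply: mul_unitarymx; last by rewrite trmxC_unitary.
  by apply: mul_unitarymx => //; rewrite trmxC_unitary.
have l1 j : `|l j| = 1.
  have := congr1 (fun M : 'M[C]_n => M j j) DD.
  rewrite mul_diag_mx !mxE eqxx !mulr1n -normCK => /eqP.
  by rewrite sqrp_eq1// => /eqP.
have quad (f : 'rV[C]_n) : (v ^t* *m (S ^t* *m diag_mx f *m S) *m v) 0 0 =
    \sum_j `|w j 0| ^+ 2 * f 0 j.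
  rewrite !mulmxA -(mulmxA _ S) -wE -trmxC_mulmx -wE -mulmxA mul_diag_mx mxE.
  by apply: eq_bigr => j _; rewrite !mxE normCKC mulrCA mulrC.
have powE k : (U ^t*) ^+ k = S ^t* *m diag_mx (\row_j (l j ^+ k)) *m S.
  elim: k => [|k IHk].
    rewrite expr0 (_ : diag_mx _ = 1%:M) ?mulmx1 ?S'S//.
    by apply/matrixP => i j; rewrite !mxE expr0.
  rewrite exprmxS IHk UE !mulmxA -(mulmxA _ S) SS mulmx1; congr (_ *m _).
  rewrite -mulmxA mulmx_diag; congr (_ *m diag_mx _).
  by apply/rowP => j; rewrite !mxE exprS.
exists (fun j => w j 0), l; split=> //.
- have := quad (const_mx 1); rewrite diag_const_mx mulmx1 S'S mulmx1 vv mxE eqxx mulr1n => H; rewrite [RHS]H.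
  by apply: eq_bigr => j _; rewrite mxE mulr1.
- by move=> k; rewrite powE quad; apply: eq_bigr => j _; rewrite mxE.
move=> z n0.
have zE : z *: U ^t* = S ^t* *m diag_mx (\row_j (z * l j)) *m S.
  rewrite UE scalemxAl scalemxAr; congr (_ *m _ *m _).
  by apply/matrixP => i j; rewrite !mxE mulrnAr.
have [Au invE] : 1%:M - z *: U ^t* \in unitmx /\ invmx (1%:M - z *: U ^t*) =
    S ^t* *m diag_mx (\row_j (1 - z * l j)^-1) *m S.
  set A := 1%:M - _; set B := S ^t* *m _ *m S.
  have AE : A = S ^t* *m diag_mx (\row_j (1 - z * l j)) *m S.
    rewrite /A zE -{1}S'S -[S ^t* in X in X - _]mulmx1 -mulmxBl -mulmxBr.
    congr (_ *m _ *m _); apply/matrixP => i j; rewrite !mxE.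
    by case: eqVneq => [->|_]; rewrite ?mulr1n ?mulr0n ?subr0.
  have AB : A *m B = 1%:M.
    rewrite AE /B !mulmxA -(mulmxA _ S) SS mulmx1 -(mulmxA (S ^t*)) mulmx_diag.
    rewrite (_ : diag_mx _ = 1%:M) ?mulmx1//.
    by apply/matrixP => i j; rewrite !mxE; case: eqVneq => [->|_]; rewrite ?mulr0n// divff.
  have [Au _] := mulmx1_unit AB.
  by split=> //; rewrite -[RHS](mulKmx Au) AB mulmx1.
split=> //; have -> : (z *: U ^t*) ^+ 2 *m invmx (1%:M - z *: U ^t*) = S ^t* *m
   diag_mx (\row_j ((z * l j) ^+ 2 / (1 - z * l j))) *m S.
  rewrite invE exprmxS expr1 zE.
  rewrite !mulmxA -(mulmxA _ S) SS mulmx1 -(mulmxA _ S) SS mulmx1; congr (_ *m _).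
  rewrite -(mulmxA (S ^t*)) mulmx_diag -(mulmxA (S ^t*)) mulmx_diag.
  by congr (_ *m diag_mx _); apply/rowP => j; rewrite !mxE -expr2.
by rewrite quad; apply: eq_bigr => j _; rewrite mxE.
Qed.

End spectral_sums.

Section spectral_representation.
Context {R : realType} {n : nat}.
Local Notation C := R[i].
Local Notation normc := (@Normc.normc R).

Lemma normc_conj (z : C) : normc z^*%R = normc z.
Proof. by apply: (@complexI R); rewrite -!normcE norm_conjC. Qed.

Lemma unitary_spectral_rep (U : 'M[C]_n) (v : 'cV[C]_n) :
  U \is unitarymx -> v ^t* *m v = 1%:M ->
  exists (p : 'I_n -> R) (l : 'I_n -> C),
    [/\ forall j, 0 <= p j, \sum_j p j = 1, forall j, normc (l j) = 1,
        forall k, (v ^t* *m (U ^t*) ^+ k *m v) 0 0 = wmoment p l k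
      & forall z, normc z < 1 ->
          1%:M - z *: U ^t* \in unitmx /\ W2 U v z = wresolvent2 p l z].
Proof.
move=> Uu vv; have [w [l [w1 l1 mE rE]]] := unitary_spectral_sums Uu vv.
have l1' j : normc (l j) = 1 by apply: (@complexI R); rewrite -normcE l1.
exists (fun j => nsq (w j)), l; split=> //.
- by move=> j; exact: nsq_ge0.
- apply: (@complexI R); rewrite rmorph_sum rmorph1/= -w1.
  by apply: eq_bigr => j _; rewrite nsqE.
- by move=> k; rewrite mE; apply: eq_bigr => j _; rewrite nsqE.
move=> z z1; rewrite /W2/=.
have [|Au ->] := rE z.
  move=> j; apply/eqP => E; have := normc_1B l1' z j; rewrite E Normc.normc0.
  by rewrite subr_le0 leNgt z1.
by split=> //; apply: eq_bigr => j _; rewrite nsqE.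
Qed.

Lemma W2_bounded_of_moments (U : 'M[C]_n) (v : 'cV[C]_n) (b h : R) m z :
  U \is unitarymx -> v ^t* *m v = 1%:M -> 0 < h <= 1 / 2 ->
  (forall k, (1 <= k < m.+2)%N -> normc ((v ^t* *m U ^+ k *m v) 0 0) <= b) ->
  normc z < 1 ->
  normc (W2 U v z) <=
    normc z ^+ 2 / (1 - normc z) * (16 * h + 28 * b + 12 * (1 - h) ^+ m).
Proof.
move=> Uu vv hh cb z1.
have [p [l [p0 p1 l1 cE /(_ z z1)[_ ->]]]] := unitary_spectral_rep Uu vv.
apply: wresolvent2_le => // k km.
by rewrite -cE unitary_amp_conj normc_conj cb.
Qed.

End spectral_representation.

(** * The event of the domination *)

Section measurable_W2.
Context {R : realType} d (T : measurableType d).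
Local Notation normc := (@Normc.normc R).

Lemma measurable_complexV (f : T -> R[i]) : measurable_fun setT f ->
  measurable_fun setT (fun t => (f t)^-1).
Proof.
move=> mf.
have mV : measurable_fun setT (fun t => (nsq (f t))^-1).
  have := measurableT_comp (@measurable_powR R (-1)) (measurable_nsq mf).
  by apply: eq_measurable_fun => t _; rewrite /= powR_inv1// nsq_ge0.
apply: eq_measurable_fun
  (measurable_complexM (measurable_realC mV) (measurable_conjC mf)) => t _.
rewrite invC_norm -nsqE; congr (_ * _).
by rewrite fmorphV.
Qed.

(** [invmx] is defined by cases. For [normc z < 1] the matrix is invertible at every point, and its
    inverse is the adjugate divided by the determinant. *)
Lemma measurable_W2 n (U : T -> 'M[R[i]]_n) (v : T -> 'cV[R[i]]_n) z :
  measurable_fun setT U -> measurable_fun setT v ->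
  (forall t, U t \is unitarymx) -> (forall t, (v t) ^t* *m v t = 1%:M) ->
  normc z < 1 -> measurable_fun setT (fun t => W2 (U t) (v t) z).
Proof.
move=> mU mv Uu vv z1.
have mA : measurable_fun setT (fun t => z *: (U t) ^t*).
  by apply: measurable_scalemx => //; exact: measurable_trmxC.
have m1A : measurable_fun setT (fun t => 1%:M - z *: (U t) ^t*).
  by apply: measurable_addmx => //; exact: measurable_oppmx.
have minv : measurable_fun setT (fun t => invmx (1%:M - z *: (U t) ^t*)).
  apply: eq_measurable_fun (measurable_scalemx
    (measurable_complexV (measurable_det m1A)) (measurable_adjmx m1A)) => t _.
  have [p [l [_ _ _ _ /(_ z z1)[Au _]]]] := unitary_spectral_rep (Uu t) (vv t).
  by rewrite /invmx Au.
have /measurable_mxP : measurable_fun setT (fun t =>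
    (v t) ^t* *m ((z *: (U t) ^t*) ^+ 2 *m invmx (1%:M - z *: (U t) ^t*)) *m v t).
  apply: measurable_mulmx => //; apply: measurable_mulmx; first exact: measurable_trmxC.
  by apply: measurable_mulmx => //; exact: measurable_exprmx.
exact.
Qed.

End measurable_W2.

Section rational_points.
Context {R : realType}.
Local Notation C := R[i].
Local Notation normc := (@Normc.normc R).

Lemma normc_dist (z w : C) : `|normc z - normc w| <= normc (z - w).
Proof.
rewrite ler_norml lerBlDr lerNl opprB lerBlDr.
have := le_normcD (z - w) w; rewrite subrK => ->.
by have := le_normcD (w - z) z; rewrite subrK -opprB normcN => ->.
Qed.

Lemma normc_le_ReIm (z : C) : normc z <= `|complex.Re z| + `|complex.Im z|.
Proof.
have -> : z = (complex.Re z)%:C + (0 +i* complex.Im z).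
  by case: z => a b; apply/eqP; rewrite eq_complex/= addr0 add0r !eqxx.
apply: (le_trans (le_normcD _ _)).
by rewrite /= !expr0n /= !addr0 !add0r !sqrtr_sqr lerD.
Qed.

Lemma rational_near (z : C) (e : R) : 0 < e ->
  exists a b : rat, normc (z - (ratr a +i* ratr b)) < e.
Proof.
case: z => x y e0.
have [a /itvP Ha] := @rat_in_itvoo R (x - e / 2) x ltac:(lra).
have [b /itvP Hb] := @rat_in_itvoo R (y - e / 2) y ltac:(lra).
have a1 : x - e / 2 < ratr a by rewrite Ha.
have a2 : ratr a < x by rewrite Ha.
have b1 : y - e / 2 < ratr b by rewrite Hb.
have b2 : ratr b < y by rewrite Hb.
exists a, b; apply: le_lt_trans; first exact: normc_le_ReIm.
by rewrite /= !ger0_norm; lra.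
Qed.

(** As [x^2 / (1 - x) = 1 / (1 - x) - 1 - x], the difference factors through [x - y]. *)
Lemma sq_div_1B_dist (x y : C) (rho : R) : normc x <= rho -> normc y <= rho -> rho < 1 ->
  normc (x ^+ 2 / (1 - x) - y ^+ 2 / (1 - y)) <= ((1 - rho) ^- 2 + 1) * normc (x - y).
Proof.
move=> xr yr r1.
have r1' : 0 < 1 - rho by rewrite subr_gt0.
have low w : normc w <= rho -> 1 - rho <= normc (1 - w).
  move=> wr; have := le_normcD (1 - w) w; rewrite subrK Normc.normc1; lra.
have nz w : normc w <= rho -> 1 - w != 0.
  move=> /low wr; apply/eqP => E; move: wr; rewrite E Normc.normc0; lra.
have -> : x ^+ 2 / (1 - x) - y ^+ 2 / (1 - y) =
    ((1 - x)^-1 * (1 - y)^-1 - 1) * (x - y).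
  by field; rewrite !nz.
rewrite Normc.normcM ler_wpM2r ?normc_ge0//.
apply: (le_trans (le_normcD _ _)); rewrite normcN Normc.normc1 lerD2r.
rewrite Normc.normcM !Normc.normcV expr2 invfM.
by rewrite ler_pM ?invr_ge0 ?normc_ge0// lef_pV2 ?posrE ?low//;
  apply: lt_le_trans (low _ _).
Qed.

(** The event of the domination quantifies over uncountably many [z]. Both sides are Lipschitz on
    disks of radius [s < 1], so countably many points decide it, which gives measurability. *)
Lemma W2_le_of_rational n (U : 'M[C]_n) (v : 'cV[C]_n) (rho M : R) :
  U \is unitarymx -> v ^t* *m v = 1%:M -> rho <= 1 -> 0 <= M ->
  (forall a b : rat, let q := ratr a +i* ratr b : C in normc q < rho ->
     normc (W2 U v q) <= M * (normc q ^+ 2 / (1 - normc q))) ->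
  forall z, normc z < rho -> normc (W2 U v z) <= M * (normc z ^+ 2 / (1 - normc z)).
Proof.
move=> Uu vv rho1 M0 H z zr.
have [p [l [p0 p1 l1 _ WE]]] := unitary_spectral_rep Uu vv.
set s := (normc z + rho) / 2.
have zs : normc z < s by rewrite /s; lra.
have sr : s < rho by rewrite /s; lra.
have s1 : s < 1 by lra.
set L := (1 - s) ^- 2 + 1.
have L0 : 0 < L by rewrite ltr_wpDl// invr_ge0 exprn_ge0//; lra.
have z1 : normc z < 1 by lra.
apply/ler_addgt0Pr => e e0.
(* [e'] keeps [q] within radius [s] and limits the total error to [e]: the constant is [L] for [W2]
   and [M * L] for the right-hand side. *)
pose e' := Num.min (s - normc z) (e / ((1 + M) * L)).
have LM0 : 0 < (1 + M) * L by rewrite mulr_gt0// ltr_wpDr.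
have e'0 : 0 < e' by rewrite lt_min divr_gt0// andbT subr_gt0.
have [a [b ab]] := rational_near z e'0.
set q : C := ratr a +i* ratr b in ab.
have qz := normc_dist z q.
have qs : normc q < s.
  have : e' <= s - normc z by rewrite ge_min lexx.
  move: qz; rewrite ler_norml => /andP[]; lra.
have q1 : normc q < 1 by lra.
have Wd : normc (W2 U v z - W2 U v q) <= L * normc (z - q).
  rewrite (WE z z1).2 (WE q q1).2 /wresolvent2 -sumrB.
  apply: (le_trans (normc_sum _ _ _)).
  rewrite -[leRHS]mul1r -p1 mulr_suml; apply: ler_sum => j _.
  rewrite -mulrBr Normc.normcM normc_real// ler_wpM2l//.
  rewrite (_ : normc (z - q) = normc (z * l j - q * l j)); last first.
    by rewrite -mulrBl [RHS]Normc.normcM l1 mulr1.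
  by apply: sq_div_1B_dist; rewrite ?Normc.normcM ?l1 ?mulr1 ?ltW.
have nr (w : R) : 0 <= w -> w%:C ^+ 2 / (1 - w%:C) = (w ^+ 2 / (1 - w))%:C :> C.
  by move=> _; rewrite -rmorphXn -[1 in LHS](rmorph1 (real_complex R)) -rmorphB -fmorphV -rmorphM.
have phid : normc q ^+ 2 / (1 - normc q) <= normc z ^+ 2 / (1 - normc z) + L * normc (z - q).
  (* The bound is the same function [x^2 / (1 - x)] at a real point, hence has the same Lipschitz
     constant. *)
  have := @sq_div_1B_dist (normc q)%:C (normc z)%:C s.
  rewrite !normc_real ?normc_ge0// => /(_ (ltW qs) (ltW zs) s1).
  rewrite !nr ?normc_ge0// -rmorphB -rmorphB -/L => Hd.
  have h1 : normc ((normc q - normc z)%:C : C) <= normc (z - q).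
    by rewrite /= expr0n addr0 sqrtr_sqr distrC.
  have h2 (x : R) : x <= normc (x%:C : C).
    by rewrite /= expr0n addr0 sqrtr_sqr ler_norm.
  have := h2 (normc q ^+ 2 / (1 - normc q) - normc z ^+ 2 / (1 - normc z)).
  move=> /le_trans/(_ Hd).
  have : L * normc ((normc q - normc z)%:C : C) <= L * normc (z - q).
    by rewrite ler_wpM2l// ltW.
  lra.
have Hq := H a b (lt_trans qs sr); rewrite -/q /= in Hq.
rewrite -(subrK (W2 U v q) (W2 U v z)); apply: (le_trans (le_normcD _ _)).
have le1 : M * (normc q ^+ 2 / (1 - normc q)) <=
    M * (normc z ^+ 2 / (1 - normc z) + L * normc (z - q)) by rewrite ler_wpM2l.
have le2 : (1 + M) * L * normc (z - q) <= e.
  rewrite mulrC -ler_pdivlMr//; apply: (le_trans (ltW ab)).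
  by rewrite ge_min lexx orbT.
apply: (le_trans (lerD Wd (le_trans Hq le1))); apply: (le_trans _ (lerD (lexx _) le2)).
by rewrite le_eqVlt; apply/orP; left; apply/eqP; ring.
Qed.

End rational_points.

Section measurable_event.
Context {R : realType} d (T : measurableType d).
Local Notation normc := (@Normc.normc R).

Lemma measurable_W2_event n (U : T -> 'M[R[i]]_n) (v : T -> 'cV[R[i]]_n) (rho M : R) :
  measurable_fun setT U -> measurable_fun setT v ->
  (forall t, U t \is unitarymx) -> (forall t, (v t) ^t* *m v t = 1%:M) ->
  rho <= 1 -> 0 <= M ->
  measurable [set t | forall z, normc z < rho ->
     normc (W2 (U t) (v t) z) <= M * (normc z ^+ 2 / (1 - normc z))].
Proof.
move=> mU mv Uu vv rho1 M0.
pose q (a b : rat) : R[i] := ratr a +i* ratr b.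
rewrite (_ : [set t | _] = ~` (\bigcup_a \bigcup_b [set t | normc (q a b) < rho /\
    M * (normc (q a b) ^+ 2 / (1 - normc (q a b))) < normc (W2 (U t) (v t) (q a b))])).
  apply: measurableC; apply: bigcupT_measurable_rat => a.
  apply: bigcupT_measurable_rat => b.
  have [lt|ge] := ltP (normc (q a b)) rho; last first.
    rewrite (_ : [set t | _] = set0)//.
    by apply/seteqP; split => // t [].
  rewrite (_ : [set t | _] = [set t | M * (normc (q a b) ^+ 2 / (1 - normc (q a b))) <
    normc (W2 (U t) (v t) (q a b))]); last by apply/seteqP; split => t //= [].
  apply: measurable_normc_gt; apply: measurable_W2 => //.
  exact: lt_le_trans rho1.
apply/seteqP; split => t /= H.
  by move=> [a _ [b _ [ab]]]; rewrite ltNge H.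
apply: W2_le_of_rational => // a b /= ab.
by rewrite leNgt; apply/negP => lt; apply: H; exists a => //; exists b.
Qed.

End measurable_event.

(** * Independence of the matrix and the vector *)

Section independent_pair.
Context {R : realType} d d1 d2 (T : measurableType d) (E1 : measurableType d1)
  (E2 : measurableType d2) (P : probability T R).
Local Open Scope ereal_scope.

Lemma independent_prob (U : {RV P >-> E1}) (v : {RV P >-> E2})
    (B : set (E2 * E1)) (c : \bar R) : independent_RV P U v -> measurable B ->
  (forall t, P [set s | B (v t, U s)] = c) -> P [set t | B (v t, U t)] = c.
Proof.
move=> UV mB Bc.
have mp : measurable_fun setT (fun t => (v t, U t)) by exact: measurable_fun_pair.
pose p : {mfun T >-> (E2 * E1)%type} := HB.pack (fun t => (v t, U t))
  (isMeasurableFun.Build _ _ _ _ (fun t => (v t, U t)) mp).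
have H := @product_measure_unique _ _ _ _ _ (distribution P v) (distribution P U)
  (distribution P p).
transitivity (distribution P p B) => //.
rewrite -H//; last first.
  move=> A B' mA mB'; rewrite muleC.
  transitivity (P (U @^-1` B' `&` v @^-1` A)); last exact: UV.
  by congr (P _); apply/seteqP; split => t [].
transitivity (\int[P]_t distribution P U (xsection B (v t))).
  apply: (@ge0_integral_distribution _ _ _ _ _ P v (distribution P U \o xsection B)) => //.
  exact: measurable_fun_xsection.
rewrite -[RHS](integral_prob_cst P c); apply: eq_integral => t _.
rewrite -(Bc t) xsectionE; congr (P _).
Qed.

End independent_pair.

(** * Choice of the parameters *)

Section parameters.
Context {R : realType}.

Lemma pow_onem_le (h : R) m : 0 <= h <= 1 -> (1 - h) ^+ m <= expR (- (h * m%:R)).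
Proof.
move=> /andP[h0 h1]; rewrite mulrC -mulrN mulrC -[X in expR X]mulrC expRM_natl.
by apply: lerXn2r; rewrite ?nnegrE ?expR_ge0 ?subr_ge0// expR_ge1Dx.
Qed.

(** [s] stands for sqrt N and [x] for a small power of N. Entries have size [x / s]; [K], about
    [s / (4 x^2)], keeps [4 K x / s] below one, and [h = x^4 / s] still makes [h K] about [x^2 / 4],
    which is large. *)
Lemma scale_bounds (x s : R) (K := Num.truncn (s / (4 * x ^+ 2))) :
  140 <= x -> x ^+ 8 <= s ->
  [/\ 16 * K%:R ^+ 2 * (x / s) ^+ 2 <= 1, (0 < K)%N, 4 * K%:R <= s,
      0 < x ^+ 4 / s <= 1 / 2 & x ^+ 2 / 4 - 1 <= x ^+ 4 / s * K.-1%:R].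
Proof.
move=> x140 x8.
have x0 : 0 < x by lra.
have xx : 1 <= x ^+ 2 by rewrite exprn_ege1//; lra.
have xxx : 140 * x <= x ^+ 2 by rewrite expr2 ler_wpM2r// ltW.
have x4 : 560 * x ^+ 2 <= x ^+ 4.
  rewrite (_ : x ^+ 4 = x ^+ 2 * x ^+ 2); last by ring.
  by rewrite ler_wpM2r//; lra.
have x4s : 4 * x ^+ 4 <= s.
  apply: le_trans x8; rewrite (_ : x ^+ 8 = x ^+ 4 * x ^+ 4); last by ring.
  by rewrite ler_wpM2r//; lra.
have s0 : 0 < s by lra.
have d0 : 0 < 4 * x ^+ 2 by lra.
pose u := s / (4 * x ^+ 2).
have u2 : 2 <= u by rewrite ler_pdivlMr//; lra.
have u0 : 0 <= u by lra.
have Ku : K%:R <= u by rewrite truncn_le.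
have uK : u < K.+1%:R by exact: truncnS_gt.
have K0 : (0 < K)%N by rewrite truncn_gt0 -/u; lra.
have us : u * (4 * x ^+ 2) = s by rewrite mulfVK// gt_eqF.
have uN : 4 * u <= s.
  rewrite -us mulrC ler_wpM2l//; lra.
have h0 : 0 < x ^+ 4 / s by rewrite divr_gt0//; lra.
have h2 : x ^+ 4 / s <= 1 / 2 by rewrite ler_pdivrMr//; lra.
split=> //; last 2 first.
- by rewrite h0.
- have hK : x ^+ 4 / s * u = x ^+ 2 / 4.
    by rewrite /u; field; rewrite !gt_eqF.
  rewrite -hK.
  (* Truncation costs one unit and the predecessor another; as [h <= 1 / 2], the product with [h]
     loses at most [1]. *)
  have KE : K.+1%:R = K.-1%:R + 2 :> R by rewrite -[in LHS](prednK K0) -!natr1; ring.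
  rewrite KE in uK.
  have := ler_wpM2l (ltW h0) (ltW uK); lra.
- have Kx : 4 * K%:R * (x / s) <= 1.
    rewrite mulrA ler_pdivrMr// mul1r -[leRHS]us.
    have : K%:R * (4 * x) <= u * (4 * x) by rewrite ler_wpM2r//; lra.
    have : u * (4 * x) <= u * (4 * x ^+ 2) by rewrite ler_wpM2l//; lra.
    lra.
  have -> : 16 * K%:R ^+ 2 * (x / s) ^+ 2 = (4 * K%:R * (x / s)) ^+ 2 by ring.
  have xs0 : 0 <= x / s by rewrite divr_ge0 ?(ltW x0) ?(ltW s0).
  by rewrite exprn_ile1// mulr_ge0// mulr_ge0.
- lra.
Qed.

(** Every term is at most its coefficient times [x^4 / s], and [140 = 16 + 112 + 12]. *)
Lemma scale_sum_bound (x s D : R) : 140 <= x -> 0 < s -> D <= s^-1 ->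
  16 * (x ^+ 4 / s) + 28 * (4 * (x / s)) + 12 * D <= x ^+ 5 / s.
Proof.
move=> x140 s0 Ds.
have x1 : 1 <= x by lra.
have x4 : 1 <= x ^+ 4 by rewrite exprn_ege1.
have xx4 : x <= x ^+ 4 by rewrite -{1}[x]expr1 ler_weXn2l.
have x5 : 140 * x ^+ 4 <= x ^+ 5 by rewrite (exprS x 4) ler_wpM2r//; lra.
apply: (@le_trans _ _ ((16 * x ^+ 4 + 112 * x + 12) * s^-1)).
  have -> : 16 * (x ^+ 4 / s) + 28 * (4 * (x / s)) + 12 * D =
    16 * x ^+ 4 * s^-1 + 112 * x * s^-1 + 12 * D by ring.
  rewrite [leRHS]mulrDl; apply: lerD; last exact: ler_wpM2l.
  by rewrite -mulrDl.
rewrite ler_wpM2r ?invr_ge0 ?(ltW s0)//; lra.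
Qed.

(** With [N = s^2] and [x] its power [al], [ln N <= x / al]; so the exponent [h m], of order [x^2],
    exceeds [ln N / 2] once [x >= 4 + 2 / al]. *)
Lemma scale_decay (x s al h : R) m : 0 < al -> 1 <= s ->
  x = (s ^+ 2) `^ al -> 4 + 2 / al <= x -> 0 <= h <= 1 ->
  x ^+ 2 / 4 - 1 <= h * m%:R -> (1 - h) ^+ m <= s^-1.
Proof.
move=> al0 s1 xE xal h01 hm.
have s0 : 0 < s by lra.
have N0 : 0 < s ^+ 2 by rewrite exprn_gt0.
apply: (le_trans (pow_onem_le m h01)).
have -> : s^-1 = expR (- (ln (s ^+ 2) / 2)).
  have -> : ln (s ^+ 2) / 2 = ln s by rewrite lnXn//; field.
  by rewrite expRN lnK.
rewrite ler_expR lerN2; apply: le_trans hm.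
have ia : 0 < 2 / al by rewrite divr_gt0.
have x0 : 0 < x by lra.
have lnx : ln (s ^+ 2) <= x / al.
  by rewrite ler_pdivlMr// mulrC -ln_powR -xE ltW// ln_sublinear.
have x1 : x * (2 / al) <= x * (x - 4) by rewrite ler_wpM2l//; lra.
rewrite (_ : x * (2 / al) = 2 * (x / al)) in x1; last by ring.
move: (x / al) (ln (s ^+ 2)) lnx x1 => w l lw.
have x4 : 4 <= x by lra.
nra.
Qed.

(** [al <= eps / 5] gives [x^5 <= N^eps], [al <= 1 / 16] gives [x^8 <= sqrt N], and [al p >= A + 1]
    gives [x^p >= N^(A + 1)], one power of N being spent on the union bound. *)
Lemma large_parameters (eps A : R) : 0 < eps -> 0 < A ->
  exists X0 : R, forall n : nat, X0 <= n.+1%:R ->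
  exists (K p : nat) (g h q : R),
  [/\ 0 < g, 16 * K%:R ^+ 2 * g ^+ 2 <= 1, (0 < K <= n)%N, 0 < h <= 1 / 2 &
   [/\ 16 * h + 28 * (4 * g) + 12 * (1 - h) ^+ K.-1 <=
      n.+1%:R `^ eps / Num.sqrt n.+1%:R,
    0 <= q, K%:R * q < n.+1%:R `^ (- A) &
    forall m, (n - K <= m <= n)%N -> p`!%:R / (m.+1%:R * g ^+ 2) ^+ p <= q]].
Proof.
move=> eps0 A0.
pose al := Num.min (eps / 5) (1 / 16).
have al0 : 0 < al by rewrite lt_min; apply/andP; split; lra.
have al5 : al * 5 <= eps.
  have : al <= eps / 5 by rewrite ge_min lexx.
  lra.
have al16 : al * 8 <= 2^-1.
  have : al <= 1 / 16 by rewrite ge_min lexx orbT.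
  lra.
move: al al0 al5 al16 => al al0 al5 al16.
pose p := (Num.truncn ((A + 1) / al)).+1.
have pA : A + 1 <= al * p%:R.
  rewrite mulrC -ler_pdivrMr//; apply: ltW; rewrite /p.
  exact: truncnS_gt.
have [Y YE] : exists Y : R, Y = 140 + 2 / al + 2 * p`!%:R by eexists.
have pf0 : 1 <= p`!%:R :> R by rewrite ler1n fact_gt0.
have ial0 : 0 < 2 / al by rewrite divr_gt0.
have Y0 : 0 <= Y by lra.
exists (Y `^ al^-1) => n.
have N1 : 1 <= n.+1%:R :> R by rewrite ler1n.
have [N NE] : exists N : R, N = n.+1%:R by eexists.
rewrite -NE in N1 *; move=> nX0.
have N0 : 0 < N by lra.
have N0' := ltW N0.
(* The definition of [Y] ensures three lower bounds for [x]: [140] and [4 + 2 / al] for the scale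
   estimates, and twice the factorial of the moment bound. *)
have [x xE] : exists x : R, x = N `^ al by eexists.
have [s sE] : exists s : R, s = Num.sqrt N by eexists.
have xY : Y <= x.
  have -> : Y = (Y `^ al^-1) `^ al by rewrite -powRrM mulVf ?gt_eqF// powRr1.
  by rewrite xE; apply: ge0_ler_powR; rewrite ?nnegrE ?powR_ge0// ltW.
have x140 : 140 <= x by lra.
have x0 : 0 < x by lra.
have ss : s ^+ 2 = N by rewrite sE sqr_sqrtr.
have s0 : 0 < s by rewrite sE sqrtr_gt0.
have s1 : 1 <= s by rewrite sE -[leLHS]sqrtr1 ler_wsqrtr.
have x8 : x ^+ 8 <= s.
  rewrite xE sE -powR_mulrn ?powR_ge0// -powRrM -powR12_sqrt//.
  exact: ler_powR.
have xp : x ^+ p = N `^ (al * p%:R) by rewrite powRrM xE powR_mulrn ?powR_ge0.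
have x5 : x ^+ 5 <= N `^ eps.
  by rewrite xE -powR_mulrn ?powR_ge0// -powRrM; exact: ler_powR.
have xx0 : 0 < x ^+ 2 / 2 by rewrite divr_gt0// exprn_gt0.
have [H1 K0 H3 H4 H5] := scale_bounds x140 x8.
move: (Num.truncn _) H1 K0 H3 H4 H5 => K H1 K0 H3 H4 H5.
have sN : s <= N by rewrite -ss expr2 ler_peMr// ltW.
have KN : K%:R < N.
  have : 1 <= K%:R :> R by rewrite ler1n.
  lra.
have Kn : (K <= n)%N by move: KN; rewrite NE ltr_nat ltnS.
have q0 : 0 <= p`!%:R / (x ^+ 2 / 2) ^+ p by rewrite divr_ge0// exprn_ge0// ltW.
exists K, p, (x / s), (x ^+ 4 / s), (p`!%:R / (x ^+ 2 / 2) ^+ p).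
split=> //; [by rewrite divr_gt0|by rewrite K0|].
have [h0 h2] := andP H4.
split=> //.
- rewrite -sE; apply: (@le_trans _ _ (x ^+ 5 / s)).
    apply: scale_sum_bound => //; apply: (scale_decay al0 s1 _ _ _ H5).
    + by rewrite ss.
    + lra.
    + by rewrite ltW//=; lra.
  by rewrite ler_wpM2r// invr_ge0 ltW.
- apply: (@le_lt_trans _ _ (N * (p`!%:R / (x ^+ 2 / 2) ^+ p))).
    by rewrite ler_wpM2r// ltW.
  have NA0 : 0 < N * N `^ A by rewrite mulr_gt0// powR_gt0.
  have NA : N * N `^ A <= x ^+ p.
    rewrite -{1}(powRr1 N0') -powRD; last by rewrite (gt_eqF N0) implybT.
    by rewrite xp ler_powR//; lra.
  have xh : p`!%:R < x / 2 by lra.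
  have xp2 : p`!%:R < (x / 2) ^+ p.
    apply: (lt_le_trans xh); rewrite -[leLHS]expr1.
    by apply: ler_weXn2l => //; lra.
  rewrite powRN mulrA ltr_pdivrMr ?exprn_gt0//.
  rewrite [ltRHS]mulrC ltr_pdivlMr ?powR_gt0//.
  (* The factor [x ^+ p] pays for [N^(A + 1)], the factor [(x / 2) ^+ p] for the factorial. *)
  have -> : (x ^+ 2 / 2) ^+ p = x ^+ p * (x / 2) ^+ p.
    by rewrite -exprMn expr2 mulrA.
  apply: (@lt_le_trans _ _ ((N * N `^ A) * (x / 2) ^+ p)).
    by rewrite mulrAC ltr_pM2l.
  by rewrite ler_wpM2r// exprn_ge0//; lra.
move=> m /andP[nKm mn].
apply: ler_wpM2l => //.
have mg : x ^+ 2 / 2 <= m.+1%:R * (x / s) ^+ 2.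
  (* All matrix sizes of the descent stay above [N / 2], since [4 K <= s <= N]. *)
  have Nm : N / 2 <= m.+1%:R.
    have nmK : (n.+1 <= m.+1 + K)%N by move: nKm; clear; lia.
    have : N <= m.+1%:R + K%:R by rewrite NE -natrD ler_nat.
    lra.
  have := ler_wpM2r (sqr_ge0 (x / s)) Nm; apply: le_trans.
  rewrite expr_div_n ss le_eqVlt; apply/orP; left; apply/eqP.
  by field; rewrite gt_eqF.
have mg0 := lt_le_trans xx0 mg.
rewrite lef_pV2 ?posrE ?exprn_gt0//.
by apply: lerXn2r; rewrite ?nnegrE ?(ltW xx0) ?(ltW mg0).
Qed.

End parameters.

(** * Stochastic domination of [W2] *)

Section domination.
Context {R : realType} (d : nat -> measure_display)
    (T : forall N, measurableType (d N)) (P : forall N, probability (T N) R)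
    (U : forall N, {RV (P N) >-> 'M[R[i]]_N})
    (v : forall N, {RV (P N) >-> 'cV[R[i]]_N}).
Hypotheses (U_haar : forall N, (0 < N)%N -> haar_unitary (P N) (U N))
    (v_unit : forall N, (0 < N)%N -> forall t, (v N t) ^t* *m v N t = 1%:M)
    (Uv_indep : forall N, (0 < N)%N -> independent_RV (P N) (U N) (v N)).
Local Notation normc := (@Normc.normc R).

Lemma measurable_large_return2 n K (gam : R) :
  measurable [set x : 'cV[R[i]]_n * 'M[R[i]]_n | large_return x.1 K gam x.2].
Proof.
rewrite (_ : [set x | _] = \bigcup_(k in [set k | (k < K)%N])
    [set x : 'cV[R[i]]_n * 'M[R[i]]_n | gam < normc (retamp x.2 x.1 0 k)]).
  apply: bigcup_measurable => k _; apply: measurable_normc_gt.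
  exact: measurable_retamp measurable_snd measurable_fst.
by apply/seteqP; split => M [k]; exists k.
Qed.

Lemma large_return_pair n K gam :
  P n.+1 [set t | large_return (v n.+1 t) K gam (U n.+1 t)] =
  P n.+1 [set t | large_return (e1 : 'cV_(1 + n)) K gam (U n.+1 t)].
Proof.
apply: (independent_prob (B := [set x : 'cV[R[i]]_n.+1 * 'M[R[i]]_n.+1 |
  large_return x.1 K gam x.2]) (Uv_indep (ltn0Sn n))).
  exact: measurable_large_return2.
move=> t; exact: (haar_large_return K gam (U_haar (ltn0Sn n)) (v_unit (ltn0Sn n) t)).
Qed.

(** The renewal equation between [th = 0] and [th = 1], with coefficient [1]. It is used only once,
    so the loss of a factor [2] is affordable. *)
Lemma moments_of_small_return n (M : 'M[R[i]]_n) (y : 'cV[R[i]]_n) K (g : R) :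
  0 <= g -> 4 * K%:R * g <= 1 -> ~ large_return y K (2 * g) M ->
  forall k, (1 <= k < K.+1)%N -> normc ((y ^t* *m M ^+ k *m y) 0 0) <= 4 * g.
Proof.
move=> g0 Kg nlr [//|k]; rewrite ltnS => /andP[_ kK]; rewrite -retamp1.
apply: (@le_trans _ _ (2 * g * (1 + 2 * 1 * K%:R * (2 * g)))); last first.
  have -> : 2 * g * (1 + 2 * 1 * K%:R * (2 * g)) = 2 * g * (1 + 4 * K%:R * g) by ring.
  have : 2 * g * (1 + 4 * K%:R * g) <= 2 * g * 2 by rewrite ler_wpM2l//; lra.
  lra.
apply: (@renewal_bound _ (fun k => retamp M y 0 k) (fun k => retamp M y 1 k) 1 K) => //.
- by move=> j; rewrite -{2}[1]subr0; exact: retamp_renewal.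
- by move=> j jK; rewrite leNgt; apply/negP => jlt; apply: nlr; exists j.
- by rewrite mulr_ge0.
- by rewrite Normc.normc1.
- by rewrite [leLHS](_ : _ = 4 * K%:R * g)//; ring.
Qed.

(** Everything after the first returns is deterministic: the bound can fail only when some first
    return to [v] is large, and by independence and invariance this is as likely as for [e1]. *)
Lemma W2_event_prob n (K : nat) (g h q rho M : R) :
  0 <= g -> 16 * K%:R ^+ 2 * g ^+ 2 <= 1 -> (0 < K <= n)%N -> 0 < h <= 1 / 2 ->
  0 <= q -> rho <= 1 ->
  16 * h + 28 * (4 * g) + 12 * (1 - h) ^+ K.-1 <= M ->
  (forall m, (n - K <= m <= n)%N ->
    (P m.+1 [set t | g < normc (U m.+1 t 0 0)]%R <= q%:E)%E) ->
  let Om := [set t | forall z, normc z < rho ->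
     normc (W2 (U n.+1 t) (v n.+1 t) z) <= M * (normc z ^+ 2 / (1 - normc z))] in
  measurable Om /\ (1 - P n.+1 Om <= (K%:R * q)%:E)%E.
Proof.
move=> g0 Kg Kn h01 q0 rho1 HM Hq Om.
have [K0 _] := andP Kn.
have M0 : 0 <= M.
  apply: le_trans HM; have /andP[h0 h1] := h01.
  by rewrite addr_ge0 ?addr_ge0 ?mulr_ge0 ?exprn_ge0//; lra.
have Uu t : U n.+1 t \is unitarymx by exact: (U_haar (ltn0Sn n)).1.
have mOm : measurable Om.
  by apply: measurable_W2_event => //; exact: v_unit.
split=> //; rewrite -probability_setC//.
have := haar_large_return_le (U := fun N => U N) U_haar g0 Kg Kn q0 Hq.
apply: le_trans; rewrite -large_return_pair; apply: le_measure; rewrite ?inE.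
- exact: measurableC.
- have mp : measurable_fun setT (fun t => (v n.+1 t, U n.+1 t)).
    exact: measurable_fun_pair.
  have := mp measurableT _ (@measurable_large_return2 n.+1 K (2 * g)).
  by rewrite setTI.
move=> t /= nOm; apply: contrapT => nlr; apply: nOm => z zr.
have z1 : normc z < 1 by exact: lt_le_trans rho1.
have Kg' : 4 * K%:R * g <= 1.
  have Kg0 : 0 <= 4 * K%:R * g by rewrite mulr_ge0// mulr_ge0.
  rewrite -(ler_pXn2r (ltn0Sn 1)) ?nnegrE// expr1n.
  by rewrite [leLHS](_ : _ = 16 * K%:R ^+ 2 * g ^+ 2)//; ring.
have Hm := moments_of_small_return g0 Kg' nlr.
(* Moments of orders [1] to [K] are controlled, so the geometric expansion has [K.-1] terms. *)
have := W2_bounded_of_moments (b := 4 * g) (m := K.-1) (Uu t) (v_unit (ltn0Sn n) t) h01.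
rewrite !prednK// => /(_ _ Hm z1)/le_trans; apply.
rewrite mulrC ler_wpM2r// divr_ge0 ?exprn_ge0 ?normc_ge0// subr_ge0.
exact: ltW.
Qed.

Lemma W2_stoch_dom (rho : nat -> R) (S : nat -> set R[i]) :
  (\forall N \near \oo, rho N <= 1 /\ forall z, S N z <-> normc z < rho N) ->
  stoch_dom P (fun N z t => W2 (U N t) (v N t) z) (@W2_bound R d T) S.
Proof.
move=> [N1 _ HS] eps eps0 A A0.
have [X0 HX] := large_parameters eps0 A0.
exists (maxn 1 (maxn N1 (Num.truncn X0).+1)) => // n.
rewrite /= !geq_max => /and3P[n0 nN1 nX]; case: n => [//|n] in n0 nN1 nX *.
have X0n : X0 <= n.+1%:R.
  by apply: ltW; apply: lt_le_trans (truncnS_gt _) _; rewrite ler_nat.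
have [K [p [g [h [q [g0 Kg Kn h01 [HM q0 qA Hq]]]]]]] := HX n X0n.
have [rho1 SE] := HS n.+1 nN1.
have Hq' m : (n - K <= m <= n)%N ->
    (P m.+1 [set t | g < normc (U m.+1 t 0 0)]%R <= q%:E)%E.
  move=> nm; apply: le_trans (haar_entry_tail (n := m) (U_haar (ltn0Sn m)) p g0) _.
  by rewrite lee_fin Hq.
have [mOm POm] := W2_event_prob (ltW g0) Kg Kn h01 q0 rho1 HM Hq'.
set Om := [set t | _] in mOm POm.
rewrite (_ : [set t | _] = Om).
  by split=> //; apply: (le_lt_trans POm); rewrite lte_fin.
have sN : 0 < Num.sqrt n.+1%:R :> R by rewrite sqrtr_gt0.
have bE z (t : T n.+1) : normc z < rho n.+1 ->
    (n.+1%:R `^ eps)%:C * `|W2_bound z t : R[i]| =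
    ((n.+1%:R `^ eps / Num.sqrt n.+1%:R) * (normc z ^+ 2 / (1 - normc z)))%:C.
  move=> zr; have z1 : 0 < 1 - normc z by rewrite subr_gt0; exact: lt_le_trans rho1.
  have -> : W2_bound z t = (normc z ^+ 2 / (Num.sqrt n.+1%:R * (1 - normc z)))%:C.
    rewrite /W2_bound normcE [RHS]rmorphM; congr (_ * _); first by rewrite rmorphXn.
    by rewrite fmorphV rmorphM rmorphB rmorph1.
  rewrite normcE normc_real; last first.
    by rewrite divr_ge0 ?exprn_ge0 ?normc_ge0// mulr_ge0// ltW.
  by rewrite -rmorphM; congr _%:C; rewrite invfM; ring.
apply/seteqP; split => t H z zr.
  have := H z ((SE z).2 zr); rewrite bE// normcE lecR; exact.
have {}zr := (SE z).1 zr.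
by rewrite bE// normcE lecR; exact: H.
Qed.

End domination.

(** * The beta law *)

Section bernoulli_inequality.
Context {R : realType}.

Lemma onem_expr_ge (y : R) m : 0 <= y <= 1 -> 1 - m%:R * y <= (1 - y) ^+ m.
Proof.
move=> /andP[y0 y1]; elim: m => [|m IHm]; first by rewrite mul0r subr0 expr0.
have m0 : 0 <= m%:R :> R by [].
rewrite exprS -natr1; have := ler_wpM2l (_ : 0 <= 1 - y) IHm.
rewrite subr_ge0 => /(_ y1)/(le_trans _); apply; nra.
Qed.

Lemma onem_expr_le (y : R) m : 0 <= y <= 1 -> (1 - y) ^+ m * (1 + m%:R * y) <= 1.
Proof.
move=> /andP[y0 y1]; elim: m => [|m IHm]; first by rewrite mul0r addr0 expr0 mulr1.
apply: le_trans IHm; rewrite exprSr -mulrA ler_wpM2l ?exprn_ge0 ?subr_ge0//.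
by rewrite -natr1; have m0 : 0 <= m%:R :> R by []; nra.
Qed.

Lemma expr_small (q e : R) : 0 <= q < 1 -> 0 < e -> exists p, q ^+ p.+1 <= e.
Proof.
move=> /andP[q0 q1] e0; have y0 : 0 < 1 - q by lra.
exists (Num.truncn (e^-1 / (1 - q))); set p := _.+1.
have pE : e^-1 / (1 - q) < p%:R by exact: truncnS_gt.
rewrite ltr_pdivrMr// in pE.
have y01 : 0 <= 1 - q <= 1 by apply/andP; split; lra.
have := onem_expr_le p y01; rewrite subKr => H.
have qp0 : 0 <= q ^+ p by rewrite exprn_ge0.
have ie : q ^+ p * e^-1 <= 1 by apply: le_trans H; rewrite ler_wpM2l//; lra.
by rewrite -[leRHS]mul1r -ler_pdivrMr.
Qed.

End bernoulli_inequality.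

Section moment_comparison.
Context {R : realType} d1 d2 (T1 : measurableType d1) (T2 : measurableType d2)
  (P1 : probability T1 R) (P2 : probability T2 R) (X1 : T1 -> R) (X2 : T2 -> R).
Hypotheses (mX1 : measurable_fun setT X1) (mX2 : measurable_fun setT X2).
Hypotheses (X1_01 : forall t, 0 <= X1 t <= 1) (X2_01 : forall t, 0 <= X2 t <= 1).
Hypothesis mom : forall p, \int[P1]_t (X1 t ^+ p) = \int[P2]_t (X2 t ^+ p).

Lemma bmeas01 d (T : measurableType d) (X : T -> R) : measurable_fun setT X ->
  (forall t, 0 <= X t <= 1) -> bmeas X.
Proof.
move=> mX X01; split=> //; exists 1 => t.
by have /andP[x0 x1] := X01 t; rewrite ger0_norm.
Qed.

Lemma exp_indic d (T : measurableType d) (P : probability T R) (A : set T) :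
  measurable A -> \int[P]_t (\1_A t) = fine (P A).
Proof. by move=> mA; rewrite /Rintegral integral_indic// setIT. Qed.

Lemma bmeas_indic d (T : measurableType d) (A : set T) :
  measurable A -> bmeas (\1_A : T -> R).
Proof.
move=> mA; split; first exact: measurable_indic.
by exists 1 => t; rewrite indicE; case: (_ \in _); rewrite ?normr1// normr0.
Qed.

Lemma measurable_le_set d (T : measurableType d) (X : T -> R) a :
  measurable_fun setT X -> measurable [set t | X t <= a].
Proof.
move=> mX; rewrite (_ : [set t | _] = X @^-1` `]-oo, a]%classic).
  by rewrite -[X in measurable X]setTI; exact: mX.
by apply/seteqP; split => t /=; rewrite in_itv.
Qed.

Let test p m (x : R) := (1 - x ^+ p) ^+ m.

Let exp_test p m : \int[P1]_t (test p m (X1 t)) = \int[P2]_t (test p m (X2 t)).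
Proof.
have E d (T : measurableType d) (P : probability T R) (X : T -> R) : bmeas X ->
    \int[P]_t (test p m (X t)) =
    \sum_(i < m.+1) ((-1) ^+ i *+ 'C(m, i)) * \int[P]_t (X t ^+ (p * i)).
  move=> bX; transitivity (\int[P]_t \sum_(i < m.+1)
      (((-1) ^+ i *+ 'C(m, i)) * X t ^+ (p * i))).
    apply: eq_Rintegral => t _; rewrite /test exprBn; apply: eq_bigr => i _.
    by rewrite expr1n mulr1 -exprM -mulrnAl.
  rewrite exp_sum; last first.
    by move=> i; apply: bmeasM; [exact: bmeas_cst|exact: bmeasX].
  by apply: eq_bigr => i _; rewrite expZ//; exact: bmeasX.
rewrite !E; [|exact: bmeas01|exact: bmeas01].
by apply: eq_bigr => i _; rewrite mom.
Qed.

(* The test polynomials [(1 - x^p)^m], with [m] close to [t^-p], tend to the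
   indicator of [x < t] away from [t], by Bernoulli's inequality. *)
Lemma cdf_le_of_moments (a b : R) : 0 <= a -> a < b -> b <= 1 ->
  fine (P1 [set t | X1 t <= a]) <= fine (P2 [set t | X2 t <= b]).
Proof.
move=> a0 ab b1; apply/ler_addgt0Pr => e e0.
pose t := (a + b) / 2.
have t0 : 0 < t by rewrite /t; lra.
have at_ : a < t by rewrite /t; lra.
have tb : t < b by rewrite /t; lra.
have b0 : 0 < b by lra.
pose q := Num.max (a / t) (t / b).
have q01 : 0 <= q < 1.
  rewrite /q le_max gt_max divr_ge0 ?(ltW t0)//=.
  by rewrite ltr_pdivrMr// mul1r at_/= ltr_pdivrMr// mul1r tb.
have e4 : 0 < e / 4 by rewrite divr_gt0.
have [p qp] := expr_small q01 e4.
have atp : (a / t) ^+ p.+1 <= e / 4.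
  have aq : a / t <= q by rewrite le_max lexx.
  have at0 : 0 <= a / t by rewrite divr_ge0 ?(ltW t0).
  by apply: le_trans qp; apply: lerXn2r => //; rewrite nnegrE ?(le_trans at0 aq).
have tbp : (t / b) ^+ p.+1 <= e / 4.
  have bq : t / b <= q by rewrite le_max lexx orbT.
  have tb0 : 0 <= t / b by rewrite divr_ge0 ?(ltW t0) ?(ltW b0).
  by apply: le_trans qp; apply: lerXn2r => //; rewrite nnegrE ?(le_trans tb0 bq).
(* Thus [1 <= m t^(p+1) <= 2]: the lower bound makes the test small beyond [b], the upper bound
   keeps it close to one below [a]. *)
pose m := (Num.truncn (t ^+ p.+1)^-1).+1.
have tp0 : 0 < t ^+ p.+1 by rewrite exprn_gt0.
have tp1 : t ^+ p.+1 <= 1 by rewrite exprn_ile1 ?(ltW t0)//; lra.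
have mt1 : 1 <= m%:R * t ^+ p.+1.
  by apply: ltW; rewrite -ltr_pdivrMr// mul1r; exact: truncnS_gt.
have mt2 : m%:R * t ^+ p.+1 <= 2.
  rewrite /m -natr1 mulrDl mul1r.
  have : (Num.truncn (t ^+ p.+1)^-1)%:R * t ^+ p.+1 <= (t ^+ p.+1)^-1 * t ^+ p.+1.
    by rewrite ler_pM2r// truncn_le invr_ge0 ltW.
  rewrite mulVf ?gt_eqF//; lra.
have pow01 (x : R) : 0 <= x <= 1 -> 0 <= x ^+ p.+1 <= 1.
  by move=> /andP[x0 x1]; rewrite exprn_ge0//= exprn_ile1.
have test01 (x : R) : 0 <= x <= 1 -> 0 <= test p.+1 m x <= 1.
  move=> /pow01/andP[y0 y1]; rewrite /test exprn_ge0 ?subr_ge0//=.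
  by rewrite exprn_ile1 ?subr_ge0//; lra.
have btest d (T : measurableType d) (X : T -> R) : measurable_fun setT X ->
    (forall t, 0 <= X t <= 1) -> bmeas (fun t => test p.+1 m (X t)).
  move=> mX X01; apply: bmeasX; apply: bmeasB; first exact: bmeas_cst.
  by apply: bmeasX; exact: bmeas01.
have mA := measurable_le_set a mX1; have mB := measurable_le_set b mX2.
have L : fine (P1 [set t | X1 t <= a]) - e / 2 <= \int[P1]_t (test p.+1 m (X1 t)).
  rewrite -exp_indic// -[X in _ - X](exp_cst P1) -expB; last 2 first.
  - exact: bmeas_indic.
  - exact: bmeas_cst.
  apply: exp_le; [|exact: btest|].
    by apply: bmeasB; [exact: bmeas_indic|exact: bmeas_cst].
  move=> s; have /andP[f0 f1] := test01 _ (X1_01 s); rewrite indicE.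
  case: (boolP (s \in _)) => [|_]; last by rewrite sub0r; lra.
  rewrite inE /= => Xa; have /andP[x0 x1] := X1_01 s.
  have H : 1 - m%:R * X1 s ^+ p.+1 <= test p.+1 m (X1 s).
    by apply: onem_expr_ge; exact: pow01.
  have : m%:R * X1 s ^+ p.+1 <= m%:R * a ^+ p.+1.
    by rewrite ler_wpM2l//; apply: lerXn2r; rewrite ?nnegrE.
  have -> : m%:R * a ^+ p.+1 = m%:R * t ^+ p.+1 * (a / t) ^+ p.+1.
    by rewrite -mulrA -exprMn; congr (_ * _ ^+ _); field; rewrite gt_eqF.
  have : m%:R * t ^+ p.+1 * (a / t) ^+ p.+1 <= 2 * (e / 4).
    have A0 : 0 <= m%:R * t ^+ p.+1 by rewrite mulr_ge0// ltW.
    have B0 : 0 <= (a / t) ^+ p.+1 by rewrite exprn_ge0// divr_ge0// ltW.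
    by rewrite ler_pM.
  lra.
have L2 : \int[P2]_t (test p.+1 m (X2 t)) <= fine (P2 [set t | X2 t <= b]) + e / 2.
  rewrite -exp_indic// -[X in _ + X](exp_cst P2) -expD; last 2 first.
  - exact: bmeas_indic.
  - exact: bmeas_cst.
  apply: exp_le; [exact: btest| |].
    by apply: bmeasD; [exact: bmeas_indic|exact: bmeas_cst].
  move=> s; have /andP[f0 f1] := test01 _ (X2_01 s); rewrite indicE.
  case: (boolP (s \in _)) => [_|]; first by rewrite /=; lra.
  rewrite notin_setE /= add0r => /negP; rewrite -ltNge => bX.
  have /andP[x0 x1] := X2_01 s.
  have H := onem_expr_le m (pow01 _ (X2_01 s)).
  have bt0 : 0 < (b / t) ^+ p.+1 by rewrite exprn_gt0// divr_gt0.
  have mX : (b / t) ^+ p.+1 <= m%:R * X2 s ^+ p.+1.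
    apply: (@le_trans _ _ (m%:R * t ^+ p.+1 * (b / t) ^+ p.+1)).
      by rewrite ler_peMl// ltW.
    have -> : m%:R * t ^+ p.+1 * (b / t) ^+ p.+1 = m%:R * b ^+ p.+1.
      by rewrite -mulrA -exprMn; congr (_ * _ ^+ _); field; rewrite gt_eqF.
    rewrite ler_wpM2l//.
    by apply: lerXn2r; rewrite ?nnegrE ?(ltW b0) ?(ltW bX).
  have H2 : test p.+1 m (X2 s) * (b / t) ^+ p.+1 <= 1.
    by apply: le_trans H; rewrite ler_wpM2l//; lra.
  rewrite -ler_pdivlMr// mul1r -exprVn invf_div in H2.
  lra.
have := exp_test p.+1 m; lra.
Qed.

End moment_comparison.

Section cdf.
Context {R : realType}.

Lemma prob_eq_of_cdf (P1 P2 : probability (measurableTypeR R) R) :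
  (forall a, P1 `]-oo, a]%classic = P2 `]-oo, a]%classic) ->
  forall A, measurable A -> P1 A = P2 A.
Proof.
move=> H A mA.
have HG : forall B, @RGenOInfty.G R B -> P1 B = P2 B.
  move=> _ [x ->].
  have -> : `]x, +oo[%classic = ~` `]-oo, x]%classic by rewrite setCitvl.
  by rewrite !probability_setC// H.
have Hfin : forall k : nat, (P1 `](- k%:R : R)%R, +oo[%classic < +oo)%E.
  by move=> k; apply: le_lt_trans (probability_le1 _ _) _ => //; rewrite ltry.
refine (@measure_unique _ R (measurableTypeR R) (@RGenOInfty.G R)
  (fun n => `](- n%:R : R), +oo[%classic) _ _ _ _ P1 P2 HG Hfin A mA).
- exact: RGenOInfty.measurableE.
- move=> _ _ [x ->] [y ->]; exists (Num.max x y).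
  by apply/seteqP; split => z /=; rewrite !in_itv/= !andbT gt_max => /andP.
- by move=> n; exists (- n%:R).
- apply/seteqP; split => // x _; exists (Num.truncn (- x)).+1 => //=.
  by rewrite in_itv/= andbT ltrNl truncnS_gt.
Qed.

End cdf.

Section beta_law.
Context {R : realType} (n : nat).
Local Notation nu := (beta_prob 1 n.+1 : probability (measurableTypeR R) R).

(** The density is at most the inverse of [beta_fun 1 n.+1], which is [n.+1]. The estimate serves
    both to identify the law and to bound the probability of a small entry. *)
Lemma beta_prob_itv_le (a b : R) : a <= b ->
  (nu `]a, b]%classic <= (n.+1%:R * (b - a))%:E)%E.
Proof.
move=> ab; rewrite -[leLHS]/(beta_prob 1 n.+1 `]a, b]%classic) -integral_beta_pdf//.
apply: (@le_trans _ _ (\int[lebesgue_measure]_(x in `]a, b]) (cst n.+1%:R%:E x))%E).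
  apply: ge0_le_integral => //=.
  - by move=> x _; rewrite lee_fin beta_pdf_ge0.
  - by apply/measurable_funTS/measurable_EFinP; exact: measurable_beta_pdf.
  by move=> x _; rewrite lee_fin (le_trans (beta_pdf_le_beta_funV _ _ _))//
    beta_fun1Sn invrK.
rewrite integral_cst//= lebesgue_measure_itv/= lte_fin.
case: ltP => [_|ba]; first by rewrite -EFinD -EFinM.
by rewrite mule0 lee_fin mulr_ge0// subr_ge0.
Qed.

(** Almost surely the identity under the beta law, but with values in [[0, 1]] everywhere, as the
    comparison of moments demands. *)
Definition clamp01 (x : R) : R := if 0 <= x <= 1 then x else 0.

Lemma clamp01_itv x : 0 <= clamp01 x <= 1.
Proof. by rewrite /clamp01; case: ifP => // _; rewrite lexx ler01. Qed.

Lemma measurable_clamp01 : measurable_fun setT clamp01.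
Proof.
have : measurable_fun setT (@idfun R \_ `[0, 1]).
  by apply/measurable_restrict => //; rewrite setTI; exact: measurable_id.
apply: eq_measurable_fun => x _; rewrite patchE /clamp01.
by rewrite mem_setE in_itv.
Qed.

Lemma beta_moment p :
  \int[nu]_x (clamp01 x ^+ p) = beta_fun p.+1 n.+1 / beta_fun 1 n.+1.
Proof.
have bc : bmeas (fun x => clamp01 x ^+ p).
  apply: bmeasX; apply: bmeas01; [exact: measurable_clamp01|exact: clamp01_itv].
apply: EFin_inj; rewrite (exp_EFin nu bc).
rewrite integral_beta_prob//; last 2 first.
- by apply/measurable_EFinP; exact: bc.1.
- have /integrableP[_] := bmeas_integrable nu bc.
  by [].
rewrite EFinM EFin_beta_fun -ge0_integralZr//=; last 3 first.
- apply/measurable_EFinP; apply/measurable_restrict => //=; rewrite setTI.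
  exact: measurable_XMonemX.
- move=> x _; rewrite lee_fin patchE; case: ifPn => //; rewrite inE/= => x01.
  exact: XMonemX_ge0.
- by rewrite lee_fin invr_ge0 beta_fun_ge0.
apply: eq_integral => x _; rewrite -!EFinM; congr _%:E.
rewrite /beta_pdf mulrA; congr (_ / _).
rewrite !patchE mem_setE; case: ifPn => [|_]; last by rewrite mulr0.
rewrite in_itv/= => x01; rewrite /clamp01 x01.
by rewrite /XMonemX/= expr0 mul1r.
Qed.

Lemma beta_prob_setC01 : nu (~` `[0, 1]%classic) = 0%E.
Proof.
have nu01 : nu `[0, 1]%classic = 1%E by exact: beta_prob01.
by rewrite probability_setC// nu01 subee.
Qed.

Variables (d : measure_display) (T : measurableType d) (P : probability T R).
Variable X : T -> R.
Hypotheses (mX : measurable_fun setT X) (X01 : forall t, 0 <= X t <= 1).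
Hypothesis mom0 : \int[P]_t (X t ^+ 0) = 1.
Hypothesis momS : forall p,
  (p.+1 + n.+1)%:R * \int[P]_t (X t ^+ p.+1) = p.+1%:R * \int[P]_t (X t ^+ p).

(** Both sides start at one and obey the same recursion, by the factorial formula for the beta
    function. *)
Lemma moments_beta p : \int[P]_t (X t ^+ p) = \int[nu]_x (clamp01 x ^+ p).
Proof.
elim: p => [|p IHp].
  by rewrite mom0 beta_moment divff// gt_eqF// beta_fun_gt0.
have pn : (p.+1 + n.+1)%:R != 0 :> R by rewrite pnatr_eq0.
apply: (mulfI pn); rewrite momS IHp !beta_moment !mulrA; congr (_ / _).
have f0 k : k`!%:R != 0 :> R by rewrite pnatr_eq0 -lt0n fact_gt0.
have pnE : (p.+1 + n.+1 = (p + n).+2)%N by rewrite addSn addnS.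
rewrite pnE in pn *; rewrite !beta_fun_fact addSn.
have fS k : k.+1`!%:R = k.+1%:R * k`!%:R :> R by rewrite factS natrM.
rewrite [in RHS]natrM [in LHS]natrM (fS p) (fS (p + n).+1).
move: pn (f0 (p + n).+1).
move: ((p + n).+2%:R : R) ((p + n).+1`!%:R : R) (p.+1%:R : R) (p`!%:R : R)
  (n`!%:R : R) => a b c x y a0 b0.
by field; rewrite a0 b0.
Qed.

Let cdfX a := fine (P [set t | X t <= a]).
Let cdfnu a := fine (nu `]-oo, a]%classic).

Let nu_clamp a : 0 <= a -> fine (nu [set x | clamp01 x <= a]) = cdfnu a.
Proof.
move=> a0; have mS : measurable [set x | clamp01 x <= a].
  exact: measurable_le_set measurable_clamp01.
have nuI (S : set R) : measurable S -> nu S = nu (S `&` (`[0, 1]%classic : set R)).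
  have m01 : measurable (`[0, 1]%classic : set R) by [].
  move=> mS'; rewrite (measureDI nu mS' m01).
  rewrite [X in (X + _)%E](_ : _ = 0%E) ?add0e//.
  apply/eqP; rewrite eq_le measure_ge0 andbT -beta_prob_setC01.
  by apply: le_measure; rewrite ?inE//; [exact: measurableD|exact: measurableC].
rewrite /cdfnu (nuI _ mS) (nuI `]-oo, a]%classic)//; congr (fine (nu _)).
apply/seteqP; split => x /=; rewrite !in_itv/= /clamp01 => -[] + x01;
  by rewrite x01.
Qed.

Let cdfnu_le a b : a <= b -> cdfnu b <= cdfnu a + n.+1%:R * (b - a).
Proof.
move=> ab; rewrite -lee_fin EFinD /cdfnu !fineK ?fin_num_measure//.
apply: le_trans (leeD (lexx _) (beta_prob_itv_le ab)).
rewrite -measureU//; last first.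
  apply/seteqP; split => x //=; rewrite !in_itv/= => -[xa /andP[ax _]].
  by move: (lt_le_trans ax xa); rewrite ltxx.
apply: le_measure; rewrite ?inE//; first exact: measurableU.
move=> x /=; rewrite !in_itv/= => xb.
by have [xa|ax] := leP x a; [left|right; rewrite xb andbT].
Qed.

(** Moments compare the two distribution functions only at distinct points [a < b]. The gap is
    closed in both directions by the Lipschitz bound on the beta side. *)
Lemma law_beta B : measurable B -> P (X @^-1` B) = nu B.
Proof.
move=> mB.
pose Y : {mfun T >-> measurableTypeR R} := HB.pack (X : T -> measurableTypeR R)
  (isMeasurableFun.Build _ _ T (measurableTypeR R) X mX).
rewrite -[LHS]/(distribution P Y B); move: B mB.
apply: (@prob_eq_of_cdf R (distribution P Y) nu) => a.
have mXa b : measurable [set t | X t <= b] by exact: measurable_le_set.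
transitivity (P [set t | X t <= a]).
  by congr (P _); apply/seteqP; split => t /=; rewrite in_itv.
rewrite -[LHS]fineK ?fin_num_measure// -[RHS]fineK ?fin_num_measure//; congr _%:E.
rewrite -/(cdfX a) -/(cdfnu a).
have n0 : 0 < n.+1%:R :> R by [].
have cdfneg b : b < 0 -> cdfnu b = 0.
  move=> b0; rewrite /cdfnu (_ : nu _ = 0%E)//.
  apply/eqP; rewrite eq_le measure_ge0 andbT -beta_prob_setC01.
  apply: le_measure; rewrite ?inE//; first exact: measurableC.
  by move=> x /=; rewrite !in_itv/= => xb /andP[]; lra.
have cdfXneg b : b < 0 -> cdfX b = 0.
  move=> b0; rewrite /cdfX (_ : [set t | _] = set0) ?measure0//.
  by apply/seteqP; split => // t /=; have /andP[] := X01 t; lra.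
have m01 : forall p, \int[nu]_x (clamp01 x ^+ p) = \int[P]_t (X t ^+ p).
  by move=> p; rewrite moments_beta.
have [a0|a0] := ltP a 0; first by rewrite cdfneg// cdfXneg.
have [a1|a1] := leP 1 a.
  rewrite /cdfX /cdfnu (_ : [set t | _] = setT); last first.
    by apply/seteqP; split => // t _ /=; have /andP[] := X01 t; lra.
  rewrite probability_setT; congr fine; apply/esym/eqP; rewrite eq_le probability_le1//=.
  have <- : nu `[0, 1]%classic = 1%E by exact: beta_prob01.
  apply: le_measure; rewrite ?inE//.
  by move=> x /=; rewrite !in_itv/=; lra.
apply/eqP; rewrite eq_le; apply/andP; split.
  apply/ler_addgt0Pr => e e0.
  pose b := Num.min 1 (a + e / n.+1%:R).
  have ab : a < b by rewrite lt_min a1 ltrDl divr_gt0.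
  have b1 : b <= 1 by rewrite ge_min lexx.
  have be : n.+1%:R * (b - a) <= e.
    rewrite mulrC -ler_pdivlMr// lerBlDl.
    by rewrite ge_min lexx orbT.
  have := @cdf_le_of_moments R _ _ T (measurableTypeR R) P nu X clamp01 mX
    measurable_clamp01 X01 clamp01_itv moments_beta a b a0 ab b1.
  rewrite nu_clamp ?(le_trans a0 (ltW ab))// => H; apply: (le_trans H).
  by apply: (le_trans (cdfnu_le (ltW ab))); rewrite lerD2l.
apply/ler_addgt0Pr => e e0.
pose c := a - e / n.+1%:R.
have en : 0 < e / n.+1%:R by rewrite divr_gt0.
have ca : c <= a by rewrite /c lerBlDr lerDl ltW.
have ce : n.+1%:R * (a - c) = e by rewrite /c subKr mulrC mulfVK// gt_eqF.
have := cdfnu_le ca; rewrite ce => H; apply: (le_trans H); rewrite lerD2r.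
have [c0|c0] := ltP c 0.
  by rewrite cdfneg// /cdfX fine_ge0// measure_ge0.
rewrite -nu_clamp//.
have ca' : c < a by rewrite /c ltrBlDr ltrDl divr_gt0.
exact: (@cdf_le_of_moments R _ _ (measurableTypeR R) T nu P clamp01 X
  measurable_clamp01 mX clamp01_itv X01 m01 c a c0 ca' (ltW a1)).
Qed.

End beta_law.

(** * The uniform phase *)

Section circle.
Context {R : realType}.
Local Notation mu := (@lebesgue_measure R).
Implicit Types (c w : R) (G : set R).

Lemma lebesgue_measure_shift c (A : set R) : measurable A ->
  mu [set x | A (x + c)] = mu A.
Proof.
move=> mA.
have mc : measurable_fun setT (fun x : measurableTypeR R => (x + c : measurableTypeR R)).
  exact: measurable_funD.
pose f : {mfun measurableTypeR R >-> measurableTypeR R} :=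
  HB.pack (fun x : measurableTypeR R => (x + c : measurableTypeR R))
    (isMeasurableFun.Build _ _ (measurableTypeR R) (measurableTypeR R) _ mc).
rewrite -[LHS]/(pushforward mu f A).
apply/esym/lebesgue_measure_unique => //= _ [[a b]] _ <-.
rewrite /pushforward/=.
rewrite (_ : _ @^-1` _ = `](a - c), (b - c)]%classic); last first.
  by apply/seteqP; split => x /=; rewrite !in_itv/= ltrBlDr lerBrDr.
rewrite !lebesgue_measure_itv/= !lte_fin ltrD2r; case: ifP => // _.
by rewrite -!EFinD; congr _%:E; ring.
Qed.

Lemma measurable_shift c G : measurable G -> measurable [set x | G (x + c)].
Proof.
move=> mG; rewrite -[X in measurable X]setTI.
by apply: (measurable_funD (f := id) (g := cst c)).
Qed.

(** Translation turns the window into []c, w + c]], and the part beyond [w] is moved back by one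
    period onto []0, c]]. Half-open intervals make the pieces disjoint. *)
Lemma lebesgue_periodic_shift c w G : measurable G ->
  (forall x, G (x + w) <-> G x) -> 0 <= c <= w ->
  mu ([set x | G (x + c)] `&` `]0, w]) = mu (G `&` `]0, w]).
Proof.
move=> mG pG /andP[c0 cw].
rewrite (_ : _ `&` _ = [set x | (G `&` `]c, w + c]) (x + c)]); last first.
  by apply/seteqP; split => x /=; rewrite !in_itv/= ltrDr lerD2r.
rewrite lebesgue_measure_shift; last exact: measurableI.
have split_at (a b e : R) : a <= b -> b <= e ->
    mu (G `&` `]a, e]) = (mu (G `&` `]a, b]) + mu (G `&` `]b, e]))%E.
  move=> ab be; rewrite -measureU; [|exact: measurableI|exact: measurableI|].
    congr (mu _); rewrite -setIUr; congr (_ `&` _).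
    apply/seteqP; split => x /=; rewrite !in_itv/=; last first.
      by case=> /andP[] h1 h2; apply/andP; split; lra.
    by move=> /andP[h1 h2]; have [h|h] := leP x b; [left|right]; apply/andP; split.
  apply/seteqP; split => // x [[_ +] [_]] /=; rewrite !in_itv/=.
  by move=> /andP[_ h1] /andP[h2 _]; move: (lt_le_trans h2 (h1 : x <= b)); rewrite ltxx.
rewrite (split_at c w (w + c)) ?lerDl// (split_at 0 c w)// addeC; congr (_ + _)%E.
rewrite -[LHS](lebesgue_measure_shift w); last exact: measurableI.
congr (mu _); apply/seteqP; split => x /=;
  by rewrite !in_itv/= ltrDr [w + c]addrC lerD2r => -[/pG gx hx].
Qed.

Lemma uniform_prob_itv0 w (w0 : 0 < w) G : measurable G ->
  uniform_prob w0 G = ((w^-1)%:E * mu (G `&` `]0%R, w]%classic))%E.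
Proof.
move=> mG; rewrite /uniform_prob integral_uniform_pdf.
rewrite (eq_integral (cst (w^-1)%:E)); last first.
  move=> x; rewrite inE/= => -[_]; rewrite in_itv/= /uniform_pdf subr0 => ->.
  by [].
rewrite integral_cst//=; last exact: measurableI.
congr (_ * _)%E.
rewrite (_ : G `&` `[0, w] = (G `&` `]0, w]) `|` (G `&` [set 0])); last first.
  rewrite -setIUr; congr (_ `&` _).
  apply/seteqP; split => x /=; rewrite !in_itv/=.
    by move=> /andP[x0 ->]; have [->|x0'] := eqVneq x 0; [right|left; rewrite lt_def x0' x0].
  by case=> [/andP[/ltW -> ->]|->]//; rewrite lexx ltW.
rewrite measureU0//; [exact: measurableI|exact: measurableI|].
apply/eqP; rewrite eq_le measure_ge0 andbT -(lebesgue_measure_set1 (0 : R)).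
by apply: le_measure; rewrite ?inE//; exact: measurableI.
Qed.

Definition expi (x : R) : R[i] := cos x +i* sin x.

Lemma expiD x y : expi (x + y) = expi x * expi y.
Proof. by rewrite /expi cosD sinD; congr (_ +i* _); rewrite [in RHS]addrC mulrC [X in _ + X]mulrC. Qed.

Lemma expiD2pi x : expi (x + 2 * pi) = expi x.
Proof. by rewrite /expi mulr_natl cosD2pi sinD2pi. Qed.

Lemma expi_unitary n x : ((expi x)%:M : 'M[R[i]]_n) \is unitarymx.
Proof.
apply/unitarymxP; rewrite tr_scalar_mx map_scalar_mx -scalar_mxM.
congr (_%:M); apply/eqP; rewrite eq_complex /=.
apply/andP; split; apply/eqP; last by ring.
by rewrite mulrN opprK -!expr2 cos2Dsin2.
Qed.

Lemma measurable_expi : measurable_fun setT expi.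
Proof.
apply/measurable_complexP; split; apply: continuous_measurable_fun.
  exact: continuous_cos.
exact: continuous_sin.
Qed.

Lemma polar (z : R[i]) :
  exists2 c, 0 <= c <= 2 * pi & z = expi c * (Normc.normc z)%:C.
Proof.
have pi0 := @pi_gt0 R.
have [->|z0] := eqVneq z 0.
  by exists 0; rewrite ?lexx ?mulr_ge0 ?ltW// Normc.normc0 mulr0.
have r0 : 0 < Normc.normc z by rewrite lt_def normc_ge0 andbT; apply: contra z0 => /eqP/Normc.eq0_normc ->.
case: z z0 r0 => a b _ r0; set r := Normc.normc _ in r0 *.
have rE : r ^+ 2 = a ^+ 2 + b ^+ 2 by rewrite /r /= sqr_sqrtr// addr_ge0 ?sqr_ge0.
have br : (b / r) ^+ 2 = 1 - (a / r) ^+ 2.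
  rewrite !expr_div_n -[X in X - _](@divff _ (r ^+ 2)) ?expf_neq0 ?gt_eqF//.
  by rewrite -mulrBl rE addrAC subrr add0r.
have ar : -1 <= a / r <= 1.
  by rewrite -ler_norml -(@expr_le1 _ 2)// real_normK ?num_real// -subr_ge0 -br sqr_ge0.
have sE : sin (acos (a / r)) = `|b| / r.
  by rewrite sin_acos// -br sqrtr_sqr normrM normfV (gtr0_norm r0).
have [ac0 acpi] : 0 <= acos (a / r) /\ acos (a / r) <= pi.
  by split; [exact: acos_ge0|exact: acos_lepi].
have zE x : cos x = a / r -> sin x = b / r -> a +i* b = expi x * r%:C.
  move=> cx sx; rewrite /expi cx sx; apply/eqP; rewrite eq_complex /=.
  by apply/andP; split; apply/eqP; field; rewrite gt_eqF.
have [b0|b0] := leP 0 b.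
  exists (acos (a / r)); first by lra.
  by apply: zE; rewrite ?acosK// sE ger0_norm.
exists (2 * pi - acos (a / r)); first by lra.
apply: zE; rewrite addrC mulr_natl.
  by rewrite cosD2pi cosN acosK.
by rewrite sinD2pi sinN sE ltr0_norm// mulNr opprK.
Qed.

(** The argument of [z] acts as a shift of [x], and the set of phases is periodic with period
    [2 * pi]. *)
Lemma uniform_phase_invariant (f : R[i] -> R[i]) (A : set R[i]) (z : R[i]) :
  measurable_fun setT f -> measurable A ->
  uniform_prob (@twopi_gt0 R) [set x | A (f (expi x * z))] =
  uniform_prob (@twopi_gt0 R) [set x | A (f (expi x * (Normc.normc z)%:C))].
Proof.
move=> mf mA; have [c c02 zE] := polar z.
set r := (Normc.normc z)%:C; pose G := [set x | A (f (expi x * r))].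
have mG : measurable G.
  rewrite -[X in measurable X]setTI.
  apply: (measurableT_comp mf) => //.
  by apply: measurable_complexM; [exact: measurable_expi|exact: measurable_cst].
rewrite (_ : [set x | _] = [set x | G (x + c)]); last first.
  by apply/seteqP; split => x; rewrite /G/= expiD -mulrA -zE.
rewrite !uniform_prob_itv0//; last exact: measurable_shift.
by rewrite lebesgue_periodic_shift// => x; rewrite /G/= expiD2pi.
Qed.

End circle.

(** * Law and tails of [omega1] *)

Section omega_law.
Context {R : realType} (n : nat) (d : measure_display) (T : measurableType d)
  (P : probability T R).
Local Notation N := (n.+2).
Local Notation nu := (beta_prob 1 n.+1 : probability (measurableTypeR R) R).
Local Notation sN := ((Num.sqrt N%:R)%:C : R[i]).
Variables (U : {RV P >-> 'M[R[i]]_N}) (v : {RV P >-> 'cV[R[i]]_N}).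
Hypotheses (U_haar : haar_unitary P U)
  (v_unit : forall t, (v t) ^t* *m v t = 1%:M) (Uv_indep : independent_RV P U v).

Let HU : haar_unitary P (U : T -> 'M[R[i]]_(1 + n.+1)) := U_haar.

Let mU i j : measurable_fun setT (fun t => U t i j).
Proof. by have /measurable_mxP := haar_measurable U_haar; exact. Qed.

Lemma e1_entry m (M : 'M[R[i]]_(1 + m)) : (e1 ^t* *m M *m e1) 0 0 = M 0 0.
Proof. by rewrite e1E trmx_delta map_delta_mx -rowE -colE !mxE. Qed.

Lemma measurable_sesqui m d' (T' : measurableType d') (y : T' -> 'cV[R[i]]_m)
    (M : T' -> 'M[R[i]]_m) : measurable_fun setT y -> measurable_fun setT M ->
  measurable_fun setT (fun t => omega1 (M t) (y t)).
Proof.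
move=> my mM; apply: measurable_complexM; first exact: measurable_cst.
have mD : measurable_fun setT (fun t => (y t) ^t* *m (M t) ^t* *m y t).
  by apply: measurable_mulmx => //; apply: measurable_mulmx; exact: measurable_trmxC.
by have /measurable_mxP := mD; exact.
Qed.

(** For frozen [v = S *m e1] this is the corner entry of the adjoint of a conjugate of [U]; the law
    is invariant under conjugation and under the adjoint. *)
Lemma omega1_entry A : measurable A ->
  P [set t | A (omega1 (U t) (v t))] = P [set t | A (sN * U t 0 0)].
Proof.
move=> mA.
pose B' := [set M : 'M[R[i]]_(1 + n.+1) | A (sN * M 0 0)].
have mB' : measurable B'.
  rewrite -[X in measurable X]setTI.
  apply: (measurable_complexM (f := cst sN) (g := fun M : 'M[R[i]]_(1 + n.+1) => M 0 0)) => //.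
  by have /measurable_mxP := @measurable_id _ 'M[R[i]]_(1 + n.+1) setT; exact.
pose B := [set M : 'M[R[i]]_(1 + n.+1) | B' (M ^t*)].
have mB : measurable B by rewrite -[X in measurable X]setTI; exact: measurable_trmxC.
apply: (independent_prob (B := [set x : 'cV[R[i]]_N * 'M[R[i]]_N | A (omega1 x.2 x.1)])
  Uv_indep).
  rewrite -[X in measurable X]setTI.
  exact: (measurable_sesqui measurable_fst measurable_snd).
move=> t; have [S Su Se] := unitary_col (v_unit t : (v t : 'cV_(1 + n.+1)) ^t* *m v t = 1%:M).
apply: etrans (esym (haar_trmxC HU HU mB')).
apply: etrans (haar_conj HU Su mB).
congr (P _); apply/seteqP; split => s; rewrite /B /B' /omega1 /= -Se;
  by rewrite -(e1_entry (_ ^t*)) !trmxC_mulmx trmxCK !mulmxA.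
Qed.

(** The phase is not extracted from [U]. An independent uniform [x] is introduced through
    [(expi x)%:M *m U], which has the law of [U] for each [x]; after the exchange of integrals it
    absorbs the argument of the entry and leaves the modulus, whose square has the beta law. *)
Lemma omega1_phase A : measurable A ->
  P [set t | A (omega1 (U t) (v t))] =
  phase_beta_law n.+1 (phase_beta N @^-1` A).
Proof.
move=> mA.
have mf (w : R[i]) : measurable_fun setT (fun z : R[i] => w * z).
  by apply: measurable_complexM; [exact: measurable_cst|exact: measurable_id].
have mscal (f : T -> R[i]) : measurable_fun setT f ->
    measurable_fun setT (fun x : R * T => sN * (expi x.1 * f x.2)).
  move=> mg; apply: measurableT_comp (mf sN) _; apply: measurable_complexM.
    exact: measurableT_comp measurable_expi measurable_fst.
  exact: measurableT_comp mg measurable_snd.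
have mX : measurable_fun setT (fun t => nsq (U t 0 0)) by exact: measurable_nsq.
pose unif := uniform_prob (@twopi_gt0 R) : probability (measurableTypeR R) R.
rewrite omega1_entry//.
transitivity (\int[unif]_x P [set t | A (sN * (expi x * U t 0 0))%R])%E.
  rewrite -[LHS](integral_prob_cst unif); apply: eq_integral => x _.
  have mB : measurable [set M : 'M[R[i]]_N | A (sN * M 0 0)].
    rewrite -[X in measurable X]setTI; apply: (measurableT_comp (mf sN)) => //.
    by have /measurable_mxP := @measurable_id _ 'M[R[i]]_N setT; exact.
  apply: etrans (esym (haar_mull U_haar (expi_unitary N x) mB)) _.
  by congr (P _); apply/seteqP; split => t /=; rewrite mul_scalar_mx mxE.
rewrite (fubini_prob unif P (mscal _ (mU 0 0)) mA).
transitivity (\int[P]_t unif [set x | A (sN * (expi x * (Num.sqrt (nsq (U t 0 0)))%:C))%R])%E.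
  apply: eq_integral => t _.
  have -> : Num.sqrt (nsq (U t 0 0)) = Normc.normc (U t 0 0) by case: (U t 0 0).
  exact: (uniform_phase_invariant (U t 0 0) (mf sN) mA).
rewrite -(fubini_prob unif P (mscal _ (measurable_realC (measurable_sqrt mX))) mA).
rewrite /phase_beta_law product_prob; apply: eq_integral => x _.
rewrite /phase_beta /=.
pose B := [set y : R | A (sN * (expi x * (Num.sqrt y)%:C))].
have mB : measurable B.
  rewrite -[X in measurable X]setTI; apply: (measurableT_comp (mf sN)) => //.
  apply: measurableT_comp (mf (expi x)) _; apply: measurable_realC.
  by apply: continuous_measurable_fun; exact: sqrt_continuous.
transitivity (nu B); last first.
  by congr (beta_prob _ _ _); apply/seteqP; split => y; rewrite /B /= mulrA.
apply: (law_beta (X := fun t => nsq (U t 0 0))) => //.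
- by move=> t; rewrite nsq_ge0 (nsq_col_le1 HU).
- exact: (col_moment0 P (U : T -> 'M[R[i]]_(1 + n.+1))).
- exact: (col_momentS HU).
Qed.

Lemma measurable_phase_beta m : measurable_fun setT (@phase_beta R m).
Proof.
apply: measurable_complexM; last first.
  by apply: measurable_realC; apply: measurable_sqrt; exact: measurable_snd.
apply: measurable_complexM; first exact: measurable_cst.
exact: measurableT_comp measurable_expi measurable_fst.
Qed.

Lemma eq_dist_omega1 : eq_dist P (fun t => omega1 (U t) (v t))
  (phase_beta_law n.+1) (phase_beta N).
Proof.
split; [|exact: measurable_phase_beta|exact: omega1_phase].
by apply: measurable_sesqui.
Qed.

Let mom : measurable_fun setT (fun t => omega1 (U t) (v t)).
Proof. exact: measurable_sesqui. Qed.

Lemma measurable_omega1_window (c C : R) :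
  measurable [set t | c < Normc.normc (omega1 (U t) (v t)) < C] /\
  measurable [set t | c <= Normc.normc (omega1 (U t) (v t)) <= C].
Proof.
have mn := measurable_normc mom; split.
- rewrite (_ : [set t | _] = (fun t => Normc.normc (omega1 (U t) (v t))) @^-1` `]c, C[).
    by rewrite -[X in measurable X]setTI; exact: mn.
  by apply/seteqP; split => t /=; rewrite in_itv.
- rewrite (_ : [set t | _] = (fun t => Normc.normc (omega1 (U t) (v t))) @^-1` `[c, C]).
    by rewrite -[X in measurable X]setTI; exact: mn.
  by apply/seteqP; split => t /=; rewrite in_itv.
Qed.

Lemma entry_small_prob (a : R) : 0 < a ->
  (P [set t | (nsq (U t 0 0) <= a)%R] <= (n.+1%:R * (2 * a))%:E)%E.
Proof.
move=> a0; have mX : measurable_fun setT (fun t => nsq (U t 0 0)) by exact: measurable_nsq.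
(* The window []-a, a]] fits the half-open interval bound and contains the value [0]; hence the
   factor [2]. *)
rewrite (_ : [set t | _] = (fun t => nsq (U t 0 0)) @^-1` `](- a)%R, a]%classic); last first.
  apply/seteqP; split => t /=; rewrite in_itv/=; last by case/andP.
  by move=> ->; rewrite andbT (lt_le_trans _ (nsq_ge0 _))// oppr_lt0.
rewrite (law_beta (n := n) mX _ (col_moment0 P (U : T -> 'M[R[i]]_(1 + n.+1))) (col_momentS HU))//;
  last by move=> t; rewrite nsq_ge0 (nsq_col_le1 HU).
have aa : - a <= a by lra.
by apply: le_trans (beta_prob_itv_le n aa) _; rewrite lee_fin (_ : a - - a = 2 * a)//; ring.
Qed.

(** The lower tail comes from the bounded beta density. The upper tail is the Markov bound with
    [p = 1] at half the threshold, since it concerns a strict inequality; this gives [4 / C^2]. *)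
Lemma omega1_window (c C : R) : 0 < c -> 0 < C ->
  ((1 - (2 * c ^+ 2 + 4 / C ^+ 2))%:E <=
    P [set t | (c < Normc.normc (omega1 (U t) (v t)) < C)%R])%E.
Proof.
move=> c0 C0; pose A := [set z : R[i] | c < Normc.normc z < C].
have N0 : 0 < N%:R :> R by [].
have sN0 : 0 < Num.sqrt N%:R :> R by rewrite sqrtr_gt0.
have sN2 : Num.sqrt N%:R ^+ 2 = N%:R :> R by rewrite sqr_sqrtr// ltW.
have mA : measurable A.
  rewrite (_ : A = (@Normc.normc R) @^-1` `]c, C[); last first.
    by apply/seteqP; split => t /=; rewrite in_itv.
  by rewrite -[X in measurable X]setTI; apply: (measurable_normc (f := id)).
rewrite (omega1_entry mA).
set Om := [set t | _].
have mOm : measurable Om.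
  rewrite -[X in measurable X]setTI.
  exact: (measurable_complexM (f := cst sN) (measurable_cst _) (mU 0 0)).
pose E1 := [set t | nsq (U t 0 0) <= c ^+ 2 / N%:R].
pose g := C / (2 * Num.sqrt N%:R).
pose E2 := [set t | g < Normc.normc (U t 0 0)].
have g0 : 0 < g by rewrite divr_gt0// mulr_gt0.
have mE1 : measurable E1 by apply: measurable_le_set; exact: measurable_nsq.
have mE2 : measurable E2 by apply: measurable_normc_gt; exact: mU.
have sub : ~` Om `<=` E1 `|` E2.
  move=> t; rewrite /Om /A /= Normc.normcM normc_real ?ltW// => /negP.
  rewrite negb_and -!leNgt; case/orP => h; [left|right].
    rewrite /E1/= nsq_normc ler_pdivlMr// -sN2 -exprMn [_ * Num.sqrt _]mulrC.
    have sN0' := ltW sN0; have c0' := ltW c0.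
    by rewrite lerXn2r ?nnegrE ?mulr_ge0 ?normc_ge0.
  rewrite /E2/= /g ltr_pdivrMr ?mulr_gt0//.
  rewrite mulrCA [_ * Num.sqrt _]mulrC (lt_le_trans _ (_ : 2 * C <= _))//.
    by rewrite ltr_pMl// ltr1n.
  by rewrite ler_wpM2l.
have P1 : (P E1 <= (2 * c ^+ 2)%:E)%E.
  apply: le_trans (entry_small_prob _) _; first by rewrite divr_gt0// exprn_gt0.
  rewrite lee_fin mulrCA ler_wpM2l// mulrC -mulrA mulrC ler_piMl ?sqr_ge0//.
  by rewrite mulrC ler_pdivrMr// mul1r ler_nat.
have P2 : (P E2 <= (4 / C ^+ 2)%:E)%E.
  apply: le_trans (haar_entry_tail (n := n.+1) HU 1 g0) _.
  rewrite lee_fin (_ : 1`! = 1%N)// expr1 /g expr_div_n exprMn sN2.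
  by rewrite le_eqVlt; apply/orP; left; apply/eqP; field; rewrite ?gt_eqF.
have PC : (P (~` Om) <= (2 * c ^+ 2 + 4 / C ^+ 2)%:E)%E.
  apply: le_trans (le_measure _ _ _ sub) _; rewrite ?inE.
  - exact: measurableC.
  - exact: measurableU.
  by rewrite EFinD; apply: le_trans (measureU2 _ mE1 mE2) _; apply: leeD.
have := PC; rewrite probability_setC// -(fineK (fin_num_measure P Om mOm)) -EFinB !lee_fin.
by rewrite lerBlDr -lerBlDl.
Qed.

End omega_law.

Section order.
Context {R : realType} (d : nat -> measure_display)
    (T : forall N, measurableType (d N)) (P : forall N, probability (T N) R)
    (U : forall N, {RV (P N) >-> 'M[R[i]]_N})
    (v : forall N, {RV (P N) >-> 'cV[R[i]]_N}).
Hypotheses (U_haar : forall N, (0 < N)%N -> haar_unitary (P N) (U N))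
    (v_unit : forall N, (0 < N)%N -> forall t, (v N t) ^t* *m v N t = 1%:M)
    (Uv_indep : forall N, (0 < N)%N -> independent_RV (P N) (U N) (v N)).
Local Notation omega := (fun N => fun t : T N => omega1 (U N t) (v N t)).

Lemma omega1_order_one : order_one P omega.
Proof.
(* With these values [2 c^2] and [4 / C^2] are both [eta / 2]. *)
move=> eta eta0; exists (Num.sqrt (eta / 4)), (Num.sqrt (8 / eta)).
have c0 : 0 < Num.sqrt (eta / 4) by rewrite sqrtr_gt0 divr_gt0.
have C0 : 0 < Num.sqrt (8 / eta) by rewrite sqrtr_gt0 divr_gt0.
split=> //; exists 2%N => // -[|[|n]]// _.
have [mo mc] := measurable_omega1_window (U n.+2) (v n.+2)
  (Num.sqrt (eta / 4)) (Num.sqrt (8 / eta)).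
rewrite (_ : [set t | _] = [set t | Num.sqrt (eta / 4) <=
    Normc.normc (omega1 (U n.+2 t) (v n.+2 t)) <= Num.sqrt (8 / eta)]); last first.
  by apply/seteqP; split => t /=; rewrite normcE !lecR.
split=> //.
apply: le_trans (le_trans (omega1_window (U_haar (ltn0Sn n.+1)) (v_unit (ltn0Sn n.+1))
  (Uv_indep (ltn0Sn n.+1)) c0 C0) _).
  rewrite lee_fin !sqr_sqrtr ?divr_ge0 ?(ltW eta0)// le_eqVlt; apply/orP; left.
  by apply/eqP; field; rewrite gt_eqF.
by apply: le_measure; rewrite ?inE// => t /= /andP[/ltW -> /ltW ->].
Qed.

Lemma omega1_regularity : omega1_regular P omega.
Proof.
move=> eps eps0; pose Om N := [set t : T N |
  N%:R `^ (- eps) < Normc.normc (omega1 (U N t) (v N t)) < N%:R `^ eps].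
have OmE N : [set t | (N%:R `^ (- eps))%:C < `|omega1 (U N t) (v N t)| < (N%:R `^ eps)%:C] = Om N.
  by apply/seteqP; split => t /=; rewrite normcE !ltcR.
have mOm n : measurable (Om n.+2).
  by have [] := measurable_omega1_window (U n.+2) (v n.+2)
    (n.+2%:R `^ (- eps)) (n.+2%:R `^ eps).
split; first by exists 2%N => // -[|[|n]]// _; rewrite OmE.
apply/fine_cvgP; split.
  by exists 2%N => // -[|[|n]]// _ /=; rewrite OmE fin_num_measure.
apply/cvgrPdist_le => eta eta0.
(* For [x = N^eps] the exceptional probability is at most [6 / x^2 <= 6 / x], hence at most [eta]
   once [x >= K]. *)
pose K := 1 + 6 / eta.
have K1 : 1 <= K by rewrite lerDl divr_ge0// ltW.
have K0 : 0 < K by apply: lt_le_trans K1.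
exists (maxn 2 (Num.truncn (K `^ eps^-1)).+1) => // N.
rewrite /= geq_max; case: N => [|[|n]]// /andP[_ nK]; rewrite OmE.
have KN : K <= n.+2%:R `^ eps.
  have h : K `^ eps^-1 <= n.+2%:R.
    by apply: ltW; apply: lt_le_trans (truncnS_gt _) _; rewrite ler_nat.
  have := ge0_ler_powR (ltW eps0) _ _ h; rewrite !nnegrE powR_ge0 ler0n => /(_ isT isT).
  by rewrite -powRrM mulVf ?gt_eqF// powRr1// ltW.
have N0 : 0 < n.+2%:R `^ eps :> R by apply: lt_le_trans KN.
have V0 : 0 < n.+2%:R `^ (- eps) :> R by rewrite powRN invr_gt0.
have := omega1_window (U_haar (ltn0Sn n.+1)) (v_unit (ltn0Sn n.+1))
  (Uv_indep (ltn0Sn n.+1)) V0 N0.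
rewrite -[X in (_ <= X)%E](fineK (fin_num_measure _ _ (mOm n))) lee_fin => H.
have p1 : fine (P n.+2 (Om n.+2)) <= 1.
  by rewrite -lee_fin fineK ?fin_num_measure// probability_le1.
rewrite ger0_norm ?subr_ge0// lerBlDl -lerBlDr; apply: le_trans H.
rewrite lerD2l lerN2 powRN.
move: (n.+2%:R `^ eps) N0 KN => x x0 Kx.
rewrite exprVn -mulrDl (_ : 2 + 4 = 6); last by ring.
rewrite ler_pdivrMr ?exprn_gt0// mulrC -ler_pdivrMr//.
apply: (@le_trans _ _ x); first by apply: le_trans Kx; rewrite /K lerDr.
by have x0' := ltW x0; rewrite expr2 ler_peMl// (le_trans K1).
Qed.

End order.

Theorem theorem10 (R : realType) (d : nat -> measure_display)
    (T : forall N, measurableType (d N)) (P : forall N, probability (T N) R)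
    (U : forall N, {RV (P N) >-> 'M[R[i]]_N})
    (v : forall N, {RV (P N) >-> 'cV[R[i]]_N})
    (U_haar : forall N, (0 < N)%N -> haar_unitary (P N) (U N))
    (v_unit : forall N, (0 < N)%N -> forall t, (v N t) ^t* *m v N t = 1%:M)
    (Uv_indep : forall N, (0 < N)%N -> independent_RV (P N) (U N) (v N)) :
  let omega N := fun t : T N => omega1 (U N t) (v N t) in
  let W N := fun (z : R[i]) (t : T N) => W2 (U N t) (v N t) z in
  [/\ W2_regular P W,
      omega1_regular P omega,
      (forall N, (1 < N)%N ->
        eq_dist (P N) (omega N) (phase_beta_law N.-1) (phase_beta N)),
      order_one P omega
    & forall delta : R, 0 < delta ->
        stoch_dom P W W2_bound
          (fun N => [set z | (N%:R `^ (- delta))%:C < 1 - `|z|])].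
Proof.
move=> omega W.
have rho1 delta : \forall N \near \oo, 1 - N%:R `^ (- delta) <= 1 :> R.
  by apply: nearW => N; rewrite gerBl powR_ge0.
split.
- move=> delta delta0; apply: (W2_stoch_dom U_haar v_unit Uv_indep
    (rho := fun N => 1 - N%:R `^ (- delta))).
  apply: filterS (rho1 delta) => N h; split=> // z.
  by rewrite /= normcE ltcR.
- exact: omega1_regularity.
- by case=> [|[|n]]// _; apply: eq_dist_omega1; [exact: U_haar|exact: v_unit|exact: Uv_indep].
- exact: omega1_order_one.
- move=> delta delta0; apply: (W2_stoch_dom U_haar v_unit Uv_indep
    (rho := fun N => 1 - N%:R `^ (- delta))).
  apply: filterS (rho1 delta) => N h; split=> // z.
  rewrite /= (_ : 1 - `|z| = (1 - Normc.normc z)%:C); last by rewrite normcE rmorphB rmorph1.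
  by rewrite ltcR ltrBrDl ltrBrDr.
Qed.
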